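(* Let $G=(X,w,\kappa,\mu)$ be a graph satisfying stochastic completeness at infinity and let $\phi\in\mathcal I$. Assume that either $\mu(X):=\sum_{x\in X}\mu(x)<\infty$ or $\limsup_{r\downarrow0}\frac{\phi(r)}{r}<\infty$. Let $T>0$, let $u_0\in\ell^1(X,\mu)$ with $u_0\ge0$, and let $u\ge0$ be a pointwise solution of (GPME) on $[0,T]\times X$ with initial datum $u_0$ such that $u\in C([0,T];\ell^1(X,\mu))$, $u(0)=u_0$, and $$\sup_{(s,x)\in[\tau,T]\times X}u(s,x)<\infty\qquad\text{for every }\tau\in(0,T).$$ Then $u$ satisfies the generalized mass balance $$\sum_{x\in X}u(t,x)\mu(x)+\int_0^t\sum_{x\in X}\kappa(x)\,\phi(u(s,x))\,ds=\sum_{x\in X}u_0(x)\mu(x)\qquad\text{for all }0\le t\le T.$$ In particular, $\mathsf M_u(t)=\sum_{x\in X}u(t,x)\mu(x)$ is absolutely continuous on $[0,T]$ and $\mathsf M_u'(t)=-\sum_{x\in X}\kappa(x)\phi(u(t,x))$ for almost every $t\in(0,T)$.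
   Context: Graph: $G=(X,w,\kappa,\mu)$ where $X$ is a countable set, $\mu\colon X\to(0,\infty)$, $w\colon X\times X\to[0,\infty)$ is symmetric with $w(x,x)=0$ and $\sum_{y\in X}w(x,y)<\infty$ for every $x\in X$, and $\kappa\colon X\to[0,\infty)$ (killing term). Graphs are always assumed connected: any $x,y\in X$ are joined by a finite path $x=x_0,\dots,x_N=y$ with $w(x_i,x_{i+1})>0$ for all $i$. No local finiteness is assumed. $\ell^1(X,\mu)$ is the set of $f\colon X\to\mathbb R$ with $\|f\|_1=\sum_x|f(x)|\mu(x)<\infty$; $C([0,T];\ell^1(X,\mu))$ denotes functions continuous in time with respect to $\|\cdot\|_1$. Laplacian: $\mathcal F$ is the set of $f\colon X\to\mathbb R$ with $\sum_{y}w(x,y)|f(y)|<\infty$ for every $x$; for $f\in\mathcal F$, $\Delta f(x)=\frac1{\mu(x)}\sum_{y\in X}w(x,y)(f(x)-f(y))+\frac{\kappa(x)}{\mu(x)}f(x)$. Stochastic completeness at infinity: let $L$ be the positive self-adjoint operator on $\ell^2(X,\mu)$ associated with the closure of the form $Q(f,g)=\frac12\sum_{x,y}w(x,y)(f(x)-f(y))(g(x)-g(y))+\sum_x\kappa(x)f(x)g(x)$ defined on finitely supported functions. The semigroup $e^{-tL}$ is positivity preserving and is extended to functions $f\ge0$ by $e^{-tL}f=\lim_n e^{-tL}f_n\in[0,\infty]$ for finitely supported $0\le f_n\uparrow f$. $G$ satisfies stochastic completeness at infinity if for some (and hence all) $t>0$, $e^{-tL}1+\int_0^te^{-sL}(\kappa/\mu)\,ds=1$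 pointwise on $X$. Nonlinearities: $\mathcal I$ is the set of continuous, increasing (in the weak sense: $s_1<s_2$ implies $\phi(s_1)\le\phi(s_2)$), nonconstant $\phi\colon\mathbb R\to\mathbb R$ with $\phi(0)=0$. Pointwise solutions: (GPME) is the Cauchy problem $\partial_tu+\Delta(\phi\circ u)=0$, $u|_{t=0}=u_0$. A pointwise solution on $[0,T]\times X$ with initial datum $u_0\colon X\to\mathbb R$ is a function $u\colon[0,T]\times X\to\mathbb R$ such that $\phi\circ u(t,\cdot)\in\mathcal F$ for every $t\in(0,T)$; $u(\cdot,x)\in C([0,T])\cap C^1((0,T))$ for every $x$; $\partial_tu(t,x)+\Delta(\phi\circ u(t,\cdot))(x)=0$ for all $(t,x)\in(0,T)\times X$; and $u(0,x)=u_0(x)$ for all $x$. *)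

(* Defs.v *)
From HB Require Import structures.
From mathcomp Require Export all_boot all_order all_algebra.
From mathcomp Require Export all_classical all_reals all_analysis.

Set Implicit Arguments.
Unset Strict Implicit.
Unset Printing Implicit Defensive.

Export Order.TTheory GRing.Theory Num.Theory.
Export numFieldNormedType.Exports.
Global Open Scope classical_set_scope.
Global Open Scope ring_scope.

Record graph (R : realType) (X : countType) := Graph {
  gw : X -> X -> R;
  gkappa : X -> R;
  gmu : X -> R;
  gmu_gt0 : forall x, 0 < gmu x;
  gw_ge0 : forall x y, 0 <= gw x y;
  gw_sym : forall x y, gw x y = gw y x;
  gw_diag : forall x, gw x x = 0;
  gw_summable : forall x, (\esum_(y in [set: X]) (gw x y)%:E < +oo)%E;
  gkappa_ge0 : forall x, 0 <= gkappa x;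
  gconnected : forall x y, exists p : seq X,
    path (fun a b => 0 < gw a b) x p /\ last x p = y
}.

(* Sum of an absolutely summable real family; [esum] itself is only meaningful
   for families of nonnegative terms. *)
Definition rsum (R : realType) (I : choiceType) (a : I -> R) : R :=
  fine (\esum_(i in [set: I]) (Num.max (a i) 0)%:E)
  - fine (\esum_(i in [set: I]) (Num.max (- a i) 0)%:E).

Section Graph.
Variables (R : realType) (X : countType) (G : graph R X).
Local Notation w := (gw G).
Local Notation kappa := (gkappa G).
Local Notation mu := (gmu G).
Implicit Types (f g h : X -> R) (S : R -> (X -> R) -> X -> R).

Definition norm1 f : \bar R := \esum_(x in [set: X]) (`|f x| * mu x)%:E.
Definition ell1 f : Prop := (norm1 f < +oo)%E.

Definition norm2 f : \bar R :=
  sqrte (\esum_(x in [set: X]) (f x ^+ 2 * mu x)%:E).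
Definition ell2 f : Prop := (norm2 f < +oo)%E.
Definition inner2 f g : R := rsum (fun x => f x * g x * mu x).

Definition total_measure : \bar R := \esum_(x in [set: X]) (mu x)%:E.

Definition lap_dom f : Prop :=
  forall x, (\esum_(y in [set: X]) (w x y * `|f y|)%:E < +oo)%E.

Definition lap f (x : X) : R :=
  (mu x)^-1 * rsum (fun y => w x y * (f x - f y)) + kappa x / mu x * f x.

Definition fin_supp f : Prop := finite_set [set x | f x != 0].

Definition form f g : R :=
  2^-1 * rsum (fun p : X * X =>
    w p.1 p.2 * (f p.1 - f p.2) * (g p.1 - g p.2))
  + rsum (fun x => kappa x * f x * g x).

Definition form_approx f (fn : nat -> X -> R) : Prop :=
  [/\ forall n, fin_supp (fn n),
      norm2 (fn n \- f) @[n --> \oo] --> 0%E &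
      form (fn nm.1 \- fn nm.2) (fn nm.1 \- fn nm.2)
        @[nm --> (\oo, \oo)] --> (0 : R)].

Definition closed_form_dom f : Prop :=
  ell2 f /\ exists fn, form_approx f fn.

(* [closed_form f g q]: the closure of [form] takes the value [q] at [(f, g)]. *)
Definition closed_form f g (q : R) : Prop :=
  exists fn gn, [/\ form_approx f fn, form_approx g gn &
                    form (fn n) (gn n) @[n --> \oo] --> q].

(* The graph of L, i.e. "f is in the domain of L and L f = h". *)
Definition L_graph f h : Prop :=
  [/\ closed_form_dom f, ell2 h &
      forall g, closed_form_dom g -> closed_form f g (inner2 h g)].

(* [S t] is e^{-tL}: S is the strongly continuous semigroup of bounded
   operators on l^2(X, mu) with generator -L; its values for t < 0 or outside
   l^2(X, mu) are irrelevant. *)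
Definition heat_semigroup S : Prop :=
  [/\ forall (t : R) f, 0 <= t -> ell2 f -> ell2 (S t f),
      forall (t a : R) f g, 0 <= t -> ell2 f -> ell2 g ->
        S t (fun x => a * f x + g x) = (fun x => a * S t f x + S t g x),
      forall t : R, 0 <= t -> exists M : R, forall f, ell2 f ->
        (norm2 (S t f) <= M%:E * norm2 f)%E &
      [/\ forall f, ell2 f -> S 0 f = f,
          forall (s t : R) f, 0 <= s -> 0 <= t -> ell2 f ->
            S (s + t) f = S s (S t f),
          forall f, ell2 f -> norm2 (S t f \- f) @[t --> 0^'+] --> 0%E &
          forall f h, ell2 f -> ell2 h ->
            (L_graph f h <->
             norm2 (fun x => (S t f x - f x) / t + h x) @[t --> 0^'+]
               --> 0%E)]].

Definition trunc_enum f (n : nat) : X -> R :=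
  fun x => if (pickle x < n)%N then f x else 0.

(* e^{-tL} f for f >= 0: the limit along finitely supported functions
   increasing to f does not depend on their choice; truncations along the
   enumeration of X are used. *)
Definition semigroup_ext S (t : R) f (x : X) : \bar R :=
  lim ((S t (trunc_enum f n) x)%:E @[n --> \oo]).

Definition stochastically_complete_at_infinity : Prop :=
  exists S, heat_semigroup S /\
  exists t : R, 0 < t /\ forall x : X,
    (semigroup_ext S t (fun=> 1%R) x
     + \int[lebesgue_measure]_(s in `[0%R, t])
         semigroup_ext S s (fun y => (kappa y / mu y)%R) x = 1)%E.

(* A function on [0,T] * X is represented by a total [u : R -> X -> R]; only
   its values on [0,T] matter. *)
Definition pointwise_solution (phi : R -> R) (T : R) (u0 : X -> R)
    (u : R -> X -> R) : Prop :=
  [/\ forall t : R, t \in `]0, T[ -> lap_dom (phi \o u t),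
      forall x, [/\ {within `[0, T], continuous (u^~ x)},
        forall t : R, t \in `]0, T[ -> derivable (u^~ x) t 1 &
        {in `]0, T[, continuous (fun t => derive1 (u^~ x) t)}],
      forall (t : R) x, t \in `]0, T[ -> derive1 (u^~ x) t + lap (phi \o u t) x = 0 &
      forall x, u 0 x = u0 x].

Definition continuous_ell1 (T : R) (u : R -> X -> R) : Prop :=
  forall t : R, t \in `[0, T] -> ell1 (u t) /\
    norm1 (u s \- u t) @[s --> within `[0, T] (nbhs t)] --> 0%E.

Definition mass (u : R -> X -> R) (t : R) : \bar R :=
  \esum_(x in [set: X]) (u t x * mu x)%:E.

Definition killing_rate (phi : R -> R) (u : R -> X -> R) (t : R) : \bar R :=
  \esum_(x in [set: X]) (kappa x * phi (u t x))%:E.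

End Graph.

Definition nonlinearity (R : realType) (phi : R -> R) : Prop :=
  [/\ continuous phi, {homo phi : x y / x <= y},
      exists a b, phi a != phi b & phi 0 = 0].

Definition absolutely_continuous (R : realType) (a b : R) (f : R -> R) : Prop :=
  forall e : R, 0 < e -> exists2 d : R, 0 < d &
  forall (n : nat) (x y : 'I_n -> R),
    (forall i, [/\ a <= x i, x i <= y i & y i <= b]) ->
    trivIset [set: 'I_n] (fun i => [set` `]x i, y i[]) ->
    \sum_(i < n) (y i - x i) < d ->
    \sum_(i < n) `|f (y i) - f (x i)| < e.

(* Main.v *)
Require Import Defs.
From mathcomp Require Import measurable_realfun ring lra.
Set Implicit Arguments.
Unset Strict Implicit.
Unset Printing Implicit Defensive.

(* Write H = mu Delta, and let e_n, with values in [0, 1], solve the Dirichlet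
   problem (H + mu) e_n = mu + kappa on the n-th set of a finite exhaustion;
   e_n increases to some e.  Stochastic completeness at infinity forces e = 1:
   if 1 - e <= m, then the functions 1 - (1 - r)^(n - j) (1 - e), 0 <= j <= n,
   solve the implicit Euler scheme of step r = t / n for du/dt + Delta u =
   kappa / mu and dominate 1 - m / (1 + t) at j = 0.  Chernoff's product formula
   turns this into 1 - e <= m / (1 + t), which can be iterated.

   The functions v = int_a^b phi(u(s)) ds are bounded and in l^1, and
   Delta v = u(a) - u(b) is in l^1.  If v_n solves (H + mu) v_n = (H + mu) v on
   the n-th set with zero exterior values, the minimum principle gives
   0 <= v - v_n <= M (1 - e_n), so v_n tends to v, and the symmetry of the
   finite problem, sum v_n (mu + kappa) = sum e_n (H + mu) v, yields
   sum H v = sum kappa v in the limit.  This is the mass balance between the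
   times a and b; let a tend to 0. *)

(** * Absolutely summable families *)

(** The hypothesis speaks of a semigroup given only through its generator, the boundedness of each
    single [S t] and right continuity at 0. Positivity and the bound by 1 have to be recovered: the
    resolvent is built as a limit of finite Dirichlet solutions, so it inherits the minimum
    principle, and Chernoff's formula carries the order properties over to [S t]. That comparison
    needs bounds on [S t] that are uniform on compact time intervals, hence the uniform boundedness
    theorem. In the balance the obstacle is that Green's formula cannot be applied to v and the
    constant 1: neither has finite support and a vertex may have infinitely many neighbours. The
    finitely supported e_n replaces 1, so that all exchanges of sums happen in a finite problem, and
    e = 1 removes it in the limit. The alternative on mu(X) and phi is what puts v in l^1. The times
    a and b stay inside (0, T) because boundedness and the equation are only available there. *)

Lemma cvg_sumr (R : realType) (J T : Type) (F : set_system T) (FF : Filter F)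
    (s : seq J) (f : J -> T -> R) (l : J -> R) :
  (forall j, f j x @[x --> F] --> l j) ->
  \sum_(j <- s) f j x @[x --> F] --> \sum_(j <- s) l j.
Proof.
move=> h; elim: s => [|j s ih].
  by rewrite big_nil; under eq_fun do rewrite big_nil; exact: cvg_cst.
by rewrite big_cons; under eq_fun do rewrite big_cons; exact: cvgD.
Qed.

Section Sums.
Variables (R : realType) (I : choiceType).
Implicit Types (a b p q : I -> R) (s : seq I).

Lemma seq_le_esum (a : I -> \bar R) s : (forall i, 0 <= a i)%E -> uniq s ->
  (\sum_(i <- s) a i <= \esum_(i in [set: I]) a i)%E.
Proof.
move=> a0 us; rewrite /esum; apply: ereal_sup_ubound; exists [set` s].
  by split.
by rewrite -fsbig_seq.
Qed.

Lemma esum_le_seq (a : I -> \bar R) c :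
  (forall s, uniq s -> \sum_(i <- s) a i <= c)%E ->
  (\esum_(i in [set: I]) a i <= c)%E.
Proof.
move=> h; apply: ge_ereal_sup => _ [A [finA _]] <-.
rewrite fsbig_finite//=; apply: h.
exact: finmap.fset_uniq.
Qed.

Definition summ a : Prop := (\esum_(i in [set: I]) `|a i|%:E < +oo)%E.

Lemma summ_bound a (c : R) :
  (forall s, uniq s -> \sum_(i <- s) `|a i| <= c) -> summ a.
Proof.
move=> h; apply: (@le_lt_trans _ _ c%:E); last exact: ltry.
by apply: esum_le_seq => s us; rewrite sumEFin lee_fin h.
Qed.

Lemma summ_le a b : (forall i, `|a i| <= b i) ->
  (\esum_(i in [set: I]) (b i)%:E < +oo)%E -> summ a.
Proof.
move=> ab; apply: le_lt_trans; apply: le_esum => i _; rewrite lee_fin.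
exact: ab.
Qed.

Lemma summ_dom a b : (forall i, `|a i| <= `|b i|) -> summ b -> summ a.
Proof. exact: summ_le. Qed.

Lemma summ_ge0 a : (forall i, 0 <= a i) ->
  summ a = (\esum_(i in [set: I]) (a i)%:E < +oo)%E :> Prop.
Proof.
by move=> a0; rewrite /summ; under eq_esum do rewrite ger0_norm//.
Qed.

Lemma fine_esumK a : (forall i, 0 <= a i) ->
  (\esum_(i in [set: I]) (a i)%:E < +oo)%E ->
  (fine (\esum_(i in [set: I]) (a i)%:E))%:E = (\esum_(i in [set: I]) (a i)%:E)%E.
Proof.
move=> a0 h; rewrite fineK// ge0_fin_numE//; apply: esum_ge0 => i _.
by rewrite lee_fin.
Qed.

Lemma summD a b : summ a -> summ b -> summ (fun i => a i + b i).
Proof.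
move=> sa sb; apply: (@summ_le _ (fun i => `|a i| + `|b i|)) => [i|].
  exact: ler_normD.
under eq_esum do rewrite EFinD.
rewrite esumD//; first by rewrite lte_add_pinfty.
Qed.

Lemma summZ (c : R) a : summ a -> summ (fun i => c * a i).
Proof.
move=> sa.
apply: (@summ_bound _ (`|c| * fine (\esum_(i in [set: I]) `|a i|%:E))).
move=> s us; under eq_bigr do rewrite normrM.
rewrite -mulr_sumr ler_wpM2l// -lee_fin fine_esumK// -sumEFin.
by apply: seq_le_esum => // i; rewrite lee_fin.
Qed.

Lemma summN a : summ a -> summ (fun i => - a i).
Proof. by apply: summ_dom => i; rewrite normrN. Qed.

Lemma summB a b : summ a -> summ b -> summ (fun i => a i - b i).
Proof. by move=> sa /summN; exact: summD. Qed.

Lemma summ0 : summ (fun=> 0).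
Proof.
by apply: (@summ_bound _ 0) => s _; rewrite big1// => i _; rewrite normr0.
Qed.

Lemma summ_fin a s : (forall i, i \notin s -> a i = 0) -> summ a.
Proof.
move=> h; apply: (@summ_bound _ (\sum_(i <- undup s) `|a i|)) => r ur.
rewrite (bigID (mem s))/= [X in _ + X]big1 ?addr0; last first.
  by move=> i /h ->; rewrite normr0.
rewrite -big_filter [leRHS](bigID (mem r))/= -[leLHS]addr0 lerD//; last first.
  exact: sumr_ge0.
rewrite -[leRHS]big_filter le_eqVlt; apply/orP; left; apply/eqP.
apply: perm_big; apply: uniq_perm; rewrite ?filter_uniq ?undup_uniq//.
by move=> i; rewrite !mem_filter/= mem_undup andbC.
Qed.

Lemma esum_fin a s : (forall i, 0 <= a i) -> uniq s ->
  (forall i, i \notin s -> a i = 0) ->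
  (\esum_(i in [set: I]) (a i)%:E = (\sum_(i <- s) a i)%:E)%E.
Proof.
move=> a0 us h; apply/eqP; rewrite eq_le; apply/andP; split; last first.
  by rewrite -sumEFin; apply: seq_le_esum => // i; rewrite lee_fin.
apply: esum_le_seq => r ur; rewrite sumEFin lee_fin.
rewrite (bigID (mem s))/= [X in _ + X]big1 ?addr0; last by move=> i /h.
rewrite -big_filter [leRHS](bigID (mem r))/= -[leLHS]addr0 lerD//; last first.
  exact: sumr_ge0.
rewrite -[leRHS]big_filter le_eqVlt; apply/orP; left; apply/eqP.
apply: perm_big; apply: uniq_perm; rewrite ?filter_uniq ?undup_uniq//.
by move=> i; rewrite !mem_filter/= andbC.
Qed.

Let pos a i := Num.max (a i) 0.
Let neg a i := Num.max (- a i) 0.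
Let pos_ge0 a i : 0 <= pos a i. Proof. by rewrite le_max lexx orbT. Qed.
Let neg_ge0 a i : 0 <= neg a i. Proof. by rewrite le_max lexx orbT. Qed.
Let posB a i : pos a i - neg a i = a i.
Proof. by rewrite /pos /neg; case: ltrP => h; case: ltrP => h'; lra. Qed.

Let pos_le a i : pos a i <= `|a i|.
Proof. by rewrite /pos ge_max normr_ge0 ler_norm. Qed.
Let neg_le a i : neg a i <= `|a i|.
Proof. by rewrite /neg ge_max normr_ge0 -normrN ler_norm. Qed.

(** The identity [pos a + q = p + neg a] relates nonnegative families and can be summed in the
    extended reals. So every decomposition into summable nonnegative parts computes [rsum], which
    reduces additivity to the additivity of [esum]. *)
Lemma rsum_diff p q : (forall i, 0 <= p i) -> (forall i, 0 <= q i) ->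
  summ p -> summ q ->
  rsum (fun i => p i - q i) =
  fine (\esum_(i in [set: I]) (p i)%:E) - fine (\esum_(i in [set: I]) (q i)%:E).
Proof.
move=> p0 q0 sp sq; set a := fun i => p i - q i; rewrite /rsum.
have sa : summ a by exact: summB.
have P : summ (pos a).
  by apply: summ_dom sa => i; rewrite ger0_norm.
have N : summ (neg a) by apply: summ_dom sa => i; rewrite ger0_norm.
rewrite -/(pos a) -/(neg a).
have E : (\esum_(i in [set: I]) (pos a i)%:E + \esum_(i in [set: I]) (q i)%:E =
    \esum_(i in [set: I]) (p i)%:E + \esum_(i in [set: I]) (neg a i)%:E)%E.
  rewrite -!esumD; try by move=> i _; rewrite lee_fin.
  apply: eq_esum => i _; rewrite -!EFinD; congr EFin.
  by have := posB a i; rewrite /a; lra.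
move: sp sq P N; rewrite !summ_ge0// => sp sq P N.
move: E; rewrite -(fine_esumK _ sp)// -(fine_esumK _ sq)//.
rewrite -(fine_esumK _ P)// -(fine_esumK _ N)//.
by rewrite -!EFinD => -[]; rewrite /pos /neg/=; lra.
Qed.

Lemma rsumE_ge0 a : (forall i, 0 <= a i) ->
  rsum a = fine (\esum_(i in [set: I]) (a i)%:E).
Proof.
move=> a0; rewrite /rsum [X in _ - fine X]esum1 ?subr0; last first.
  by move=> i _; rewrite (max_idPr _)// oppr_le0.
by congr fine; apply: eq_esum => i _; rewrite (max_idPl _).
Qed.

Lemma rsum_esum a : (forall i, 0 <= a i) -> summ a ->
  (rsum a)%:E = (\esum_(i in [set: I]) (a i)%:E)%E.
Proof. by move=> a0; rewrite summ_ge0// => h; rewrite rsumE_ge0 // fine_esumK. Qed.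

Lemma eq_rsum a b : a =1 b -> rsum a = rsum b.
Proof. by move=> /funext ->. Qed.

Lemma rsumD a b : summ a -> summ b ->
  rsum (fun i => a i + b i) = rsum a + rsum b.
Proof.
move=> sa sb.
have sp c : summ c -> summ (pos c).
  by move=> sc; apply: summ_dom sc => i; rewrite ger0_norm.
have sn c : summ c -> summ (neg c).
  by move=> sc; apply: summ_dom sc => i; rewrite ger0_norm.
have -> : rsum (fun i => a i + b i) =
  rsum (fun i => (pos a i + pos b i) - (neg a i + neg b i)).
  by apply: eq_rsum => i; rewrite -[in LHS](posB a) -[in LHS](posB b); ring.
rewrite rsum_diff; [|by move=> i; exact: addr_ge0..|exact: summD (sp _ _) (sp _ _)|
  exact: summD (sn _ _) (sn _ _)].
under [X in fine X - _]eq_esum do rewrite EFinD.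
under [X in _ - fine X]eq_esum do rewrite EFinD.
rewrite !esumD; try by move=> i _; rewrite lee_fin.
rewrite /rsum.
move: (sp _ sa) (sp _ sb) (sn _ sa) (sn _ sb); rewrite !summ_ge0// => h1 h2 h3 h4.
rewrite !fineD ?ge0_fin_numE//; try by apply: esum_ge0 => i _; rewrite lee_fin.
rewrite /pos /neg; ring.
Qed.

Lemma rsumN a : rsum (fun i => - a i) = - rsum a.
Proof. 
rewrite /rsum opprB; congr (_ - _).
by congr fine; apply: eq_esum => i _; rewrite opprK. Qed.

Lemma rsumB a b : summ a -> summ b ->
  rsum (fun i => a i - b i) = rsum a - rsum b.
Proof. by move=> sa sb; rewrite rsumD ?rsumN//; exact: summN. Qed.

Lemma rsum0 : rsum (fun _ : I => 0 : R) = 0.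
Proof. by rewrite rsumE_ge0// esum1. Qed.

Lemma rsum_ge0 a : (forall i, 0 <= a i) -> 0 <= rsum a.
Proof.
move=> a0; rewrite rsumE_ge0// fine_ge0// esum_ge0// => i _.
by rewrite lee_fin.
Qed.

Lemma ler_rsum a b : summ a -> summ b -> (forall i, a i <= b i) ->
  rsum a <= rsum b.
Proof.
move=> sa sb ab; rewrite -subr_ge0 -rsumB//; apply: rsum_ge0 => i.
by rewrite subr_ge0.
Qed.

Lemma rsum_seq_le a s : (forall i, 0 <= a i) -> summ a -> uniq s ->
  \sum_(i <- s) a i <= rsum a.
Proof.
move=> a0 sa us; rewrite -lee_fin rsum_esum// -sumEFin.
by apply: seq_le_esum => // i; rewrite lee_fin.
Qed.

Lemma rsum_le_seq a c : (forall i, 0 <= a i) ->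
  (forall s, uniq s -> \sum_(i <- s) a i <= c) -> rsum a <= c.
Proof.
move=> a0 h.
have sa : summ a.
  by apply: (@summ_bound _ c) => s /h; apply: le_trans; apply: ler_sum => i _; rewrite ger0_norm.
rewrite -lee_fin rsum_esum//; apply: esum_le_seq => s us.
by rewrite sumEFin lee_fin h.
Qed.

Lemma rsum_seq_gt a e : (forall i, 0 <= a i) -> summ a -> 0 < e ->
  exists s, uniq s /\ rsum a - e < \sum_(i <- s) a i.
Proof.
move=> a0 sa e0; apply: contrapT => h.
suff : rsum a <= rsum a - e by lra.
apply: rsum_le_seq => // s us; rewrite leNgt; apply/negP => k.
by apply: h; exists s.
Qed.

Lemma rsum_fin a s : uniq s -> (forall i, i \notin s -> a i = 0) ->
  rsum a = \sum_(i <- s) a i.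
Proof.
move=> us h; rewrite /rsum (@esum_fin (pos a) s)//; last first.
  by move=> i /h; rewrite /pos => ->; rewrite maxxx.
rewrite (@esum_fin (neg a) s)//; last first.
  by move=> i /h; rewrite /neg => ->; rewrite oppr0 maxxx.
by rewrite /= -sumrB; apply: eq_bigr => i _; rewrite posB.
Qed.

Lemma rsum_disj a s : summ a -> uniq s ->
  rsum a = \sum_(i <- s) a i + rsum (fun i => if i \in s then 0 else a i).
Proof.
move=> sa us.
have sf : summ (fun i => if i \in s then a i else 0).
  by apply: (@summ_fin _ s) => i /negPf ->.
have sg : summ (fun i => if i \in s then 0 else a i).
  by apply: summ_dom sa => i; case: ifP; rewrite ?normr0.
have -> : \sum_(i <- s) a i = rsum (fun i => if i \in s then a i else 0).
  rewrite (@rsum_fin _ s)// => [|i /negPf ->//].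
  by rewrite big_seq [in RHS]big_seq; apply: eq_bigr => i ->.
by rewrite -rsumD//; apply: eq_rsum => i; case: ifP; rewrite ?addr0 ?add0r.
Qed.

Lemma ler_norm_rsum a b : summ b -> (forall i, `|a i| <= b i) ->
  `|rsum a| <= rsum b.
Proof.
move=> sb ab.
have b0 i : 0 <= b i by exact: le_trans (ab i).
have sa : summ a.
  by apply: summ_dom sb => i; rewrite (le_trans (ab i))// ler_norm.
rewrite ler_norml -rsumN; apply/andP; split; apply: ler_rsum => //.
- exact: summN.
- by move=> i; have := ab i; rewrite ler_norml => /andP[].
- by move=> i; have := ab i; rewrite ler_norml => /andP[].
Qed.

Lemma rsumZ (c : R) a : summ a -> rsum (fun i => c * a i) = c * rsum a.
Proof.
(* One inequality suffices: applied to [d] and to [d^-1] it gives equality for nonnegative families;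
   signs of [a] and of [c] are dealt with afterwards. *)
have le d b : 0 < d -> (forall i, 0 <= b i) -> summ b ->
    rsum (fun i => d * b i) <= d * rsum b.
  move=> d0 b0 sb; apply: rsum_le_seq => [i|s us].
    by rewrite mulr_ge0// ltW.
  by rewrite -mulr_sumr ler_pM2l//; apply: rsum_seq_le.
have E0 d b : 0 < d -> (forall i, 0 <= b i) -> summ b ->
    rsum (fun i => d * b i) = d * rsum b.
  move=> d0 b0 sb; apply/eqP; rewrite eq_le le//= -ler_pdivlMl//.
  have <- : rsum (fun i => d^-1 * (d * b i)) = rsum b.
    by apply: eq_rsum => i; rewrite mulKf// gt_eqF.
  apply: le; rewrite ?invr_gt0//; last exact: summZ.
  by move=> i; rewrite mulr_ge0// ltW.
have E d b : 0 < d -> summ b -> rsum (fun i => d * b i) = d * rsum b.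
  move=> d0 sb.
  have sp : summ (pos b) by apply: summ_dom sb => i; rewrite ger0_norm.
  have sn : summ (neg b) by apply: summ_dom sb => i; rewrite ger0_norm.
  have -> : rsum (fun i => d * b i) =
      rsum (fun i => d * pos b i - d * neg b i).
    by apply: eq_rsum => i; rewrite -mulrBr posB.
  rewrite rsumB; [|exact: summZ..].
  by rewrite !E0// -mulrBr -rsumB//; congr (_ * _); apply: eq_rsum => i; rewrite posB.
move=> sa; have [c0|c0|->] := ltgtP c 0; last first.
- by rewrite mul0r -[RHS]rsum0; apply: eq_rsum => i; rewrite mul0r.
- exact: E.
- rewrite -[c]opprK mulNr -E ?oppr_gt0// -rsumN.
  by apply: eq_rsum => i; rewrite mulNr.
Qed.

Lemma rsum_seqD a (e : R) : 0 < e -> summ a ->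
  exists r, uniq r /\ rsum (fun i => if i \in r then 0 else `|a i|) < e.
Proof.
move=> e0 sa.
have sn : summ (fun i => `|a i|) by apply: summ_dom sa => i; rewrite normr_id.
have [r [ur hr]] := rsum_seq_gt (fun i => normr_ge0 (a i)) sn e0.
by exists r; split => //; move: hr; rewrite (rsum_disj sn ur); lra.
Qed.

(** Dominated convergence for sums: the tail of [b] outside a finite set controls all tails
    uniformly, and on the finite set termwise convergence is enough. *)
Lemma rsum_dominated (an : nat -> I -> R) a b : summ b ->
  (forall n i, `|an n i| <= b i) -> (forall i, an n i @[n --> \oo] --> a i) ->
  rsum (an n) @[n --> \oo] --> rsum a.
Proof.
move=> sb hb ha.
have b0 i : 0 <= b i by exact: le_trans (hb 0%N i).
have ab i : `|a i| <= b i.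
  rewrite -(cvg_lim _ (cvg_norm (ha i)))//; apply: limr_le.
    by apply/cvg_ex; exists `|a i|; exact: cvg_norm.
  by near=> n; exact: hb.
have san n : summ (an n).
  by apply: summ_dom sb => i; rewrite (ger0_norm (b0 i)).
have sa : summ a by apply: summ_dom sb => i; rewrite (ger0_norm (b0 i)).
apply/cvgrPdist_le => e e0.
(* The tail of the differences is at most twice the tail of [b], hence below [e / 2]; the other half
   of [e] is left for the finite part. *)
have [r [ur hr]] := @rsum_seqD b (e / 4) ltac:(by rewrite divr_gt0) sb.
have hs : \sum_(i <- r) `|a i - an n i| @[n --> \oo] --> \sum_(i <- r) (0 : R).
  apply: (@cvg_sumr R I nat \oo _ r (fun i n => `|a i - an n i|) (fun=> 0)) => i.
  have : a i - an n i @[n --> \oo] --> a i - a i.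
    by apply: cvgB => //; exact: cvg_cst.
  by move=> /cvg_norm; rewrite subrr normr0.
rewrite [X in _ --> X]big1 // in hs.
have /cvgrPdist_le/(_ (e / 2)) := hs.
have e2 : 0 < e / 2 by rewrite divr_gt0.
move=> /(_ e2); apply: filterS => n.
rewrite sub0r normrN (ger0_norm (sumr_ge0 _ _))// => hn.
rewrite -rsumB//; have sd := summB sa (san n).
have sn : summ (fun i => `|a i - an n i|).
  by apply: summ_dom sd => i; rewrite normr_id.
apply: (@le_trans _ _ (rsum (fun i => `|a i - an n i|))).
  exact: ler_norm_rsum.
rewrite (rsum_disj sn ur).
have sc : summ (fun i => if i \in r then 0 else `|b i|).
  by apply: summ_dom sb => i; case: ifP; rewrite ?normr0// normr_id.
have : rsum (fun i => if i \in r then 0 else `|a i - an n i|) <=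
  rsum (fun i => 2 * if i \in r then 0 else `|b i|).
  apply: ler_rsum; [|exact: summZ|].
    by apply: summ_dom sn => i; case: ifP; rewrite ?normr0.
  move=> i; case: ifP; rewrite ?mulr0// => _.
  rewrite (le_trans (ler_normB _ _))// (ger0_norm (b0 i)).
  by have := ab i; have := hb n i; lra.
rewrite rsumZ//; lra.
Unshelve. all: by end_near. Qed.

(** Finite partial sums pass to the limit and stay below [c]; this bound on all of them gives
    summability and the estimate at once. *)
Lemma rsum_fatou (an : nat -> I -> R) a (c : R) :
  (forall n i, 0 <= an n i) -> (forall n, summ (an n)) ->
  (forall i, an n i @[n --> \oo] --> a i) ->
  (\forall n \near \oo, rsum (an n) <= c) ->
  summ a /\ rsum a <= c.
Proof.
move=> a0 san ha hc.
have ale s : uniq s -> \sum_(i <- s) a i <= c.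
  move=> us; have hs : \sum_(i <- s) an n i @[n --> \oo] --> \sum_(i <- s) a i.
    by apply: cvg_sumr => i; exact: ha.
  rewrite -(cvg_lim _ hs)//; apply: limr_le.
    by apply/cvg_ex; exists (\sum_(i <- s) a i).
  apply: filterS hc => n; apply: le_trans; exact: rsum_seq_le.
have ag0 i : 0 <= a i.
  rewrite -(cvg_lim _ (ha i))//; apply: limr_ge; last by near=> n; exact: a0.
  by apply/cvg_ex; exists (a i).
split; last exact: rsum_le_seq.
apply: (@summ_bound _ c) => s us; under eq_bigr do rewrite ger0_norm//.
exact: ale.
Unshelve. all: by end_near. Qed.

End Sums.

Section SumsReindex.
Variables (R : realType) (I J : choiceType).

Lemma esum_inj (f : J -> I) (a : I -> \bar R) : injective f ->
  (forall i, ~ range f i -> a i = 0%E) ->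
  (\esum_(i in [set: I]) a i = \esum_(j in [set: J]) a (f j))%E.
Proof.
move=> fi a0; rewrite -(@esum_image R J I setT f a); last first.
  by move=> x y _ _; exact: fi.
rewrite [RHS]esum_mkcond; apply: eq_esum => i _.
by case: ifPn => //; rewrite notin_setE => /a0.
Qed.

Lemma summ_inj (f : J -> I) (a : I -> R) : injective f ->
  (forall i, ~ range f i -> a i = 0) -> summ a <-> summ (a \o f).
Proof.
move=> fi a0; rewrite /summ (esum_inj fi)// => i /a0 ->.
by rewrite normr0.
Qed.

Lemma rsum_inj (f : J -> I) (a : I -> R) : injective f ->
  (forall i, ~ range f i -> a i = 0) -> rsum a = rsum (a \o f).
Proof.
move=> fi a0; rewrite /rsum !(esum_inj fi)// => i /a0 ->.
  by rewrite oppr0 maxxx.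
by rewrite maxxx.
Qed.

End SumsReindex.

(** * The Hilbert space of square-summable functions *)

Section Ell2.
Variables (R : realType) (X : countType) (G : graph R X).
Local Notation mu := (gmu G).
Local Notation ip := (inner2 G).
Local Notation L2 := (ell2 G).
Implicit Types (f g h : X -> R).

Let mu_ge0 x : 0 <= mu x. Proof. exact/ltW/gmu_gt0. Qed.

Definition nrm f : R := Num.sqrt (ip f f).

Let sq_ge0 f x : 0 <= f x * f x * mu x.
Proof. by rewrite mulr_ge0// -expr2 sqr_ge0. Qed.

Lemma ell2P f : L2 f <-> summ (fun x => f x * f x * mu x).
Proof.
rewrite /ell2 /norm2 summ_ge0//; under eq_esum do rewrite expr2.
have : (0 <= \esum_(x in [set: X]) (f x * f x * mu x)%:E)%E.
  by apply: esum_ge0 => x _; rewrite lee_fin.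
by case: (esum _ _) => [r _|_|//]; split => // _; rewrite /= ltry.
Qed.

Lemma ip_ge0 f : 0 <= ip f f.
Proof. exact: rsum_ge0. Qed.

Lemma nrm_ge0 f : 0 <= nrm f.
Proof. exact: sqrtr_ge0. Qed.

Lemma nrm_sqr f : nrm f ^+ 2 = ip f f.
Proof. by rewrite sqr_sqrtr// ip_ge0. Qed.

Lemma norm2E f : L2 f -> norm2 G f = (nrm f)%:E.
Proof.
move=> /ell2P sf; rewrite /norm2 /nrm /inner2.
under eq_esum do rewrite expr2.
by rewrite -rsum_esum.
Qed.

Lemma summ_ip f g : L2 f -> L2 g -> summ (fun x => f x * g x * mu x).
Proof.
move=> /ell2P sf /ell2P sg.
apply: summ_dom (summD sf sg) => x.
rewrite [leRHS]ger0_norm ?addr_ge0// normrM (ger0_norm (mu_ge0 x)) -mulrDl.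
apply: ler_wpM2r => //; rewrite ler_norml; apply/andP; split; nra.
Qed.

Lemma ell2Z (a : R) f : L2 f -> L2 (fun x => a * f x).
Proof.
move=> /ell2P sf; apply/ell2P; have := summZ (a * a) sf.
by congr summ; apply/funext => x; ring.
Qed.

Lemma ell2D f g : L2 f -> L2 g -> L2 (fun x => f x + g x).
Proof.
move=> sf sg; apply/ell2P.
have := summD (summD (proj1 (ell2P f) sf) (proj1 (ell2P g) sg)) (summZ 2 (summ_ip sf sg)).
by congr summ; apply/funext => x; ring.
Qed.

Lemma ell2N f : L2 f -> L2 (fun x => - f x).
Proof. by move=> /(ell2Z (-1)); congr ell2; apply/funext => x; ring. Qed.

Lemma ell2B f g : L2 f -> L2 g -> L2 (fun x => f x - g x).
Proof. by move=> sf /ell2N; exact: ell2D. Qed.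

Lemma ell2_0 : L2 (fun=> 0).
Proof.
apply/ell2P; have := @summ0 R X; congr summ.
by apply/funext => x; rewrite !mul0r.
Qed.

Lemma ell2_fin f (s : seq X) : (forall x, x \notin s -> f x = 0) -> L2 f.
Proof.
by move=> h; apply/ell2P; apply: (@summ_fin _ _ _ s) => x /h ->; rewrite !mul0r.
Qed.

Lemma ipC f g : ip f g = ip g f.
Proof. by apply: eq_rsum => x; rewrite (mulrC (f x)). Qed.

Lemma ipDl f g h : L2 f -> L2 g -> L2 h ->
  ip (fun x => f x + g x) h = ip f h + ip g h.
Proof.
move=> sf sg sh; rewrite /inner2 -rsumD; [|exact: summ_ip..].
by apply: eq_rsum => x; ring.
Qed.

Lemma ipZl (a : R) f g : L2 f -> L2 g -> ip (fun x => a * f x) g = a * ip f g.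
Proof.
move=> sf sg; rewrite /inner2 -rsumZ; last exact: summ_ip.
by apply: eq_rsum => x; ring.
Qed.

Lemma ipBl f g h : L2 f -> L2 g -> L2 h ->
  ip (fun x => f x - g x) h = ip f h - ip g h.
Proof.
move=> sf sg sh; rewrite /inner2 -rsumB; [|exact: summ_ip..].
by apply: eq_rsum => x; ring.
Qed.

Lemma ipDr f g h : L2 f -> L2 g -> L2 h ->
  ip h (fun x => f x + g x) = ip h f + ip h g.
Proof. by move=> *; rewrite ipC ipDl// !(ipC h). Qed.

Lemma ipBr f g h : L2 f -> L2 g -> L2 h ->
  ip h (fun x => f x - g x) = ip h f - ip h g.
Proof. by move=> *; rewrite ipC ipBl// !(ipC h). Qed.

Lemma ipZr (a : R) f g : L2 f -> L2 g -> ip f (fun x => a * g x) = a * ip f g.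
Proof. by move=> *; rewrite ipC ipZl// ipC. Qed.

Lemma sqr_le_ip f x : L2 f -> f x * f x * mu x <= ip f f.
Proof.
move=> /ell2P sf; have := @rsum_seq_le R X _ [:: x] (sq_ge0 f) sf erefl.
by rewrite big_seq1.
Qed.

(** Every point has positive mass, so evaluation at a point is a bounded functional. Norm
    convergence therefore implies pointwise convergence. *)
Lemma eval_le_nrm f x : L2 f -> `|f x| <= nrm f / Num.sqrt (mu x).
Proof.
move=> sf; rewrite ler_pdivlMr ?sqrtr_gt0 ?gmu_gt0//.
rewrite -sqrtr_sqr -sqrtrM ?sqr_ge0// /nrm ler_sqrt ?ip_ge0//.
by rewrite expr2 sqr_le_ip.
Qed.

Lemma nrm_eq0 f : L2 f -> nrm f = 0 -> f = fun=> 0.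
Proof.
move=> sf f0; apply/funext => x; apply/eqP.
by have := eval_le_nrm x sf; rewrite f0 mul0r normr_le0.
Qed.

Lemma cauchy_schwarz f g : L2 f -> L2 g -> ip f g <= nrm f * nrm g.
Proof.
move=> sf sg; have [g0|gn0] := eqVneq (nrm g) 0.
  rewrite g0 mulr0 (nrm_eq0 sg g0) /inner2.
  rewrite (_ : (fun x => _) = fun=> 0) ?rsum0//.
  by apply/funext => x; rewrite mulr0 mul0r.
have c0 : 0 < ip g g by rewrite -nrm_sqr exprn_gt0// lt_neqAle eq_sym gn0 nrm_ge0.
rewrite /nrm -sqrtrM ?ip_ge0//.
apply: le_trans (ler_norm _) _; rewrite -sqrtr_sqr ler_sqrt ?mulr_ge0 ?ip_ge0//.
(* The minimizer of the norm of [f - t g]. Writing [ip f g] as [t * ip g g] twice turns the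
   nonnegative minimum into the claim. *)
set t := ip f g / ip g g.
have := ip_ge0 (fun x => f x - t * g x).
have sz := ell2Z t sg; have sb := ell2B sf sz.
rewrite ipBl// !ipBr// !ipZr// !ipZl// (ipC g f) => h.
have : 0 <= (ip f f - t * ip f g - (t * ip f g - t * (t * ip g g))) * ip g g.
  by rewrite mulr_ge0// ip_ge0.
have <- : ip f g = t * ip g g by rewrite /t mulfVK// gt_eqF.
have -> : (ip f f - t * ip f g - (t * ip f g - t * ip f g)) * ip g g =
   ip f f * ip g g - (t * ip g g) * ip f g by ring.
have <- : ip f g = t * ip g g by rewrite /t mulfVK// gt_eqF.
by rewrite subr_ge0 expr2.
Qed.

Lemma nrmZ (a : R) f : L2 f -> nrm (fun x => a * f x) = `|a| * nrm f.
Proof.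
move=> sf; rewrite /nrm ipZl ?ipZr//; last exact: ell2Z.
by rewrite mulrA -expr2 sqrtrM ?sqr_ge0// sqrtr_sqr.
Qed.

Lemma nrmN f : L2 f -> nrm (fun x => - f x) = nrm f.
Proof.
move=> sf; rewrite -[RHS]mul1r -[X in X * _](normrN1 R) -nrmZ//.
by congr nrm; apply/funext => x; rewrite mulN1r.
Qed.

Lemma nrmD f g : L2 f -> L2 g -> nrm (fun x => f x + g x) <= nrm f + nrm g.
Proof.
move=> sf sg; have sfg := ell2D sf sg.
rewrite -[leRHS]ger0_norm ?addr_ge0 ?nrm_ge0// -[leRHS]sqrtr_sqr.
rewrite /(nrm (fun x => _)) ler_sqrt ?sqr_ge0//.
rewrite ipDl// !ipDr// (ipC g f) sqrrD !nrm_sqr.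
have := cauchy_schwarz sf sg; lra.
Qed.

Lemma nrmB f g : L2 f -> L2 g -> nrm (fun x => f x - g x) <= nrm f + nrm g.
Proof.
by move=> sf sg; rewrite -(nrmN sg); apply: nrmD => //; exact: ell2N.
Qed.

Lemma nrmBC f g : L2 f -> L2 g -> nrm (fun x => f x - g x) = nrm (fun x => g x - f x).
Proof.
move=> sf sg; rewrite -nrmN; last exact: ell2B.
by congr nrm; apply/funext => x; rewrite opprB.
Qed.

Lemma nrm_triB f g h : L2 f -> L2 g -> L2 h ->
  nrm (fun x => f x - h x) <= nrm (fun x => f x - g x) + nrm (fun x => g x - h x).
Proof.
move=> sf sg sh; have := nrmD (ell2B sf sg) (ell2B sg sh).
by congr (_ <= _); congr nrm; apply/funext => x; ring.
Qed.

Lemma nrm0 : nrm (fun=> 0) = 0.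
Proof.
by rewrite /nrm /inner2; under eq_rsum do rewrite !mul0r; rewrite rsum0 sqrtr0.
Qed.

Definition cvg2 (fn : nat -> X -> R) f :=
  nrm (fun x => fn n x - f x) @[n --> \oo] --> 0.

Lemma cvg2P (fn : nat -> X -> R) f : cvg2 fn f <->
  forall e : R, 0 < e -> \forall n \near \oo, nrm (fun x => fn n x - f x) <= e.
Proof.
split=> [/cvgrPdist_le h e /h|h].
  by apply: filterS => n; rewrite sub0r normrN ger0_norm// nrm_ge0.
apply/cvgrPdist_le => e /h; apply: filterS => n.
by rewrite sub0r normrN ger0_norm// nrm_ge0.
Qed.

Lemma cvg2_pointwise (fn : nat -> X -> R) f x :
  (forall n, L2 (fn n)) -> L2 f -> cvg2 fn f -> fn n x @[n --> \oo] --> f x.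
Proof.
move=> sn sf /cvg2P h; apply/cvgrPdist_le => e e0.
have m0 : 0 < Num.sqrt (mu x) by rewrite sqrtr_gt0 gmu_gt0.
have := h (e * Num.sqrt (mu x)) (mulr_gt0 e0 m0); apply: filterS => n hn.
rewrite distrC; apply: le_trans (eval_le_nrm x (ell2B (sn n) sf)) _.
by rewrite ler_pdivrMr.
Qed.

Lemma cvg2_ip (fn gn : nat -> X -> R) f g :
  (forall n, L2 (fn n)) -> (forall n, L2 (gn n)) -> L2 f -> L2 g ->
  cvg2 fn f -> cvg2 gn g -> ip (fn n) (gn n) @[n --> \oo] --> ip f g.
Proof.
move=> sfn sgn sf sg hf hg.
have : (nrm (fun x => fn n x - f x) * (nrm (fun x => gn n x - g x) + nrm g) +
    nrm f * nrm (fun x => gn n x - g x)) @[n --> \oo] --> (0 * (0 + nrm g) + nrm f * 0).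
  apply: cvgD; apply: cvgM => //; last exact: cvg_cst.
  by apply: cvgD => //; exact: cvg_cst.
rewrite mul0r mulr0 addr0 => /cvgrPdist_le h.
apply/cvgrPdist_le => e /h; apply: filterS => n.
rewrite sub0r normrN => hn.
rewrite distrC; apply: le_trans (le_trans (ler_norm _) hn).
have sd1 := ell2B (sfn n) sf; have sd2 := ell2B (sgn n) sg.
have -> : ip (fn n) (gn n) - ip f g =
  ip (fun x => fn n x - f x) (gn n) + ip f (fun x => gn n x - g x).
  rewrite ipBl// ipBr//; ring.
apply: le_trans (ler_normD _ _) _.
have cs a b : L2 a -> L2 b -> `|ip a b| <= nrm a * nrm b.
  move=> sa sb; rewrite ler_norml cauchy_schwarz// andbT lerNl.
  rewrite -mulN1r -ipZl// -(nrmN sa).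
  have -> : (fun x => -1 * a x) = (fun x => - a x) by apply/funext => x; rewrite mulN1r.
  by apply: cauchy_schwarz => //; exact: ell2N.
apply: lerD; last exact: cs.
apply: le_trans (cs _ _ sd1 (sgn n)) _.
apply: ler_wpM2l; first exact: nrm_ge0.
have := nrmD sd2 sg; congr (_ <= _); congr nrm; apply/funext => x; ring.
Qed.

(** The candidate is the pointwise limit. Fatou converts bounds between members of the sequence into
    bounds on the distance to it, hence membership and convergence. The last clause keeps explicit
    rates, which the gliding hump argument consumes. *)
Lemma ell2_complete (fn : nat -> X -> R) : (forall n, L2 (fn n)) ->
  (forall e : R, 0 < e -> exists k, forall n m, (k <= n)%N -> (k <= m)%N ->
     nrm (fun x => fn n x - fn m x) <= e) ->
  exists f, [/\ L2 f, cvg2 fn f &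
    forall e n, (\forall m \near \oo, nrm (fun x => fn n x - fn m x) <= e) ->
      nrm (fun x => fn n x - f x) <= e].
Proof.
move=> sn cau.
have hx x : cvgn (fn^~ x).
  apply: cauchy_cvg; apply: cauchy_exP => e e0.
  have m0 : 0 < Num.sqrt (mu x) by rewrite sqrtr_gt0 gmu_gt0.
  have [k hk] := cau (e / 2 * Num.sqrt (mu x)) ltac:(by rewrite !mulr_gt0).
  exists (fn k x); exists k => // n /= kn; rewrite /ball/=.
  apply: le_lt_trans (eval_le_nrm x (ell2B (sn k) (sn n))) _.
  rewrite ltr_pdivrMr//; apply: le_lt_trans (hk _ _ (leqnn k) kn) _.
  rewrite ltr_pM2r//; lra.
pose f x := limn (fn^~ x).
have hf x : fn n x @[n --> \oo] --> f x by exact: hx.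
have key e n : (\forall m \near \oo, nrm (fun x => fn n x - fn m x) <= e) ->
    L2 (fun x => fn n x - f x) /\ nrm (fun x => fn n x - f x) <= e.
  move=> he.
  have e0 : 0 <= e.
    have [m hm] := @filter_ex _ _ eventually_filter _ he.
    exact: le_trans (nrm_ge0 _) hm.
  have [||||s1 s2] := @rsum_fatou R X
    (fun m x => (fn n x - fn m x) * (fn n x - fn m x) * mu x)
    (fun x => (fn n x - f x) * (fn n x - f x) * mu x) (e ^+ 2).
  - by move=> m x; exact: sq_ge0 (fun x => fn n x - fn m x) x.
  - by move=> m; apply/ell2P; exact: ell2B.
  - move=> x; apply: cvgM; last exact: cvg_cst.
    by apply: cvgM; apply: cvgB => //; exact: cvg_cst.
  - apply: filterS he => m hm.
    by rewrite -/(inner2 G _ _) -nrm_sqr lerXn2r ?nnegrE ?nrm_ge0.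
  - by split; [exact/ell2P|
      rewrite /nrm -(ger0_norm e0) -sqrtr_sqr ler_sqrt ?sqr_ge0].
have sf : L2 f.
  have [k hk] := cau 1 ltr01.
  have [|s _] := key 1 k; first by exists k => // m km; exact: hk.
  have := ell2B (sn k) s; congr ell2; apply/funext => x; ring.
exists f; split => //; last by move=> e n /key[].
apply/cvg2P => e /cau[k hk]; exists k => // n kn.
by have [|] := key e n; first by exists k => // m km; exact: hk.
Unshelve. all: by end_near. Qed.

End Ell2.

(** * The formal Laplacian and finite Dirichlet problems *)

Section SumsFin.
Variables (R : realType) (I J : choiceType).

Lemma summ_sum (s : seq J) (a : J -> I -> R) : (forall j, summ (a j)) ->
  summ (fun i => \sum_(j <- s) a j i).
Proof.
move=> sa; elim: s => [|j s ih].
  by under eq_fun do rewrite big_nil; exact: summ0.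
by under eq_fun do rewrite big_cons; exact: summD.
Qed.

Lemma rsum_sum (s : seq J) (a : J -> I -> R) : (forall j, summ (a j)) ->
  rsum (fun i => \sum_(j <- s) a j i) = \sum_(j <- s) rsum (a j).
Proof.
move=> sa; elim: s => [|j s ih].
  by under eq_fun do rewrite big_nil; rewrite big_nil rsum0.
under eq_fun do rewrite big_cons.
by rewrite big_cons rsumD ?ih//; exact: summ_sum.
Qed.

End SumsFin.

Lemma seq_argmin (R : realType) (T : eqType) (f : T -> R) (s : seq T) x0 :
  x0 \in s -> exists x, x \in s /\ forall y, y \in s -> f x <= f y.
Proof.
elim: s x0 => [//|a [|b s] ih] x0 _.
  by exists a; rewrite mem_head; split => // y; rewrite inE => /eqP ->.
have [x [xs hx]] := ih b (mem_head _ _).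
have [fax|fxa] := leP (f a) (f x).
  exists a; rewrite mem_head; split => // y; rewrite inE => /orP[/eqP -> //|].
  by move=> /hx; exact: le_trans.
exists x; rewrite inE xs orbT; split => // y; rewrite inE => /orP[/eqP -> |/hx//].
exact: ltW.
Qed.

Section Operator.
Variables (R : realType) (X : countType) (G : graph R X).
Local Notation w := (gw G).
Local Notation kappa := (gkappa G).
Local Notation mu := (gmu G).
Implicit Types (f g h v b : X -> R) (x y : X) (K : seq X).

Definition wdeg x : R := rsum (w x) + kappa x.
Definition adj f x : R := rsum (fun y => w x y * f y).
Definition opH f x : R := wdeg x * f x - adj f x.
Definition ldom f : Prop := forall x, summ (fun y => w x y * f y).

Lemma summ_w x : summ (w x).
Proof.
by rewrite summ_ge0; [exact: gw_summable|exact: gw_ge0].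
Qed.

Lemma lap_domE f : lap_dom G f <-> ldom f.
Proof.
by split=> h x; have := h x; rewrite /summ; congr (_ < _)%E; apply: eq_esum => y _;
  rewrite normrM (ger0_norm (gw_ge0 G x y)).
Qed.

Lemma lapE f x : ldom f -> mu x * lap G f x = opH f x.
Proof.
move=> df; rewrite /lap mulrDr mulVKf ?gt_eqF ?gmu_gt0//.
rewrite mulrA (mulrC (mu x)) divfK ?gt_eqF ?gmu_gt0//.
rewrite (_ : (fun y => _) = fun y => f x * w x y - w x y * f y); last first.
  by apply/funext => y; ring.
rewrite rsumB; [|exact/summZ/summ_w|exact: df].
rewrite rsumZ; last exact: summ_w.
rewrite /opH /wdeg /adj; ring.
Qed.

Lemma ldom_bounded f (M : R) : (forall x, `|f x| <= M) -> ldom f.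
Proof.
move=> fM x; apply: summ_dom (summZ M (summ_w x)) => y.
by rewrite mulrC !normrM ler_wpM2r// (le_trans (fM y))// ler_norm.
Qed.

Definition fsupp K f := forall x, x \notin K -> f x = 0.

Lemma ldom_fsupp K f : fsupp K f -> ldom f.
Proof. by move=> sf x; apply: (@summ_fin _ _ _ K) => y /sf ->; rewrite mulr0. Qed.

Lemma ldomD f g : ldom f -> ldom g -> ldom (fun x => f x + g x).
Proof.
move=> df dg x; have := summD (df x) (dg x); congr summ.
by apply/funext => y; ring.
Qed.

Lemma ldomZ (a : R) f : ldom f -> ldom (fun x => a * f x).
Proof.
by move=> df x; have := summZ a (df x); congr summ; apply/funext => y; ring.
Qed.

Lemma ldomB f g : ldom f -> ldom g -> ldom (fun x => f x - g x).
Proof.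
move=> df dg x; have := summB (df x) (dg x); congr summ.
by apply/funext => y; ring.
Qed.

Lemma opHD f g x : ldom f -> ldom g ->
  opH (fun x => f x + g x) x = opH f x + opH g x.
Proof.
move=> df dg; rewrite /opH /adj.
rewrite (_ : (fun y => w x y * (f y + g y)) = (fun y => w x y * f y + w x y * g y)).
  by rewrite rsumD; [ring|exact: df|exact: dg].
by apply/funext => y; ring.
Qed.

Lemma opHZ (a : R) f x : ldom f -> opH (fun x => a * f x) x = a * opH f x.
Proof.
move=> df; rewrite /opH /adj.
rewrite (_ : (fun y => w x y * (a * f y)) = (fun y => a * (w x y * f y))).
  by rewrite rsumZ; [ring|exact: df].
by apply/funext => y; ring.
Qed.

Lemma opHB f g x : ldom f -> ldom g ->
  opH (fun x => f x - g x) x = opH f x - opH g x.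
Proof.
move=> df dg; rewrite /opH /adj.
rewrite (_ : (fun y => w x y * (f y - g y)) = (fun y => w x y * f y - w x y * g y)).
  by rewrite rsumB; [ring|exact: df|exact: dg].
by apply/funext => y; ring.
Qed.

Lemma opH_cst (c : R) x : opH (fun=> c) x = kappa x * c.
Proof.
rewrite /opH /adj; under eq_rsum do rewrite mulrC.
rewrite rsumZ; last exact: summ_w.
rewrite /wdeg; ring.
Qed.

Lemma adj_fsupp K f x : uniq K -> fsupp K f ->
  adj f x = \sum_(y <- K) w x y * f y.
Proof. by move=> uK sf; apply: rsum_fin => // y /sf ->; rewrite mulr0. Qed.

(** A negative value would make the minimum over [K] a global minimum, the exterior values being
    nonnegative. There [adj f x] is at least [f x] times the total edge weight, so [opH f x] is at
    most [kappa x * f x], and the term with [b] makes the left side strictly negative. *)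
Lemma min_principle K (b : R) f : 0 < b -> ldom f ->
  (forall x, x \notin K -> 0 <= f x) ->
  (forall x, x \in K -> 0 <= opH f x + b * mu x * f x) -> forall x, 0 <= f x.
Proof.
move=> b0 df fo fi x0; rewrite leNgt; apply/negP => fx0.
have x0K : x0 \in K by apply: contraTT fx0 => /fo; rewrite leNgt.
have [x [xK hx]] := seq_argmin f x0K.
have fx : f x < 0 by apply: le_lt_trans (hx _ x0K) fx0.
have fxy y : f x <= f y.
  have [/hx//|/fo] := boolP (y \in K); apply: le_trans; exact: ltW.
have : f x * rsum (w x) <= adj f x.
  rewrite -rsumZ; last exact: summ_w.
  apply: ler_rsum; [exact/summZ/summ_w|exact: df|move=> y].
  by rewrite mulrC ler_wpM2l// gw_ge0.
have := fi x xK; rewrite /opH /wdeg.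
have k0 := gkappa_ge0 G x; have := gmu_gt0 G x => m0.
have : b * mu x * f x < 0 by rewrite pmulr_rlt0// mulr_gt0.
have : kappa x * f x <= 0 by rewrite mulr_ge0_le0// ltW.
nra.
Qed.

(** This is a square linear system. The minimum principle applied to a kernel vector and to its
    negative shows that the matrix is injective, hence invertible. *)
Lemma dirichlet_exists K (b : R) (rhs : X -> R) : uniq K -> 0 < b ->
  exists v, fsupp K v /\
    forall x, x \in K -> opH v x + b * mu x * v x = rhs x.
Proof.
move=> uK b0; pose t := in_tuple K.
have tinj : injective (tnth t) by apply/tuple_uniqP.
pose fn (r : 'rV[R]_(size K)) x : R := \sum_i r 0 i * (x == tnth t i)%:R.
have fnE r i : fn r (tnth t i) = r 0 i.
  rewrite /fn (bigD1 i)//= eqxx mulr1 big1 ?addr0// => j ji.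
  by rewrite (inj_eq tinj) eq_sym (negPf ji) mulr0.
have fns r : fsupp K (fn r).
  move=> x xK; rewrite /fn big1// => i _.
  by case: eqP => [xE|]; rewrite ?mulr0//; move: xK; rewrite xE mem_tnth.
pose M : 'M[R]_(size K) := \matrix_(i, j)
  ((wdeg (tnth t j) + b * mu (tnth t j)) * (i == j)%:R - w (tnth t i) (tnth t j)).
have ME r j : (r *m M) 0 j = opH (fn r) (tnth t j) + b * mu (tnth t j) * r 0 j.
  have -> : (r *m M) 0 j = \sum_i (r 0 i * ((wdeg (tnth t j) + b * mu (tnth t j)) *
      (i == j)%:R) - r 0 i * w (tnth t i) (tnth t j)).
    by rewrite mxE; apply: eq_bigr => i _; rewrite mxE mulrBr.
  rewrite sumrB (bigD1 j)//= eqxx mulr1 big1 ?addr0; last first.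
    by move=> i /negPf ->; rewrite !mulr0.
  have -> : \sum_i r 0 i * w (tnth t i) (tnth t j) = adj (fn r) (tnth t j).
    rewrite (adj_fsupp _ uK (fns r)) [RHS]big_tnth.
    by apply: eq_bigr => i _; rewrite fnE mulrC gw_sym.
  rewrite /opH fnE; ring.
have Mu : M \in unitmx.
  rewrite -row_free_unit; apply: inj_row_free => r rM.
  have h x : x \in K -> opH (fn r) x + b * mu x * fn r x = 0.
    by move=> /seq_tnthP[j ->]; have := ME r j; rewrite rM mxE fnE => <-.
  have h1 : forall x, 0 <= fn r x.
    apply: (min_principle b0 (ldom_fsupp (fns r))) => x; last by move=> /h ->.
    by move=> /(fns r) ->.
  have h2 : forall x, 0 <= -1 * fn r x.
    apply: (min_principle b0 (ldomZ (-1) (ldom_fsupp (fns r)))) => x.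
      by move=> /(fns r) ->; rewrite mulr0.
    move=> /h e; rewrite opHZ; last exact: ldom_fsupp (fns r).
    suff -> : -1 * opH (fn r) x + b * mu x * (-1 * fn r x) = 0 by [].
    rewrite -[RHS]oppr0 -e; ring.
  apply/rowP => i; rewrite mxE -fnE; apply/eqP; rewrite eq_le h1 andbT.
  by have := h2 (tnth t i); rewrite mulN1r oppr_ge0.
pose r : 'rV[R]_(size K) := (\row_i rhs (tnth t i)) *m invmx M.
exists (fn r); split => // x /seq_tnthP[j ->].
by have := ME r j; rewrite fnE => <-; rewrite mulmxKV// mxE.
Qed.

(** The finite exhaustion, chosen to agree with [trunc_enum]: truncations in the definition of the
    extended semigroup are supported exactly on these sets. *)
Definition Kseq (n : nat) : seq X := pmap (@pickle_inv X) (iota 0 n).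

Lemma mem_Kseq n x : (x \in Kseq n) = (pickle x < n)%N.
Proof.
rewrite mem_pmap; apply/mapP/idP => [[i]|h].
  rewrite mem_iota add0n => /andP[_ hi] /esym hx.
  by have := @pickle_invK X i; rewrite hx /= => ->.
by exists (pickle x); rewrite ?mem_iota ?pickleK_inv.
Qed.

Lemma Kseq_uniq n : uniq (Kseq n).
Proof.
apply: (@pmap_uniq _ _ (@pickle_inv X) (@pickle X)); last exact: iota_uniq.
exact: pickle_invK.
Qed.

Lemma fsupp_Kseq_le n m f : (n <= m)%N -> fsupp (Kseq n) f -> fsupp (Kseq m) f.
Proof.
move=> nm sf x; rewrite mem_Kseq -leqNgt => mx; apply: sf.
by rewrite mem_Kseq -leqNgt (leq_trans nm).
Qed.

Lemma fin_suppP f : fin_supp f -> exists n, fsupp (Kseq n) f.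
Proof.
move=> /finite_seqP[A hA].
exists (\max_(x <- A) (pickle x)).+1 => x.
rewrite mem_Kseq ltnS => xK; apply/eqP; apply/negP => /negP fx.
have xA : x \in A by have : [set` A] x by rewrite -hA.
move/negP: xK; apply; exact: (@leq_bigmax_seq _ _ xpredT (@pickle X)).
Qed.

Lemma fsupp_fin n f : fsupp (Kseq n) f -> fin_supp f.
Proof.
move=> sf; apply: (@sub_finite_set _ _ [set` Kseq n]); last exact: finite_seq.
move=> x /= fx; apply: contrapT => /negP /sf fx0; by rewrite fx0 eqxx in fx.
Qed.

(** Made total in [b] by the default value 0 when [b] is not positive, so that it can be handled as
    an ordinary function. *)
Definition gsol n (b : R) (rhs : X -> R) : X -> R :=
  if pselect (0 < b) is left b0 then
    proj1_sig (cid (dirichlet_exists rhs (Kseq_uniq n) b0)) else fun=> 0.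

Section Gsol.
Variables (n : nat) (b : R).
Hypothesis b0 : 0 < b.

Lemma gsol_fsupp rhs : fsupp (Kseq n) (gsol n b rhs).
Proof. by rewrite /gsol; case: pselect => // b0'; case: cid => v []. Qed.

Lemma gsolE rhs x : x \in Kseq n ->
  opH (gsol n b rhs) x + b * mu x * gsol n b rhs x = rhs x.
Proof. by rewrite /gsol; case: pselect => // b0'; case: cid => v /= [_]; exact. Qed.

Lemma gsol_ldom rhs : ldom (gsol n b rhs).
Proof. exact: ldom_fsupp (gsol_fsupp rhs). Qed.

(** The minimum principle for the difference. As [f] may live on the whole graph, constants, v and
    solutions on larger sets are all admissible barriers. *)
Lemma gsol_le rhs f : ldom f -> (forall x, x \notin Kseq n -> 0 <= f x) ->
  (forall x, x \in Kseq n -> rhs x <= opH f x + b * mu x * f x) ->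
  forall x, gsol n b rhs x <= f x.
Proof.
move=> df fo fi x; rewrite -subr_ge0.
apply: (@min_principle (Kseq n) _ _ b0 (ldomB df (gsol_ldom rhs))) => {}x xK.
  by rewrite (gsol_fsupp rhs xK) subr0 fo.
rewrite opHB//; last exact: gsol_ldom.
by have := fi x xK; have := gsolE rhs xK; lra.
Qed.

Lemma gsol_ge rhs f : ldom f -> (forall x, x \notin Kseq n -> f x <= 0) ->
  (forall x, x \in Kseq n -> opH f x + b * mu x * f x <= rhs x) ->
  forall x, f x <= gsol n b rhs x.
Proof.
move=> df fo fi x; rewrite -subr_ge0.
apply: (@min_principle (Kseq n) _ _ b0 (ldomB (gsol_ldom rhs) df)) => {}x xK.
  by rewrite (gsol_fsupp rhs xK) sub0r oppr_ge0 fo.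
rewrite opHB//; last exact: gsol_ldom.
by have := fi x xK; have := gsolE rhs xK; lra.
Qed.

Lemma gsol_ge0 rhs x : (forall x, x \in Kseq n -> 0 <= rhs x) -> 0 <= gsol n b rhs x.
Proof.
move=> r0; apply: (@gsol_ge rhs (fun=> 0)) => //.
  by apply: (@ldom_bounded _ 0) => y; rewrite normr0.
by move=> y yK; rewrite opH_cst !mulr0 addr0 r0.
Qed.

Lemma gsol_uniq rhs f : fsupp (Kseq n) f ->
  (forall x, x \in Kseq n -> opH f x + b * mu x * f x = rhs x) ->
  f = gsol n b rhs.
Proof.
move=> sf fE; apply/funext => x; apply/eqP; rewrite eq_le; apply/andP; split.
  by apply: gsol_ge; [exact: ldom_fsupp sf|move=> y /sf ->|move=> y /fE ->].
by apply: gsol_le; [exact: ldom_fsupp sf|move=> y /sf ->|move=> y /fE ->].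
Qed.

Lemma gsolB r1 r2 x :
  gsol n b (fun x => r1 x - r2 x) x = gsol n b r1 x - gsol n b r2 x.
Proof.
have <- // : (fun x => gsol n b r1 x - gsol n b r2 x) = gsol n b (fun x => r1 x - r2 x).
apply: gsol_uniq => [y yK|y yK].
  by rewrite !gsol_fsupp// subr0.
rewrite opHB; [|exact: gsol_ldom..].
rewrite -(gsolE r1 yK) -(gsolE r2 yK); ring.
Qed.

End Gsol.

(** The solution on the larger set is a nonnegative supersolution of the problem on the smaller
    one. *)
Lemma gsol_mono n m (b : R) rhs x : 0 < b -> (forall x, 0 <= rhs x) -> (n <= m)%N ->
  gsol n b rhs x <= gsol m b rhs x.
Proof.
move=> b0 r0 nm; apply: gsol_le => //; first exact: gsol_ldom.
  by move=> y _; apply: gsol_ge0.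
move=> y yK; rewrite gsolE//.
by move: yK; rewrite !mem_Kseq => /leq_trans; exact.
Qed.

End Operator.

(** * The energy form on finitely supported functions *)

Section PairSums.
Variables (R : realType) (X : choiceType).

(** Only finitely many rows contribute, so the double family is a finite sum of summable families,
    each carried by one row. This does the work of Fubini's theorem in Green's formula. *)
Lemma pair_sum (K : seq X) (f : X -> R) (c : X -> X -> R) : uniq K ->
  (forall x, x \notin K -> f x = 0) -> (forall x, summ (c x)) ->
  summ (fun p : X * X => f p.1 * c p.1 p.2) /\
  rsum (fun p : X * X => f p.1 * c p.1 p.2) = \sum_(x <- K) f x * rsum (c x).
Proof.
move=> uK sf sc.
pose a x (p : X * X) : R := if p.1 == x then f x * c x p.2 else 0.
have aE : (fun p : X * X => f p.1 * c p.1 p.2) = fun p => \sum_(x <- K) a x p.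
  apply/funext => -[x y] /=; have [xK|xK] := boolP (x \in K); last first.
    rewrite sf// mul0r big_seq big1// => z zK; rewrite /a /=.
    by case: eqP => // xz; move: xK; rewrite xz zK.
  rewrite (bigD1_seq x)//= /a /= eqxx big1 ?addr0// => z /negPf.
  by rewrite eq_sym => ->.
have inj (x : X) : injective (fun y : X => (x, y)) by move=> y z [].
have a0 x (p : X * X) : ~ range (fun y => (x, y)) p -> a x p = 0.
  case: p => z y h; rewrite /a /=; case: eqP => // zx; exfalso; apply: h.
  by exists y => //; rewrite zx.
have ac x : a x \o (fun y => (x, y)) = fun y => f x * c x y.
  by apply/funext => y; rewrite /a /= eqxx.
have sa x : summ (a x).
  have h := summ_inj (inj x) (a0 x); apply: (proj2 h); rewrite ac; exact: summZ.
rewrite aE; split; first exact: summ_sum.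
rewrite rsum_sum//; apply: eq_bigr => x _.
by rewrite (rsum_inj (inj x) (a0 x)) ac rsumZ.
Qed.

Lemma summ_swap (a : X * X -> R) : summ a -> summ (fun p => a (p.2, p.1)).
Proof.
pose sw (p : X * X) := (p.2, p.1).
have inj : injective sw by move=> [x y] [z t] [-> ->].
have a0 p : ~ range sw p -> a p = 0.
  by case: p => x y h; exfalso; apply: h; exists (y, x).
exact: (proj1 (summ_inj inj a0)).
Qed.

Lemma rsum_swap (a : X * X -> R) : rsum (fun p => a (p.2, p.1)) = rsum a.
Proof.
pose sw (p : X * X) := (p.2, p.1).
have inj : injective sw by move=> [x y] [z t] [-> ->].
by apply/esym/(@rsum_inj R _ _ sw a inj) => -[x y] h; exfalso; apply: h; exists (y, x).
Qed.

End PairSums.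

Section Form.
Variables (R : realType) (X : countType) (G : graph R X).
Local Notation w := (gw G).
Local Notation kappa := (gkappa G).
Local Notation mu := (gmu G).
Local Notation Q := (form G).
Implicit Types (f g h : X -> R) (K : seq X).

Lemma fsuppD K f g : fsupp K f -> fsupp K g -> fsupp K (fun x => f x + g x).
Proof. by move=> sf sg x xK; rewrite sf// sg// addr0. Qed.

Lemma fsuppB K f g : fsupp K f -> fsupp K g -> fsupp K (fun x => f x - g x).
Proof. by move=> sf sg x xK; rewrite sf// sg// subr0. Qed.

Lemma fsuppZ K (a : R) f : fsupp K f -> fsupp K (fun x => a * f x).
Proof. by move=> sf x xK; rewrite sf// mulr0. Qed.

(** Green's formula without local finiteness. The product of differences expands into four double
    families, each of which contains a finitely supported factor in one of its variables, so
    [pair_sum] applies, after a swap for one of them. Symmetry of [w] merges the mixed terms. *)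
Lemma form_sum K f g : uniq K -> fsupp K f -> fsupp K g ->
  [/\ summ (fun p : X * X => w p.1 p.2 * (f p.1 - f p.2) * (g p.1 - g p.2)),
      summ (fun x => kappa x * f x * g x) &
      Q f g = \sum_(x <- K) g x * opH G f x].
Proof.
move=> uK sf sg.
have sfg : fsupp K (fun x => f x * g x) by move=> x /sf ->; rewrite mul0r.
have [s1 r1] := pair_sum uK sfg (summ_w G).
have dg := ldom_fsupp G sg; have df := ldom_fsupp G sf.
have [s3] := pair_sum uK sf dg; rewrite -/(adj G g _) => r3.
have [s4] := pair_sum uK sg df; rewrite -/(adj G f _) => r4.
have s2 := summ_swap s1; have r2 := rsum_swap (fun p : X * X => f p.1 * g p.1 * w p.1 p.2).
have -> : (fun p : X * X => w p.1 p.2 * (f p.1 - f p.2) * (g p.1 - g p.2)) =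
  (fun p : X * X => (f p.1 * g p.1 * w p.1 p.2 + f p.2 * g p.2 * w p.2 p.1) -
    (f p.1 * (w p.1 p.2 * g p.2) + g p.1 * (w p.1 p.2 * f p.2))).
  by apply/funext => -[x y] /=; rewrite (gw_sym G y x); ring.
have sk : summ (fun x => kappa x * f x * g x).
  by apply: (@summ_fin _ _ _ K) => x /sf ->; rewrite mulr0 mul0r.
have s12 := summD s1 s2; have s34 := summD s3 s4.
split => //; first exact: summB.
rewrite /form.
have -> : (fun p : X * X => w p.1 p.2 * (f p.1 - f p.2) * (g p.1 - g p.2)) =
  (fun p : X * X => (f p.1 * g p.1 * w p.1 p.2 + f p.2 * g p.2 * w p.2 p.1) -
    (f p.1 * (w p.1 p.2 * g p.2) + g p.1 * (w p.1 p.2 * f p.2))).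
  by apply/funext => -[x y] /=; rewrite (gw_sym G y x); ring.
rewrite rsumB// rsumD// rsumD// r2 r1 r3 r4.
rewrite (@rsum_fin _ _ (fun x => kappa x * f x * g x) K)//; last first.
  by move=> x /sf ->; rewrite mulr0 mul0r.
have -> : \sum_(x <- K) f x * adj G g x = \sum_(x <- K) g x * adj G f x.
  under eq_bigr do rewrite (adj_fsupp G _ uK sg) mulr_sumr.
  rewrite exchange_big/=; apply: eq_bigr => y _.
  rewrite (adj_fsupp G _ uK sf) mulr_sumr; apply: eq_bigr => x _.
  by rewrite (gw_sym G x y); ring.
have -> : \sum_(x <- K) g x * opH G f x =
  \sum_(x <- K) f x * g x * rsum (w x) + \sum_(x <- K) kappa x * f x * g x
  - \sum_(x <- K) g x * adj G f x.
  rewrite -big_split/= -sumrB; apply: eq_bigr => x _.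
  by rewrite /opH /wdeg; ring.
lra.
Qed.

Lemma form_fsupp K f g : uniq K -> fsupp K f -> fsupp K g ->
  Q f g = \sum_(x <- K) g x * opH G f x.
Proof. by move=> uK sf sg; have [] := form_sum uK sf sg. Qed.

Lemma formC f g : Q f g = Q g f.
Proof. by rewrite /form; congr (_ * _ + _); apply: eq_rsum => x; ring. Qed.

Lemma form_ge0 f : 0 <= Q f f.
Proof.
rewrite /form addr_ge0 ?mulr_ge0 ?rsum_ge0 ?invr_ge0// => x.
  by rewrite -mulrA mulr_ge0 ?gw_ge0// -expr2 sqr_ge0.
by rewrite -mulrA mulr_ge0 ?gkappa_ge0// -expr2 sqr_ge0.
Qed.

Section Bilinear.
Variables (K : seq X).
Hypothesis uK : uniq K.

Lemma formDl f g h : fsupp K f -> fsupp K g -> fsupp K h ->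
  Q (fun x => f x + g x) h = Q f h + Q g h.
Proof.
move=> sf sg sh; rewrite !(form_fsupp uK)//; last exact: fsuppD.
rewrite -big_split/=; apply: eq_bigr => x _; rewrite opHD ?mulrDr//.
  exact: ldom_fsupp sf. exact: ldom_fsupp sg.
Qed.

Lemma formBl f g h : fsupp K f -> fsupp K g -> fsupp K h ->
  Q (fun x => f x - g x) h = Q f h - Q g h.
Proof.
move=> sf sg sh; rewrite !(form_fsupp uK)//; last exact: fsuppB.
rewrite -sumrB/=; apply: eq_bigr => x _; rewrite opHB ?mulrBr//.
  exact: ldom_fsupp sf. exact: ldom_fsupp sg.
Qed.

Lemma formDr f g h : fsupp K f -> fsupp K g -> fsupp K h ->
  Q h (fun x => f x + g x) = Q h f + Q h g.
Proof. by move=> *; rewrite formC formDl// !(formC h). Qed.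

Lemma formBr f g h : fsupp K f -> fsupp K g -> fsupp K h ->
  Q h (fun x => f x - g x) = Q h f - Q h g.
Proof. by move=> *; rewrite formC formBl// !(formC h). Qed.

(** Polarization, 4 Q(f, g) = Q(f + g) - Q(f - g), with the first term dropped. It is used for two
    sequences that approximate the same function. *)
Lemma form_polar_ge f g : fsupp K f -> fsupp K g ->
  - Q (fun x => f x - g x) (fun x => f x - g x) <= 4 * Q f g.
Proof.
move=> sf sg; have := form_ge0 (fun x => f x + g x).
have sD := fsuppD sf sg; have sB := fsuppB sf sg.
rewrite formBl// !formBr// formDl// !formDr// (formC g f); lra.
Qed.

(** Completing the square: Q(f - 2g) is nonnegative. *)
Lemma form_quarter f g : fsupp K f -> fsupp K g ->
  Q g f - Q g g <= Q f f / 4.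
Proof.
move=> sf sg; have := form_ge0 (fun x => f x - 2 * g x).
have s2 := fsuppZ 2 sg.
have h : Q (fun x => 2 * g x) f = 2 * Q g f.
  have -> : (fun x => 2 * g x) = (fun x => g x + g x) by apply/funext => x; ring.
  by rewrite formDl//; ring.
have h2 : Q (fun x => 2 * g x) (fun x => 2 * g x) = 4 * Q g g.
  have -> : (fun x => 2 * g x) = (fun x => g x + g x) by apply/funext => x; ring.
  by rewrite formDl// ?formDr//; [ring|exact: fsuppD].
rewrite formBl// ?formBr//; last exact: fsuppB.
rewrite h2 (formC f) h; lra.
Qed.

Lemma form_par f g : fsupp K f -> fsupp K g ->
  Q (fun x => f x - g x) (fun x => f x - g x) <= 2 * Q f f + 2 * Q g g.
Proof.
move=> sf sg; have := form_ge0 (fun x => f x + g x).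
have sD := fsuppD sf sg; have sB := fsuppB sf sg.
rewrite formBl// !formBr// formDl// !formDr// (formC g f); lra.
Qed.

End Bilinear.

Definition form_cauchy (fn : nat -> X -> R) := forall e : R, 0 < e -> exists k,
  forall n m, (k <= n)%N -> (k <= m)%N ->
  Q (fun x => fn n x - fn m x) (fun x => fn n x - fn m x) <= e.

Lemma fin_supp_common f g : fin_supp f -> fin_supp g ->
  exists n, fsupp (Kseq X n) f /\ fsupp (Kseq X n) g.
Proof.
move=> /fin_suppP[n sf] /fin_suppP[m sg]; exists (maxn n m).
by split; [apply: fsupp_Kseq_le sf; exact: leq_maxl|
  apply: fsupp_Kseq_le sg; exact: leq_maxr].
Qed.

Lemma fin_supp_ell2 f : fin_supp f -> ell2 G f.
Proof. by move=> /fin_suppP[n]; exact: ell2_fin. Qed.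

Lemma form_approxP f fn : ell2 G f ->
  form_approx G f fn <->
  [/\ forall n, fin_supp (fn n), cvg2 G fn f & form_cauchy fn].
Proof.
move=> sf; have H : (forall n, fin_supp (fn n)) ->
    (fun n => norm2 G (fn n \- f)) = (fun n => (nrm G (fun x => fn n x - f x))%:E).
  move=> fs; apply/funext => n; rewrite norm2E//; apply: ell2B => //.
  exact: fin_supp_ell2.
split=> -[fs c1 c2]; split => //.
- by move: c1; rewrite H// => /fine_cvg.
- move=> e e0; move: c2 => /cvgrPdist_le/(_ _ e0)[[A B] /= [[k _ kA] [l _ lB]] AB].
  exists (maxn k l) => n m; rewrite !geq_max => /andP[kn ln] /andP[km lm].
  have /= := AB (n, m) (conj (kA _ kn) (lB _ lm)).
  by rewrite sub0r normrN ger0_norm//; exact: form_ge0.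
- by rewrite H//; apply: cvg_EFin => //; exact: nearW.
- apply/cvgrPdist_le => e /c2[k hk].
  exists ([set n | (k <= n)%N], [set n | (k <= n)%N]); first by split; exists k.
  move=> [n m] /= [kn km]; rewrite sub0r normrN ger0_norm; last exact: form_ge0.
  exact: hk.
Qed.

(** Closability of the form. For fixed large [n] the energy of [r n - r m] is small for all large
    [m]; as [r m] tends to 0 pointwise, Fatou passes the smallness to [r n] itself. *)
Lemma form_closable (r : nat -> X -> R) : (forall n, fin_supp (r n)) ->
  (forall x, r n x @[n --> \oo] --> 0) -> form_cauchy r ->
  Q (r n) (r n) @[n --> \oo] --> 0.
Proof.
move=> fs r0 cau; apply/cvgrPdist_le => e e0.
have [k hk] := cau (e / 2) ltac:(by rewrite divr_gt0).
exists k => // n /= kn.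
rewrite sub0r normrN ger0_norm; last exact: form_ge0.
pose A m (p : X * X) := w p.1 p.2 * (r n p.1 - r m p.1 - (r n p.2 - r m p.2)) *
   (r n p.1 - r m p.1 - (r n p.2 - r m p.2)).
pose B m x := kappa x * (r n x - r m x) * (r n x - r m x).
(* Half the edge sum plus the killing sum is at most [e / 2], so the two are separately bounded by
   [e] and [e / 2]. In the limit these recombine to exactly [e]. *)
have S m : [/\ summ (A m), summ (B m) &
    (k <= m)%N -> rsum (A m) <= e /\ rsum (B m) <= e / 2].
  have [N [s1 s2]] := fin_supp_common (fs n) (fs m).
  have s := fsuppB s1 s2.
  have [sA sB _] := form_sum (Kseq_uniq X N) s s.
  split => // km; have := hk n m kn km; rewrite /form.
  have : 0 <= rsum (A m).
    by apply: rsum_ge0 => x; rewrite /A -mulrA mulr_ge0 ?gw_ge0// -expr2 sqr_ge0.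
  have : 0 <= rsum (B m).
    by apply: rsum_ge0 => x; rewrite /B -mulrA mulr_ge0 ?gkappa_ge0// -expr2 sqr_ge0.
  rewrite /A /B; lra.
have cv x : r n x - r m x @[m --> \oo] --> r n x.
  rewrite -[X in _ --> X]subr0; apply: cvgB; [exact: cvg_cst|exact: r0].
have [||||_ hA] := @rsum_fatou R _ A
  (fun p => w p.1 p.2 * (r n p.1 - r n p.2) * (r n p.1 - r n p.2)) e.
- by move=> m x; rewrite /A -mulrA mulr_ge0 ?gw_ge0// -expr2 sqr_ge0.
- by move=> m; have [] := S m.
- move=> p; apply: cvgM; first apply: cvgM; first exact: cvg_cst.
    by apply: cvgB; exact: cv.
  by apply: cvgB; exact: cv.
- by exists k => // m /= km; have [_ _ /(_ km)[]] := S m.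
have [||||_ hB] := @rsum_fatou R _ B (fun x => kappa x * r n x * r n x) (e / 2).
- by move=> m x; rewrite /B -mulrA mulr_ge0 ?gkappa_ge0// -expr2 sqr_ge0.
- by move=> m; have [] := S m.
- by move=> p; apply: cvgM; last exact: cv; apply: cvgM; [exact: cvg_cst|exact: cv].
- by exists k => // m /= km; have [_ _ /(_ km)[]] := S m.
rewrite /form; lra.
Qed.

End Form.

(** * The resolvent as a Galerkin limit *)

Section Resolvent.
Variables (R : realType) (X : countType) (G : graph R X).
Local Notation mu := (gmu G).
Local Notation Q := (form G).
Local Notation ip := (inner2 G).
Local Notation L2 := (ell2 G).
Local Notation K := (Kseq X).
Implicit Types (f g h v : X -> R).

(* [resn b f n] is the Galerkin approximation of [res b f], which is
   b (L + b)^{-1} f. *)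
Definition resn (b : R) f n : X -> R := gsol G n b (fun x => b * mu x * f x).
Definition res (b : R) f x : R := limn (fun n => resn b f n x).

Section Fixed.
Variable b : R.
Hypothesis b0 : 0 < b.

Lemma resn_fsupp f n : fsupp (K n) (resn b f n).
Proof. exact: gsol_fsupp. Qed.

Lemma resn_L2 f n : L2 (resn b f n).
Proof. exact: ell2_fin (@resn_fsupp f n). Qed.

Lemma galerkin f n g : L2 f -> fsupp (K n) g ->
  Q (resn b f n) g + b * ip (resn b f n) g = b * ip f g.
Proof.
move=> sf sg; have uK := Kseq_uniq X n.
rewrite (form_fsupp G uK (@resn_fsupp f n) sg).
rewrite /inner2 !(@rsum_fin _ _ _ (K n))//; last 2 first.
- by move=> x /sg ->; rewrite mulr0 mul0r.
- by move=> x /sg ->; rewrite mulr0 mul0r.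
rewrite !mulr_sumr -big_split/= big_seq [RHS]big_seq; apply: eq_bigr => x xK.
have := @gsolE R X G n b b0 (fun x => b * mu x * f x) x xK.
rewrite -/(resn b f n) => e.
transitivity (g x * (opH G (resn b f n) x + b * mu x * resn b f n x)); first by ring.
by rewrite e; ring.
Qed.

Lemma galerkin_self f n : L2 f ->
  Q (resn b f n) (resn b f n) + b * ip (resn b f n) (resn b f n) =
  b * ip f (resn b f n).
Proof. by move=> sf; apply: galerkin => //; exact: resn_fsupp. Qed.

(** Galerkin orthogonality: the n-th equation is tested with both solutions, the m-th with its own.
    The distance becomes an increment of the sequence [ip f (resn b f n)], which is thus
    nondecreasing; as it is also bounded, the approximations are Cauchy in energy and in norm. *)
Lemma galerkin_diff f n m : L2 f -> (m <= n)%N ->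
  let d := fun x => resn b f n x - resn b f m x in
  Q d d + b * ip d d = b * (ip f (resn b f n) - ip f (resn b f m)).
Proof.
move=> sf mn d; have sn := @resn_fsupp f n.
have sm := fsupp_Kseq_le mn (@resn_fsupp f m).
have sd : fsupp (K n) d by exact: fsuppB.
have uK := Kseq_uniq X n.
have e1 := galerkin sf sn; have e2 := galerkin sf sm.
have e3 := galerkin_self m sf.
have ln := resn_L2 f n; have lm := resn_L2 f m.
have ld : L2 d by exact: ell2B.
rewrite {1 3}/d (formBl G uK)// (ipBl ln lm ld) /d !(formBr G uK)// !ipBr//.
rewrite (formC G (resn b f m) (resn b f n)) (ipC G (resn b f m) (resn b f n)).
lra.
Qed.

Lemma resn_nrm_le f n : L2 f -> nrm G (resn b f n) <= nrm G f.
Proof.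
move=> sf; have e := galerkin_self n sf; have q := form_ge0 G (resn b f n).
have c := cauchy_schwarz sf (resn_L2 f n).
have : b * ip (resn b f n) (resn b f n) <= b * (nrm G f * nrm G (resn b f n)).
  have : b * ip f (resn b f n) <= b * (nrm G f * nrm G (resn b f n)) by rewrite ler_pM2l.
  lra.
rewrite ler_pM2l// -nrm_sqr expr2.
have := nrm_ge0 G (resn b f n); rewrite le_eqVlt => /orP[/eqP <-|h].
  by rewrite nrm_ge0.
by rewrite ler_pM2r.
Qed.

Lemma resn_energy_cauchy f : L2 f -> forall e : R, 0 < e -> exists k, forall n m,
  (k <= n)%N -> (k <= m)%N ->
  let d := fun x => resn b f n x - resn b f m x in Q d d + b * ip d d <= e.
Proof.
move=> sf; pose s n := ip f (resn b f n).
have smono n m : (m <= n)%N -> s m <= s n.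
  move=> mn; have := galerkin_diff sf mn => /= h.
  rewrite -subr_ge0 -(pmulr_rge0 _ b0) -h.
  by rewrite addr_ge0 ?form_ge0// mulr_ge0 ?ip_ge0// ltW.
have sb n : s n <= nrm G f * nrm G f.
  apply: le_trans (cauchy_schwarz sf (resn_L2 f n)) _.
  by apply: ler_wpM2l; [exact: nrm_ge0|exact: resn_nrm_le].
have sc : cvgn s.
  apply: nondecreasing_is_cvgn; first by move=> n m; exact: smono.
  by exists (nrm G f * nrm G f) => _ [n _ <-].
have sl n : s n <= limn s.
  apply: (@nondecreasing_cvgn_le R s) => //; by move=> p q; exact: smono.
move=> e e0; have [k _ hk] := (cvgrPdist_le _ _).1 sc (e / b) (divr_gt0 e0 b0).
exists k => n m kn km; wlog mn : n m kn km / (m <= n)%N.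
  move=> H; have [|/ltnW nm] := leqP m n; first exact: H.
  have := H _ _ km kn nm; congr (_ <= _) => /=.
  have dE : (fun x => resn b f m x - resn b f n x) =
     (fun x => - 1 * (resn b f n x - resn b f m x)).
    by apply/funext => x; ring.
  rewrite dE.
  have sd : fsupp (K m) (fun x => resn b f n x - resn b f m x).
    by apply: fsuppB; [exact: fsupp_Kseq_le nm (@resn_fsupp f n)|exact: resn_fsupp].
  have ld := ell2B (resn_L2 f n) (resn_L2 f m).
  rewrite ipZl// ?ipZr//; last exact: ell2Z.
  rewrite /form; congr (_ * _ + _ + _); [| |ring].
    by apply: eq_rsum => x; ring.
  by apply: eq_rsum => x; ring.
rewrite /= galerkin_diff// -ler_pdivlMl// mulrC.
have := hk m km; have := sl n; have := sl m; rewrite /s.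
move=> h1 h2; rewrite ger0_norm ?subr_ge0//; lra.
Qed.

Lemma resn_cvg f : L2 f ->
  [/\ L2 (res b f), cvg2 G (resn b f) (res b f) &
      forall x, resn b f n x @[n --> \oo] --> res b f x].
Proof.
move=> sf; have [|v [sv cv _]] := @ell2_complete R X G (resn b f) (resn_L2 f).
  move=> e e0.
  have [k hk] := resn_energy_cauchy sf (mulr_gt0 b0 (exprn_gt0 2 e0)).
  exists k => n m kn km; have := hk n m kn km => /= h.
  have q := form_ge0 G (fun x => resn b f n x - resn b f m x).
  have : b * ip (fun x => resn b f n x - resn b f m x)
    (fun x => resn b f n x - resn b f m x) <= b * e ^+ 2 by lra.
  rewrite ler_pM2l// -nrm_sqr => h2.
  by rewrite -(@ler_pXn2r _ 2)// ?nnegrE ?nrm_ge0// ltW.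
have pv x : resn b f n x @[n --> \oo] --> v x.
  by apply: (@cvg2_pointwise _ _ G) => // n; exact: resn_L2.
have -> : res b f = v by apply/funext => x; apply/cvg_lim => //; exact: pv.
by [].
Qed.

Lemma res_L2 f : L2 f -> L2 (res b f).
Proof. by move=> /resn_cvg[]. Qed.

Lemma res_approx f : L2 f -> form_approx G (res b f) (resn b f).
Proof.
move=> sf; have [sv cv _] := resn_cvg sf.
apply/form_approxP => //; split => //.
  by move=> n; exact: fsupp_fin (@resn_fsupp f n).
move=> e /(resn_energy_cauchy sf)[k hk]; exists k => n m kn km.
have := hk n m kn km => /=.
have := ip_ge0 G (fun x => resn b f n x - resn b f m x).
rewrite -(pmulr_rge0 _ b0); lra.
Qed.

Lemma res_graph f : L2 f -> L_graph G (res b f) (fun x => b * (f x - res b f x)).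
Proof.
move=> sf; have [sv cv _] := resn_cvg sf.
have sh : L2 (fun x => b * (f x - res b f x)) by apply: ell2Z; exact: ell2B.
split => //; first by split => //; exists (resn b f); exact: res_approx.
move=> g [sg [gn agn]]; have /form_approxP [//|fg cg caug] := agn.
have /choice[N hN] : forall n, exists N, fsupp (K N) (gn n).
  by move=> n; exact: fin_suppP.
(* The Galerkin index is raised until its set contains the support of [gn n]; then the weak equation
   tested with [gn n] holds exactly for every [n]. *)
pose nu n := maxn n (N n).
have nule n : (n <= nu n)%N by exact: leq_maxl.
have sgn n : fsupp (K (nu n)) (gn n).
  by apply: fsupp_Kseq_le (hN n); exact: leq_maxr.
have lgn n : L2 (gn n) by exact: ell2_fin (sgn n).
have cnu : cvg2 G (fun n => resn b f (nu n)) (res b f).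
  apply/cvg2P => e /((cvg2P _ _ _).1 cv)[k _ hk]; exists k => // n /= kn.
  by apply: hk; rewrite /= (leq_trans kn).
exists (fun n => resn b f (nu n)), gn; split => //.
  apply/form_approxP => //; split => //.
    by move=> n; exact: fsupp_fin (@resn_fsupp f (nu n)).
  have /form_approxP [//|_ _ cau] := res_approx sf.
  by move=> e /cau[k hk]; exists k => n m kn km; apply: hk;
    [exact: leq_trans kn _|exact: leq_trans km _].
have -> : (fun n => Q (resn b f (nu n)) (gn n)) =
    (fun n => b * (ip f (gn n) - ip (resn b f (nu n)) (gn n))).
  by apply/funext => n; have := galerkin sf (sgn n); lra.
have -> : ip (fun x => b * (f x - res b f x)) g = b * (ip f g - ip (res b f) g).
  by rewrite ipZl// ?ipBl//; exact: ell2B.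
apply: cvgM; first exact: cvg_cst.
apply: cvgB; first apply: cvg2_ip => //.
  apply/cvg2P => e e0; apply: nearW => n.
  under [X in nrm _ X]eq_fun do rewrite subrr.
  by rewrite nrm0 ltW.
by apply: cvg2_ip => // n; exact: resn_L2.
Qed.

Lemma res_le f (Z : X -> R) x : L2 f -> ldom G Z -> (forall x, 0 <= Z x) ->
  (forall x, b * mu x * f x <= opH G Z x + b * mu x * Z x) -> res b f x <= Z x.
Proof.
move=> sf dZ Z0 hZ; have [_ _ /(_ x) cv] := resn_cvg sf.
rewrite -(cvg_lim _ cv)//; apply: limr_le; first by apply/cvg_ex; exists (res b f x).
by apply: nearW => n; apply: gsol_le.
Qed.

Lemma res_ge0 f x : L2 f -> (forall x, 0 <= f x) -> 0 <= res b f x.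
Proof.
move=> sf f0; have [_ _ /(_ x) cv] := resn_cvg sf.
rewrite -(cvg_lim _ cv)//; apply: limr_ge; first by apply/cvg_ex; exists (res b f x).
apply: nearW => n; apply: gsol_ge0 => // y _.
by rewrite !mulr_ge0// ltW// gmu_gt0.
Qed.

Lemma res_lin (a : R) f g x : L2 f -> L2 g ->
  res b (fun x => a * f x + g x) x = a * res b f x + res b g x.
Proof.
move=> sf sg; have [_ _ /(_ x) cf] := resn_cvg sf; have [_ _ /(_ x) cg] := resn_cvg sg.
have c : a * resn b f n x + resn b g n x @[n --> \oo] --> a * res b f x + res b g x.
  by apply: cvgD => //; apply: cvgM => //; exact: cvg_cst.
rewrite /res -(cvg_lim _ c)//; congr (limn _); apply/funext => n.
have sZ := fsuppZ a (@resn_fsupp f n).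
rewrite /resn -(@gsol_uniq _ _ G n b b0 _
  (fun x => a * resn b f n x + resn b g n x))//.
  by apply: fsuppD => //; exact: resn_fsupp.
move=> y yK; have df := ldom_fsupp G (@resn_fsupp f n).
have dg := ldom_fsupp G (@resn_fsupp g n).
rewrite opHD//; last exact: ldomZ.
rewrite opHZ//.
have := @gsolE _ _ G n b b0 (fun x => b * mu x * f x) y yK.
have := @gsolE _ _ G n b b0 (fun x => b * mu x * g x) y yK.
rewrite -/(resn b f n) -/(resn b g n) => e1 e2.
transitivity (a * (b * mu y * f y) + b * mu y * g y); last by ring.
rewrite -e1 -e2; ring.
Qed.

(* The minimizing property of the resolvent, tested against f itself. *)
Lemma res_dist f n : fsupp (K n) f ->
  b * ip (fun x => res b f x - f x) (fun x => res b f x - f x) <= Q f f / 4.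
Proof.
move=> sf; have lf : L2 f by exact: ell2_fin sf.
have [sv cv _] := resn_cvg lf.
have lr := resn_L2 f.
have c : b * ip (fun x => resn b f m x - f x) (fun x => resn b f m x - f x)
    @[m --> \oo] --> b * ip (fun x => res b f x - f x) (fun x => res b f x - f x).
  have cd : cvg2 G (fun m x => resn b f m x - f x) (fun x => res b f x - f x).
    apply/cvg2P => e /((cvg2P _ _ _).1 cv); apply: filterS => m.
    by congr (_ <= _); congr nrm; apply/funext => x; ring.
  apply: cvgM; first exact: cvg_cst.
  by apply: cvg2_ip => // [m|m||]; exact: ell2B.
rewrite -(cvg_lim _ c)//; apply: limr_le.
  by apply/cvg_ex; eexists; exact: c.
exists n => // m /= nm; have sfm := fsupp_Kseq_le nm sf.
have sr := @resn_fsupp f m; have sd := fsuppB sr sfm.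
have := galerkin lf sd; have := form_quarter G (Kseq_uniq X m) sfm sr.
rewrite (formBr G (Kseq_uniq X m))//.
have lrm := lr m; have ld := ell2B lrm lf.
rewrite (ipBl lrm lf ld); lra.
Qed.

End Fixed.

(** The closed form at (v, v) comes with two approximating sequences that may differ, so the values
    need not be nonnegative. By polarization they are at least minus a quarter of the energy of the
    difference, and this tends to 0 by closability. *)
Lemma L_graph_accretive v h : L_graph G v h -> 0 <= ip h v.
Proof.
move=> [dv sh /(_ v dv)[fn [gn [+ + c]]]]; have sv := dv.1.
move=> /form_approxP [//|ff cf cauf] /form_approxP [//|fg cg caug].
pose r n x := fn n x - gn n x.
have lf n := fin_supp_ell2 G (ff n); have lg n := fin_supp_ell2 G (fg n).
have frn n : exists N, fsupp (K N) (fn n) /\ fsupp (K N) (gn n).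
  exact: fin_supp_common.
have fr n : fin_supp (r n).
  by have [N [s1 s2]] := frn n; exact: fsupp_fin (fsuppB s1 s2).
have r0 x : r n x @[n --> \oo] --> 0.
  have : fn n x - gn n x @[n --> \oo] --> v x - v x.
    by apply: cvgB; exact: cvg2_pointwise.
  by rewrite subrr.
have cr : form_cauchy G r.
  move=> e e0; have e4 : 0 < e / 4 by rewrite divr_gt0.
  have [k1 h1] := cauf _ e4; have [k2 h2] := caug _ e4.
  exists (maxn k1 k2) => n m; rewrite !geq_max => /andP[n1 n2] /andP[m1 m2].
  have [N [s1 s2]] := frn n; have [M [t1 t2]] := frn m.
  have u1 := fsupp_Kseq_le (leq_maxl N M) s1.
  have u2 := fsupp_Kseq_le (leq_maxl N M) s2.
  have u3 := fsupp_Kseq_le (leq_maxr N M) t1.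
  have u4 := fsupp_Kseq_le (leq_maxr N M) t2.
  have := form_par G (Kseq_uniq X (maxn N M)) (fsuppB u1 u3) (fsuppB u2 u4).
  have := h1 n m n1 m1; have := h2 n m n2 m2.
  have -> : (fun x => r n x - r m x) =
    (fun x => fn n x - fn m x - (gn n x - gn m x)).
    by apply/funext => x; rewrite /r; ring.
  lra.
have cQ := form_closable fr r0 cr.
have : 4 * Q (fn n) (gn n) + Q (r n) (r n) @[n --> \oo] --> 4 * ip h v + 0.
  by apply: cvgD => //; apply: cvgM => //; exact: cvg_cst.
rewrite addr0 => c4.
suff : 0 <= 4 * ip h v by rewrite pmulr_rge0.
rewrite -(cvg_lim _ c4)//; apply: limr_ge; first by apply/cvg_ex; exists (4 * ip h v).
apply: nearW => n; have [N [s1 s2]] := frn n.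
have := form_polar_ge G (Kseq_uniq X N) s1 s2; rewrite /r; lra.
Qed.

End Resolvent.

(** * Uniform boundedness *)

Section UniformBoundedness.
Variables (R : realType) (X : countType) (G : graph R X).
Local Notation L2 := (ell2 G).
Local Notation nrm := (nrm G).
Implicit Types (f g h v : X -> R).

Definition lin_bounded (T : (X -> R) -> X -> R) : Prop :=
  [/\ forall f, L2 f -> L2 (T f),
      forall (a : R) f g, L2 f -> L2 g ->
        T (fun x => a * f x + g x) = (fun x => a * T f x + T g x) &
      exists2 M : R, 0 <= M & forall f, L2 f -> nrm (T f) <= M * nrm f].

Section Lin.
Variable T : (X -> R) -> X -> R.
Hypothesis TB : lin_bounded T.

Lemma lb0 : T (fun=> 0) = fun=> 0.
Proof.
case: TB => _ lin _; have := lin (-1) _ _ (ell2_0 G) (ell2_0 G).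
have -> : (fun _ : X => -1 * 0 + 0 : R) = fun=> 0.
  by apply/funext => x; ring.
by move=> /funeqP e; apply/funext => x; have := e x; lra.
Qed.

Lemma lbZ (a : R) f : L2 f -> T (fun x => a * f x) = fun x => a * T f x.
Proof.
case: TB => _ lin _ sf; have := lin a f _ sf (ell2_0 G); rewrite lb0.
by under eq_fun do rewrite addr0; under [RHS]eq_fun do rewrite addr0.
Qed.

Lemma lbD f g : L2 f -> L2 g -> T (fun x => f x + g x) = fun x => T f x + T g x.
Proof.
case: TB => _ lin _ sf sg; have := lin 1 f g sf sg.
by under eq_fun do rewrite mul1r; under [RHS]eq_fun do rewrite mul1r.
Qed.

Lemma lbB f g : L2 f -> L2 g -> T (fun x => f x - g x) = fun x => T f x - T g x.
Proof.
case: TB => _ lin _ sf sg; have := lin (-1) g f sg sf.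
have -> : (fun x => -1 * g x + f x) = fun x => f x - g x by apply/funext => x; ring.
by move=> ->; apply/funext => x; ring.
Qed.

(** [N] is the operator norm and [f0] almost attains it. The fraction [2 / 3] has to exceed the
    [1 / 2] that the tail of the gliding hump series can cancel. *)
Lemma near_norming : exists2 N : R, 0 <= N &
  (forall f, L2 f -> nrm (T f) <= N * nrm f) /\
  exists f0, [/\ L2 f0, nrm f0 <= 1 & 2 / 3 * N <= nrm (T f0)].
Proof.
case: TB => TL _ [M M0 TM].
pose A : set R := [set y | exists f, [/\ L2 f, nrm f <= 1 & y = nrm (T f)]].
have A0 : A 0.
  by exists (fun=> 0); rewrite lb0 nrm0; split => //; exact: ell2_0.
have supA : has_sup A.
  split; first by exists 0.
  exists M => _ [f [sf f1 ->]]; apply: le_trans (TM f sf) _.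
  by rewrite ler_piMr.
have N0 : 0 <= sup A by exact: ub_le_sup supA.2 _ A0.
exists (sup A) => //; split=> [f sf|].
  have [f0|fn0] := eqVneq (nrm f) 0.
    by rewrite (nrm_eq0 sf f0) lb0 !nrm0 mulr0.
  have fp : 0 < nrm f by rewrite lt_neqAle eq_sym fn0 nrm_ge0.
  rewrite -ler_pdivrMr// mulrC.
  have := lbZ (nrm f)^-1 sf => e.
  have i0 : 0 <= (nrm f)^-1 by rewrite invr_ge0 nrm_ge0.
  rewrite -[X in X * _](ger0_norm i0) -(nrmZ (nrm f)^-1 (TL f sf)) -e.
  apply: ub_le_sup; first exact: supA.2.
  exists (fun x => (nrm f)^-1 * f x); split => //; first exact: ell2Z.
  by rewrite nrmZ// ger0_norm// mulVf.
move: N0; rewrite le_eqVlt => /orP[/eqP <-|N0].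
  exists (fun=> 0); rewrite lb0 nrm0 mulr0; split => //; exact: ell2_0.
have [_ [f [sf f1 ->]] hf] := sup_adherent (divr_gt0 N0 (ltr0n _ 3)) supA.
by exists f; split => //; lra.
Qed.

End Lin.

(* Gliding hump (Sokal's proof of the uniform boundedness theorem): one of
   x + xi, x - xi has an image at least as large as that of xi. *)
Lemma uniform_bounded (T : nat -> (X -> R) -> X -> R) :
  (forall n, lin_bounded (T n)) ->
  (forall f, L2 f -> exists B : R, forall n, nrm (T n f) <= B) ->
  exists M : R, forall n f, L2 f -> nrm (T n f) <= M * nrm f.
Proof.
move=> TB pb; apply: contrapT => nb.
(* The k-th hump will have size 3^-k; the factor [3 ^+ k] compensates for it and leaves an image of
   order [k]. *)
have hk k : exists n, ~ forall f, L2 f -> nrm (T n f) <= k%:R * 3 ^+ k * nrm f.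
  apply: contrapT => h; apply: nb; exists (k%:R * 3 ^+ k) => n.
  by apply: contrapT => h'; apply: h; exists n.
have /choice[nu hnu] := hk.
have /choice[f0 hf0] : forall k, exists f0, [/\ L2 f0, nrm f0 <= 1 &
    exists N : R, [/\ forall f, L2 f -> nrm (T (nu k) f) <= N * nrm f,
      k%:R * 3 ^+ k <= N & 2 / 3 * N <= nrm (T (nu k) f0)]].
  move=> k; have [N N0 [hN [f [sf f1 hf]]]] := near_norming (TB (nu k)).
  exists f; split => //; exists N; split => //.
  rewrite leNgt; apply/negP => lt; apply: (hnu k) => g sg.
  apply: le_trans (hN g sg) _; apply: ler_wpM2r; [exact: nrm_ge0|exact: ltW].
pose xi k x := 3^-1 ^+ k * f0 k x.
pose step k (y : X -> R) : X -> R :=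
  if nrm (T (nu k) (xi k)) <= nrm (T (nu k) (fun x => y x + xi k x))
  then fun x => y x + xi k x else fun x => y x - xi k x.
pose fix y k : X -> R := if k is k'.+1 then step k' (y k') else fun=> 0.
have i3 k : 0 <= 3^-1 ^+ k :> R by rewrite exprn_ge0.
have Lxi k : L2 (xi k) by apply: ell2Z; have [] := hf0 k.
have Ly k : L2 (y k).
  elim: k => [|k ih] /=; first exact: ell2_0.
  by rewrite /step; case: ifP => _; [exact: ell2D|exact: ell2B].
have nxi k : nrm (xi k) <= 3^-1 ^+ k.
  have [sf f1 _] := hf0 k.
  by rewrite nrmZ// ger0_norm// ler_piMr.
have ystep k : nrm (fun x => y k.+1 x - y k x) <= 3^-1 ^+ k.
  rewrite /= /step; case: ifP => _.
    rewrite (_ : (fun x => _) = xi k)//; by apply/funext => x; ring.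
  rewrite (_ : (fun x => _) = fun x => - xi k x) ?nrmN//.
  by apply/funext => x; ring.
have ybig k : nrm (T (nu k) (xi k)) <= nrm (T (nu k) (y k.+1)).
  rewrite /= /step; case: ifPn => //; rewrite -ltNge => lt.
  have Tk := TB (nu k); have [TL _ _] := Tk.
  have := nrmB (TL _ (ell2D (Ly k) (Lxi k))) (TL _ (ell2B (Ly k) (Lxi k))).
  have -> : (fun x => T (nu k) (fun x0 => y k x0 + xi k x0) x -
      T (nu k) (fun x0 => y k x0 - xi k x0) x) = (fun x => 2 * T (nu k) (xi k) x).
    rewrite (lbD Tk)// (lbB Tk)//; apply/funext => x; ring.
  rewrite nrmZ; last exact: TL.
  rewrite ger0_norm//; lra.
clearbody y.
have ycau k m : (k <= m)%N ->
    nrm (fun x => y m x - y k x) <= 3 / 2 * (3^-1 ^+ k - 3^-1 ^+ m).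
  move=> /subnK <-; elim: (m - k)%N => [|j ih].
    rewrite add0n subrr mulr0 (_ : (fun x => _) = fun=> 0) ?nrm0//.
    by apply/funext => x; rewrite subrr.
  apply: le_trans (nrm_triB (Ly _) (Ly (j + k)%N) (Ly k)) _.
  rewrite addSn exprS; have := ystep (j + k)%N; lra.
have ycau2 k m : (k <= m)%N -> nrm (fun x => y m x - y k x) <= 3 / 2 * 3^-1 ^+ k.
  by move=> /ycau; have := i3 m; lra.
have small (e : R) : 0 < e -> exists k, 3 * 3^-1 ^+ k <= e.
  move=> e0; have : (fun k => 3 * 3^-1 ^+ k : R) @ \oo --> (3 * 0 : R).
    apply: cvgM; first exact: cvg_cst.
    by apply: cvg_expr; rewrite ger0_norm// invf_lt1// ltr1n.
  rewrite mulr0 => /cvgrPdist_le/(_ e e0)[k _ /(_ k (leqnn k))] /=.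
  rewrite sub0r normrN => h; exists k; exact: le_trans (ler_norm _) h.
have [|z [Lz _ hz]] := ell2_complete Ly.
  move=> e /small[k ke]; exists k => n m kn km.
  apply: le_trans (nrm_triB (Ly n) (Ly k) (Ly m)) _.
  rewrite (nrmBC (Ly k) (Ly m)).
  have := ycau2 _ _ kn; have := ycau2 _ _ km; lra.
have yz k : nrm (fun x => y k.+1 x - z x) <= 2^-1 * 3^-1 ^+ k.
  apply: hz; exists k.+1 => // m /= km; rewrite (nrmBC (Ly k.+1) (Ly m)).
  by have := ycau2 _ _ km; rewrite exprS; lra.
have [B hB] := pb z Lz.
have B0 : 0 <= B by exact: le_trans (nrm_ge0 _ _) (hB 0%N).
(* The hump contributes at least 2/3 of N 3^-q, the steps after it at most 1/2 of it, and N 3^-q is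
   at least q. The image of [z] thus has norm at least q / 6, which has to exceed [B]. *)
pose q := (Num.trunc (6 * B)).+1.
have qB : 6 * B < q%:R by rewrite /q truncnS_gt.
have [Lf _ [N [hN qN h2N]]] := hf0 q.
have Tk := TB (nu q); have [TL _ _] := Tk.
have e1 : nrm (T (nu q) (xi q)) = 3^-1 ^+ q * nrm (T (nu q) (f0 q)).
  by rewrite /xi (lbZ Tk)// nrmZ ?ger0_norm//; exact: TL.
have e2 := ybig q.
have : nrm (T (nu q) (y q.+1)) <= nrm (T (nu q) z) + N * (2^-1 * 3^-1 ^+ q).
  have sd := ell2B (Ly q.+1) Lz.
  have N0 : 0 <= N by apply: le_trans qN; rewrite mulr_ge0// exprn_ge0.
  have -> : y q.+1 = fun x => z x + (y q.+1 x - z x) by apply/funext => x; ring.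
  rewrite (lbD Tk Lz sd).
  apply: le_trans (nrmD (TL _ Lz) (TL _ sd)) _; rewrite lerD2l.
  have hNd := hN _ sd; apply: le_trans hNd _; apply: ler_wpM2l => //.
have := hB (nu q).
have : 3^-1 ^+ q * (2 / 3 * N) <= 3^-1 ^+ q * nrm (T (nu q) (f0 q)).
  by rewrite ler_wpM2l.
have : q%:R <= 3^-1 ^+ q * N.
  rewrite -(@ler_pM2l _ (3 ^+ q)) ?exprn_gt0// mulrA -exprMn mulfV// expr1n mul1r.
  by rewrite mulrC.
lra.
Qed.

End UniformBoundedness.

(** * The heat semigroup and its Chernoff approximation *)

Section Semigroup.
Variables (R : realType) (X : countType) (G : graph R X).
Local Notation mu := (gmu G).
Local Notation L2 := (ell2 G).
Local Notation nrm := (nrm G).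
Local Notation res := (res G).
Implicit Types (f g h v : X -> R).
Variable S : R -> (X -> R) -> X -> R.
Hypothesis hS : heat_semigroup G S.

Lemma norm2_cvg0P (F : R -> X -> R) : (forall t, 0 < t -> L2 (F t)) ->
  norm2 G (F t) @[t --> 0^'+] --> 0%E <->
  forall e : R, 0 < e -> exists2 d : R, 0 < d &
    forall t, 0 < t -> t < d -> nrm (F t) <= e.
Proof.
move=> LF; split=> [/fine_cvg/cvgrPdist_le h e e0|h].
  have [d /= d0 hd] := h e e0; exists d => // t t0 td.
  have := hd t; rewrite /ball_/= sub0r normrN (gtr0_norm t0) => /(_ td t0) H.
  have {H} : `|0 - nrm (F t)| <= e by move: H; rewrite norm2E//; exact: LF.
  by rewrite distrC subr0 ger0_norm// nrm_ge0.
apply: cvg_EFin.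
  by exists 1 => //= t _ t0; rewrite norm2E//; exact: LF.
apply/cvgrPdist_le => e e0; have [d d0 hd] := h e e0.
exists d => //= t td t0.
have {}td : t < d.
  by move: td; rewrite /ball_/= ?sub0r ?normrN; apply: le_lt_trans; exact: ler_norm.
rewrite norm2E; last exact: LF.
by rewrite /= ?sub0r ?normrN ger0_norm ?nrm_ge0// hd.
Qed.

Lemma S_L2 t f : 0 <= t -> L2 f -> L2 (S t f).
Proof. by case: hS => h _ _ _; exact: h. Qed.

Lemma S_lb t : 0 <= t -> lin_bounded G (S t).
Proof.
move=> t0; case: (hS) => _ lin bd _; split.
- by move=> f; exact: S_L2.
- by move=> a f g; exact: lin.
- have [M hM] := bd t t0; exists (Num.max M 0).
    by rewrite le_max lexx orbT.
  move=> f sf; have := hM f sf; rewrite !norm2E//; last exact: S_L2.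
  rewrite -EFinM lee_fin => /le_trans; apply.
  by rewrite ler_wpM2r ?nrm_ge0// le_max lexx.
Qed.

Lemma S_0 f : L2 f -> S 0 f = f.
Proof. by case: hS => _ _ _ [h _ _ _]; exact: h. Qed.

Lemma S_add s t f : 0 <= s -> 0 <= t -> L2 f -> S (s + t) f = S s (S t f).
Proof. by case: hS => _ _ _ [_ h _ _]; exact: h. Qed.

Lemma S_right f : L2 f -> forall e : R, 0 < e -> exists2 d : R, 0 < d &
    forall t, 0 <= t -> t < d -> nrm (fun x => S t f x - f x) <= e.
Proof.
move=> sf e e0; case: (hS) => _ _ _ [_ _ /(_ f sf) h _].
have /norm2_cvg0P h' := h; have [t t0|d d0 hd] := h' _ e e0.
  by apply: ell2B => //; apply: S_L2 => //; exact: ltW.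
exists d => // t; rewrite le_eqVlt => /orP[/eqP <- _|t0 td]; last exact: hd.
rewrite S_0// (_ : (fun x => _) = fun=> 0) ?nrm0 ?ltW//.
by apply/funext => x; rewrite subrr.
Qed.

(** The right derivative of [S t f] at 0 is [- h], stated with real norms; by [genP] this is L f =
    h. *)
Definition gen f h := forall e : R, 0 < e -> exists2 d : R, 0 < d &
    forall t, 0 < t -> t < d -> nrm (fun x => (S t f x - f x) / t + h x) <= e.

Lemma quot_L2 t f h : 0 < t -> L2 f -> L2 h ->
  L2 (fun x => (S t f x - f x) / t + h x).
Proof.
move=> t0 sf sh; apply: ell2D => //.
under eq_fun do rewrite mulrC.
by apply: ell2Z; apply: ell2B => //; apply: S_L2 => //; exact: ltW.
Qed.

Lemma genP f h : L2 f -> L2 h -> L_graph G f h <-> gen f h.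
Proof.
move=> sf sh; case: (hS) => _ _ _ [_ _ _ /(_ f h sf sh) ->].
by apply: norm2_cvg0P => t t0; exact: quot_L2.
Qed.

Lemma gen_sub f h f' h' : L2 f -> L2 h -> L2 f' -> L2 h' ->
  gen f h -> gen f' h' -> gen (fun x => f x - f' x) (fun x => h x - h' x).
Proof.
move=> sf sh sf' sh' g g' e e0.
have e2 : 0 < e / 2 by rewrite divr_gt0.
have [d d0 hd] := g _ e2; have [d' d0' hd'] := g' _ e2.
exists (Num.min d d'); first by rewrite lt_min d0.
move=> t t0; rewrite lt_min => /andP[td td'].
rewrite (lbB (S_lb (ltW t0)))//.
have := nrmB (quot_L2 t0 sf sh) (quot_L2 t0 sf' sh').
have -> : (fun x => (S t f x - S t f' x - (f x - f' x)) / t + (h x - h' x)) =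
  (fun x => (S t f x - f x) / t + h x - ((S t f' x - f' x) / t + h' x)).
  by apply/funext => x; ring.
have := hd t t0 td; have := hd' t t0 td'; lra.
Qed.

Lemma gen_S s f h : 0 <= s -> L2 f -> L2 h -> gen f h -> gen (S s f) (S s h).
Proof.
move=> s0 sf sh g e e0; have [TL lin [M M0 hM]] := S_lb s0.
have M1 : 0 < M + 1 by lra.
have [d d0 hd] := g _ (divr_gt0 e0 M1); exists d => // t t0 td.
have sd : L2 (fun x => S t f x - f x) by apply: ell2B => //; apply: S_L2 => //; exact: ltW.
have SC : S t (S s f) = S s (S t f) by rewrite -!S_add ?(ltW t0)// addrC.
rewrite SC; have -> : (fun x => (S s (S t f) x - S s f x) / t + S s h x) =
    S s (fun x => (S t f x - f x) / t + h x).
  have -> : (fun x => (S t f x - f x) / t + h x) =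
    (fun x => t^-1 * (S t f x - f x) + h x) by apply/funext => x; rewrite mulrC.
  rewrite lin// (lbB (S_lb s0))//; last by apply: S_L2 => //; exact: ltW.
  by apply/funext => x; ring.
apply: le_trans (hM _ (quot_L2 t0 sf sh)) _.
have := hd t t0 td; have n0 := nrm_ge0 G (fun x => (S t f x - f x) / t + h x).
rewrite -(@ler_pM2l _ (M + 1))// mulrCA mulfV ?gt_eqF// mulr1.
apply: le_trans; apply: ler_wpM2r => //; lra.
Qed.

(** Expanding the square, the cross term is nonnegative by accretivity. Read as the inverse of 1 + c
    L being a contraction, it bounds an error by its residual. *)
Lemma gen_contraction f h (c : R) : 0 <= c -> L2 f -> L2 h -> gen f h ->
  nrm f <= nrm (fun x => f x + c * h x).
Proof.
move=> c0 sf sh /(genP sf sh) /L_graph_accretive acc.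
have sc := ell2Z c sh; have sfc := ell2D sf sc.
rewrite /nrm ler_sqrt ?ip_ge0//.
rewrite ipDl// !ipDr// !ipZl// !ipZr// (ipC G f h).
have := ip_ge0 G h => hh.
have : 0 <= c * inner2 G h f by rewrite mulr_ge0.
have : 0 <= c * (c * inner2 G h h) by rewrite !mulr_ge0.
lra.
Qed.

Section Res.
Variable b : R.
Hypothesis b0 : 0 < b.

Lemma res_gen_L2 f : L2 f -> L2 (fun x => b * (f x - res b f x)).
Proof. by move=> sf; apply: ell2Z; apply: ell2B => //; exact: res_L2. Qed.

Lemma res_gen f : L2 f -> gen (res b f) (fun x => b * (f x - res b f x)).
Proof.
move=> sf; apply/genP; [exact: res_L2|exact: res_gen_L2|exact: res_graph].
Qed.

Lemma res_lip f g : L2 f -> L2 g ->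
  nrm (fun x => res b f x - res b g x) <= nrm (fun x => f x - g x).
Proof.
move=> sf sg; have rf := res_L2 b0 sf; have rg := res_L2 b0 sg.
have hf := res_gen_L2 sf; have hg := res_gen_L2 sg.
have := gen_sub rf hf rg hg (res_gen sf) (res_gen sg).
have ib : 0 <= b^-1 by rewrite invr_ge0 ltW.
move=> /(gen_contraction ib (ell2B rf rg) (ell2B hf hg)) /le_trans; apply.
rewrite le_eqVlt; apply/orP; left; apply/eqP; congr nrm; apply/funext => x.
by rewrite -mulrBr mulKf ?gt_eqF//; ring.
Qed.

End Res.

Lemma iter_res_L2 b n f : 0 < b -> L2 f -> L2 (iter n (res b) f).
Proof. by move=> b0 sf; elim: n => //= n; exact: res_L2. Qed.

Lemma iter_res_lip b n f g : 0 < b -> L2 f -> L2 g ->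
  nrm (fun x => iter n (res b) f x - iter n (res b) g x) <= nrm (fun x => f x - g x).
Proof.
move=> b0 sf sg; elim: n => //= n; apply: le_trans.
by apply: res_lip => //; exact: iter_res_L2.
Qed.

Lemma S_mulrn (k : nat) t f : 0 <= t -> L2 f -> S (k%:R * t) f = iter k (S t) f.
Proof.
move=> t0 sf; elim: k => [|k ih]; first by rewrite mul0r S_0.
rewrite iterS -ih -S_add//; last by rewrite mulr_ge0.
by rewrite -natr1 mulrDl mul1r addrC.
Qed.

(** The definition bounds each [S t] separately. If no bound held near 0, there would be times
    tending to 0 with operator norms tending to infinity, although right continuity bounds every
    single orbit along them; uniform boundedness excludes this. *)
Lemma S_locally_bounded : exists d : R, 0 < d /\ exists M : R,
  forall t f, 0 <= t -> t <= d -> L2 f -> nrm (S t f) <= M * nrm f.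
Proof.
apply: contrapT => nb.
have /choice[t ht] : forall n : nat, exists t : R, [/\ 0 <= t, t <= n.+1%:R^-1 &
    ~ forall f, L2 f -> nrm (S t f) <= n%:R * nrm f].
  move=> n; apply: contrapT => h; apply: nb; exists n.+1%:R^-1; split.
    by rewrite invr_gt0.
  exists n%:R => t f t0 tn sf; apply: contrapT => h'; apply: h; exists t.
  by split => // /(_ f sf).
have TB n : lin_bounded G (S (t n)) by apply: S_lb; have [] := ht n.
have [|M hM] := uniform_bounded TB.
  move=> f sf; have [d d0 hd] := S_right sf ltr01.
  pose k := (Num.trunc d^-1).+1.
  have kd : k%:R^-1 < d by rewrite invf_plt ?posrE ?ltr0n// /k truncnS_gt.
  exists (nrm f + 1 + \sum_(i < k) nrm (S (t i) f)) => n.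
  have [nk|kn] := ltnP n k.
    rewrite (bigD1 (Ordinal nk))//=.
    have : 0 <= \sum_(i < k | i != Ordinal nk) nrm (S (t i) f).
      by apply: sumr_ge0 => i _; exact: nrm_ge0.
    have := nrm_ge0 G f; lra.
  have : 0 <= \sum_(i < k) nrm (S (t i) f).
    by apply: sumr_ge0 => i _; exact: nrm_ge0.
  have [t0 tn _] := ht n.
  have td : t n < d.
    apply: le_lt_trans tn _; apply: le_lt_trans kd.
    by rewrite lef_pV2 ?posrE ?ltr0n// ler_nat ltnW.
  have := hd _ t0 td; have := nrmD (ell2B (S_L2 t0 sf) sf) sf.
  have -> : (fun x => S (t n) f x - f x + f x) = S (t n) f by apply/funext => x; ring.
  lra.
pose k := (Num.trunc M).+1.
have [_ _] := ht k; apply => f sf; apply: le_trans (hM k f sf) _.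
by rewrite ler_wpM2r ?nrm_ge0// ltW// /k truncnS_gt.
Qed.

Lemma S_bounded (T : R) : 0 <= T -> exists2 M : R, 1 <= M &
  forall t f, 0 <= t -> t <= T -> L2 f -> nrm (S t f) <= M * nrm f.
Proof.
move=> T0; have [d [d0 [M hM]]] := S_locally_bounded.
pose M1 := Num.max M 1.
have M11 : 1 <= M1 by rewrite le_max lexx orbT.
have M10 : 0 <= M1 by exact: le_trans M11.
pose k := (Num.trunc (T / d)).+1.
have Tk : T / k%:R <= d.
  by rewrite ler_pdivrMr// mulrC -ler_pdivrMr// ltW// /k truncnS_gt.
exists (M1 ^+ k); first exact: exprn_ege1.
move=> t f t0 tT sf.
have tk0 : 0 <= t / k%:R by rewrite divr_ge0.
have -> : t = k%:R * (t / k%:R) by rewrite mulrCA mulfV ?mulr1// pnatr_eq0.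
rewrite S_mulrn//.
have tkd : t / k%:R <= d by apply: le_trans Tk; rewrite ler_wpM2r// invr_ge0.
have LS j : L2 (iter j (S (t / k%:R)) f) by elim: j => //= j; exact: S_L2.
elim: k {Tk} (t / k%:R) tk0 tkd LS => [|k ih] r r0 rd LS /=; first by rewrite mul1r.
apply: le_trans (hM _ _ r0 rd (LS k)) _.
rewrite exprS -mulrA; apply: (@le_trans _ _ (M1 * nrm (iter k (S r) f))).
  by rewrite ler_wpM2r ?nrm_ge0// le_max lexx.
by rewrite ler_wpM2l// ih.
Qed.

Lemma S_modulus (T : R) f (e : R) : 0 <= T -> L2 f -> 0 < e ->
  exists2 d : R, 0 < d & forall s r, 0 <= s -> s <= r -> r <= T -> r - s < d ->
    nrm (fun x => S r f x - S s f x) <= e.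
Proof.
move=> T0 sf e0; have [M M1 hM] := S_bounded T0.
have M0 : 0 < M by apply: lt_le_trans M1.
have [d d0 hd] := S_right sf (divr_gt0 e0 M0).
exists d => // s r s0 sr rT rsd.
have rs0 : 0 <= r - s by rewrite subr_ge0.
have -> : r = s + (r - s) by ring.
rewrite S_add//; have sd := ell2B (S_L2 rs0 sf) sf.
rewrite -(lbB (S_lb s0) (S_L2 rs0 sf) sf).
apply: le_trans (hM _ _ s0 (le_trans sr rT) sd) _.
by rewrite -ler_pdivlMl// mulrC; exact: hd.
Qed.

(* One step of S and one step of the resolvent agree to first order on the
   domain of the generator, and the resolvent is a contraction. *)
Lemma chernoff_gen (t : R) v h (e : R) : 0 <= t -> L2 v -> L2 h -> gen v h -> 0 < e ->
  exists2 d : R, 0 < d & forall (r : R) (j : nat), 0 < r -> r < d -> j%:R * r <= t ->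
    nrm (fun x => S (j%:R * r) v x - iter j (res r^-1) v x) <= e.
Proof.
move=> t0 sv sh g e0; have [M M1 hM] := S_bounded t0.
have M0 : 0 < M by apply: lt_le_trans M1.
have t1 : 0 < t + 1 by lra.
(* Each step costs at most [r * (M * (2 * c))] and the steps cover a time of at most [t], for a
   total of [t / (t + 1) * e]. The [+ 1] keeps the divisor positive at [t = 0]. *)
pose c := e / (2 * M * (t + 1)).
have c0 : 0 < c by rewrite divr_gt0// !mulr_gt0.
have [d d0 hd] := g _ c0; have [d' d0' hd'] := S_right sh c0.
exists (Num.min d d'); first by rewrite lt_min d0.
move=> r j r0; rewrite lt_min => /andP[rd rd'] jt.
have rr : 0 <= r by exact: ltW.
have b0 : 0 < r^-1 by rewrite invr_gt0.
have step0 : nrm (fun x => S r v x - v x + r * S r h x) <= r * (2 * c).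
  have q1 := quot_L2 r0 sv sh; have q2 := ell2B (S_L2 rr sh) sh.
  have -> : (fun x => S r v x - v x + r * S r h x) =
    (fun x => r * (((S r v x - v x) / r + h x) + (S r h x - h x))).
    by apply/funext => x; field; rewrite gt_eqF.
  rewrite nrmZ; last exact: ell2D.
  rewrite gtr0_norm// ler_pM2l//; apply: le_trans (nrmD q1 q2) _.
  have := hd r r0 rd; have := hd' r rr rd'; lra.
have main : nrm (fun x => S (j%:R * r) v x - iter j (res r^-1) v x) <=
    j%:R * r * (M * (2 * c)).
  elim: j jt => [_|j ih jt].
    rewrite !mul0r S_0//= (_ : (fun x => _) = fun=> 0) ?nrm0//.
    by apply/funext => x; rewrite subrr.
  have jt' : j%:R * r <= t.
    by apply: le_trans jt; rewrite ler_wpM2r// ler_nat.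
  have j0 : 0 <= j%:R * r by rewrite mulr_ge0.
  pose v' := S (j%:R * r) v; pose h' := S (j%:R * r) h.
  have sv' : L2 v' by exact: S_L2.
  have sh' : L2 h' by exact: S_L2.
  have g' : gen v' h' by exact: gen_S.
  have sSv : L2 (S r v') by exact: S_L2.
  have sSh : L2 (S r h') by exact: S_L2.
  have srv : L2 (res r^-1 v') by exact: res_L2.
  have sit := @iter_res_L2 r^-1 j v b0 sv.
  have -> : S (j.+1%:R * r) v = S r v'.
    by rewrite -S_add//; congr (S _ _); rewrite -natr1; ring.
  apply: le_trans (nrm_triB sSv srv (res_L2 b0 sit)) _.
  have h1 := res_lip b0 sv' sit.
  (* As an approximate implicit Euler step from [v'], [S r v'] has the residual
     [S r v' + r S r h' - v']. This is the image under [S (j r)] of the quantity in [step0], and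
     accretivity bounds the error by it. *)
  have h2 : nrm (fun x => S r v' x - res r^-1 v' x) <= r * (M * (2 * c)).
    have hg := gen_sub sSv sSh srv (res_gen_L2 b0 sv') (gen_S rr sv' sh' g') (res_gen b0 sv').
    have := gen_contraction rr (ell2B sSv srv) (ell2B sSh (res_gen_L2 b0 sv')) hg.
    move=> /le_trans; apply.
    have -> : (fun x => S r v' x - res r^-1 v' x +
        r * (S r h' x - r^-1 * (v' x - res r^-1 v' x))) =
      S (j%:R * r) (fun x => r * S r h x + (S r v x - v x)).
      have [_ lin _] := S_lb j0.
      rewrite lin; [|exact: S_L2|by apply: ell2B => //; exact: S_L2].
      rewrite (lbB (S_lb j0))//; last exact: S_L2.
      rewrite -!S_add// addrC !S_add// -/v' -/h'.
      by apply/funext => x; rewrite mulrBr mulrA mulfV ?gt_eqF//; ring.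
    have sst : L2 (fun x => r * S r h x + (S r v x - v x)).
      by apply: ell2D; [apply: ell2Z; exact: S_L2|apply: ell2B => //; exact: S_L2].
    apply: le_trans (hM _ _ j0 jt' sst) _.
    rewrite mulrCA ler_pM2l//; move: step0; congr (nrm _ <= _).
    by apply/funext => x; rewrite addrC.
  have := ih jt'; rewrite -/v' -natr1; lra.
apply: le_trans main _.
apply: (@le_trans _ _ (t * (M * (2 * c)))).
  by apply: ler_wpM2r => //; apply: mulr_ge0; [exact: ltW|rewrite mulr_ge0// ltW].
have -> : t * (M * (2 * c)) = t / (t + 1) * e.
  by rewrite /c; field; rewrite !gt_eqF.
rewrite -[leRHS]mul1r ler_wpM2r ?ltW// ltr_pdivrMr//; lra.
Qed.

(** Without local finiteness a finitely supported function may lie outside the domain of L. It is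
    replaced by [res b f] with large [b], which lies in the domain and is close to [f]. *)
Lemma chernoff (t : R) n f (e : R) : 0 <= t -> fsupp (Kseq X n) f -> 0 < e ->
  exists2 d : R, 0 < d & forall (r : R) (j : nat), 0 < r -> r < d -> j%:R * r <= t ->
    nrm (fun x => S (j%:R * r) f x - iter j (res r^-1) f x) <= e.
Proof.
move=> t0 ff e0; have sf : L2 f by exact: ell2_fin ff.
have [M M1 hM] := S_bounded t0.
have M0 : 0 < M by apply: lt_le_trans M1.
(* Exchanging [f] for [res b f] costs [M * e1 = e / 4] under the semigroup and at most [e / 4] under
   the contractive iterates; [e / 2] remains for [chernoff_gen]. The value of [b] comes from
   [res_dist]. *)
pose e1 := e / (4 * M); have e10 : 0 < e1 by rewrite divr_gt0// mulr_gt0.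
pose b := form G f f / 4 / e1 ^+ 2 + 1.
have b0 : 0 < b.
  have : 0 <= form G f f / 4 / e1 ^+ 2.
    by rewrite !divr_ge0 ?form_ge0// sqr_ge0.
  by rewrite /b; lra.
have srf := res_L2 b0 sf.
have hw : nrm (fun x => res b f x - f x) <= e1.
  rewrite -(@ler_pXn2r _ 2)// ?nnegrE ?nrm_ge0 ?(ltW e10)// nrm_sqr.
  rewrite -(ler_pM2l b0). apply: le_trans (@res_dist _ _ G _ b0 _ _ ff) _.
  have -> : b * e1 ^+ 2 = form G f f / 4 + e1 ^+ 2 by rewrite /b; field; rewrite gt_eqF.
  by rewrite lerDl sqr_ge0.
have e2 : 0 < e / 2 by rewrite divr_gt0.
have [d d0 hd] := chernoff_gen t0 srf (res_gen_L2 b0 sf) (res_gen b0 sf) e2.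
exists d => // r j r0 rd jt.
have ib0 : 0 < r^-1 by rewrite invr_gt0.
have j0 : 0 <= j%:R * r by rewrite mulr_ge0// ltW.
have h1 := hd r j r0 rd jt.
have h2 := @iter_res_lip r^-1 j _ _ ib0 srf sf.
have h3 := hM _ _ j0 jt (ell2B sf srf).
rewrite (lbB (S_lb j0))// in h3.
rewrite (nrmBC sf srf) in h3.
have i1 := @iter_res_L2 r^-1 j _ ib0 srf; have i2 := @iter_res_L2 r^-1 j _ ib0 sf.
have s1 := S_L2 j0 sf; have s2 := S_L2 j0 srf.
apply: le_trans (nrm_triB s1 s2 i2) _.
have := nrm_triB s2 i1 i2.
have M2 : M * nrm (fun x => res b f x - f x) <= e / 4.
  apply: (@le_trans _ _ (M * e1)); first by rewrite ler_pM2l.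
  by rewrite /e1 le_eqVlt; apply/orP; left; apply/eqP; field; rewrite gt_eqF.
have : e1 <= e / 4.
  rewrite /e1 ler_pdivrMr ?mulr_gt0// mulrA divfK//.
  by rewrite ler_peMr// ltW.
lra.
Qed.

Lemma chernoff_pointwise (t : R) n f (x : X) (e : R) : 0 <= t ->
  fsupp (Kseq X n) f -> 0 < e ->
  exists2 d : R, 0 < d & forall (r : R) (j : nat), 0 < r -> r < d -> j%:R * r <= t ->
    `|S (j%:R * r) f x - iter j (res r^-1) f x| <= e.
Proof.
move=> t0 ff e0; have sf : L2 f by exact: ell2_fin ff.
have m0 : 0 < Num.sqrt (mu x) by rewrite sqrtr_gt0 gmu_gt0.
have [d d0 hd] := chernoff t0 ff (mulr_gt0 e0 m0).
exists d => // r j r0 rd jt.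
have j0 : 0 <= j%:R * r by rewrite mulr_ge0// ltW.
have ib0 : 0 < r^-1 by rewrite invr_gt0.
have sd := ell2B (S_L2 j0 sf) (@iter_res_L2 r^-1 j f ib0 sf).
apply: le_trans (eval_le_nrm x sd) _.
by rewrite ler_pdivrMr//; exact: hd.
Qed.

Lemma S_modulus_pointwise (T : R) f x (e : R) : 0 <= T -> L2 f -> 0 < e ->
  exists2 d : R, 0 < d & forall s r, 0 <= s -> s <= r -> r <= T -> r - s < d ->
    `|S r f x - S s f x| <= e.
Proof.
move=> T0 sf e0.
have m0 : 0 < Num.sqrt (mu x) by rewrite sqrtr_gt0 gmu_gt0.
have [d d0 hd] := S_modulus T0 sf (mulr_gt0 e0 m0).
exists d => // s r s0 sr rT rs; have r0 := le_trans s0 sr.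
apply: le_trans (eval_le_nrm x (ell2B (S_L2 r0 sf) (S_L2 s0 sf))) _.
by rewrite ler_pdivrMr//; exact: hd.
Qed.

(** The channel through which order properties, available for resolvents, reach the semigroup. At
    [t = 0] no iteration is made. *)
Lemma S_iter_close (t : R) n f (x : X) (e : R) : 0 <= t -> fsupp (Kseq X n) f ->
  0 < e -> exists (b : R) (j : nat), 0 < b /\ `|S t f x - iter j (res b) f x| <= e.
Proof.
move=> t0 ff e0; have [d d0 hd] := chernoff_pointwise x t0 ff e0.
have [->|tn0] := eqVneq t 0.
  exists 1, 0%N; rewrite S_0; last exact: ell2_fin ff.
  by rewrite subrr normr0 ltW.
have tp : 0 < t by rewrite lt_neqAle eq_sym tn0.
pose k := (Num.trunc (t / d)).+1.
have kd : t / k%:R < d.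
  by rewrite ltr_pdivrMr ?ltr0n// mulrC -ltr_pdivrMr// /k truncnS_gt.
have tk : 0 < t / k%:R by rewrite divr_gt0// ltr0n.
have E : k%:R * (t / k%:R) = t by rewrite mulrCA mulfV ?mulr1// pnatr_eq0.
exists (t / k%:R)^-1, k; rewrite invr_gt0; split => //.
by have := hd _ k tk kd; rewrite E; apply.
Qed.

Lemma S_ge (t : R) n f (x : X) (a : R) : 0 <= t -> fsupp (Kseq X n) f ->
  (forall (b : R) j, 0 < b -> a <= iter j (res b) f x) -> a <= S t f x.
Proof.
move=> t0 ff h; apply/ler_addgt0Pr => e /(S_iter_close x t0 ff)[b [j [/(h _ j) h1]]].
by rewrite ler_distl => /andP[h3 h4]; lra.
Qed.

Lemma S_le (t : R) n f (x : X) (c : R) : 0 <= t -> fsupp (Kseq X n) f ->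
  (forall (b : R) j, 0 < b -> iter j (res b) f x <= c) -> S t f x <= c.
Proof.
move=> t0 ff h; apply/ler_addgt0Pr => e /(S_iter_close x t0 ff)[b [j [/(h _ j) h1]]].
by rewrite ler_distl => /andP[h3 h4]; lra.
Qed.

Lemma iter_res_ge0 (b : R) j f x : 0 < b -> L2 f -> (forall x, 0 <= f x) ->
  0 <= iter j (res b) f x.
Proof.
move=> b0 sf f0; elim: j x => //= j ih x.
by apply: res_ge0 => //; exact: iter_res_L2.
Qed.

Lemma S_ge0 t n f x : 0 <= t -> fsupp (Kseq X n) f -> (forall x, 0 <= f x) ->
  0 <= S t f x.
Proof.
move=> t0 ff f0; apply: (S_ge t0 ff) => b j b0.
by apply: iter_res_ge0 => //; exact: ell2_fin ff.
Qed.

Lemma S_le1 t n f x : 0 <= t -> fsupp (Kseq X n) f -> (forall x, f x <= 1) ->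
  S t f x <= 1.
Proof.
move=> t0 ff f1; apply: (S_le t0 ff) => b j b0.
have sf : L2 f by exact: ell2_fin ff.
elim: j x => //= j ih x; apply: (@res_le _ _ G b b0 _ (fun=> 1)) => //.
- exact: iter_res_L2.
- by apply: (@ldom_bounded _ _ _ _ 1) => y; rewrite normr1.
- move=> y; rewrite opH_cst; have := gkappa_ge0 G y.
  have : b * mu y * iter j (res b) f y <= b * mu y * 1.
    by rewrite ler_pM2l ?ih// mulr_gt0// gmu_gt0.
  lra.
Qed.

Lemma S_mono t n f g x : 0 <= t -> fsupp (Kseq X n) f -> fsupp (Kseq X n) g ->
  (forall x, f x <= g x) -> S t f x <= S t g x.
Proof.
move=> t0 ff fg h; have := @S_ge0 t n (fun x => g x - f x) x t0 (fsuppB fg ff).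
rewrite (lbB (S_lb t0)); [|exact: ell2_fin fg|exact: ell2_fin ff].
by rewrite subr_ge0; apply => y; rewrite subr_ge0.
Qed.

End Semigroup.

(** * The minimal solution of (Delta + 1) e = 1 + kappa / mu *)

Section Completeness.
Variables (R : realType) (X : countType) (G : graph R X).
Local Notation w := (gw G).
Local Notation kappa := (gkappa G).
Local Notation mu := (gmu G).
Local Notation L2 := (ell2 G).
Local Notation res := (res G).
Local Notation leb := (@lebesgue_measure R).
Implicit Types (f g h v : X -> R).

(* Dirichlet approximations, on the exhaustion [Kseq], of the minimal
   nonnegative solution of (Delta + 1) e = 1 + kappa / mu. *)
Definition esol n : X -> R := gsol G n 1 (fun x => mu x + kappa x).

Lemma esol_fsupp n : fsupp (Kseq X n) (esol n).
Proof. exact: gsol_fsupp. Qed.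

Lemma esol_ge0 n x : 0 <= esol n x.
Proof.
by apply: gsol_ge0 => // y _; rewrite addr_ge0 ?gkappa_ge0// ltW// gmu_gt0.
Qed.

Lemma esol_le1 n x : esol n x <= 1.
Proof.
apply: (@gsol_le _ _ G n 1 ltr01 _ (fun=> 1)) => //.
  by apply: (@ldom_bounded _ _ _ _ 1) => y; rewrite normr1.
by move=> y _; rewrite opH_cst; lra.
Qed.

Lemma esol_mono n m x : (n <= m)%N -> esol n x <= esol m x.
Proof.
by apply: gsol_mono => // y; rewrite addr_ge0 ?gkappa_ge0// ltW// gmu_gt0.
Qed.

Definition esol_lim x : R := limn (fun n => esol n x).

Lemma esol_cvg x : esol n x @[n --> \oo] --> esol_lim x.
Proof.
have : cvgn (fun n => esol n x).
  apply: nondecreasing_is_cvgn; first by move=> n m; exact: esol_mono.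
  by exists 1 => _ [n _ <-]; exact: esol_le1.
by [].
Qed.

Lemma esol_lim_itv x : 0 <= esol_lim x <= 1.
Proof.
have c := @esol_cvg x; have ic : cvgn (fun n => esol n x).
  by apply/cvg_ex; exists (esol_lim x).
apply/andP; split.
  by rewrite -(cvg_lim _ c)//; apply: limr_ge => //; apply: nearW => n; exact: esol_ge0.
by rewrite -(cvg_lim _ c)//; apply: limr_le => //; apply: nearW => n; exact: esol_le1.
Qed.

Lemma esol_lim_eq x : opH G esol_lim x + mu x * esol_lim x = mu x + kappa x.
Proof.
have cA : adj G (esol n) x @[n --> \oo] --> adj G esol_lim x.
  apply: (rsum_dominated (summ_w G x)).
    move=> n y; rewrite normrM !ger0_norm ?gw_ge0 ?esol_ge0//.
    by rewrite ler_piMr ?gw_ge0// esol_le1.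
  by move=> y; apply: cvgM; [exact: cvg_cst|exact: esol_cvg].
have c : opH G (esol n) x + mu x * esol n x @[n --> \oo] -->
    opH G esol_lim x + mu x * esol_lim x.
  apply: cvgD; first apply: cvgB => //.
    by apply: cvgM; [exact: cvg_cst|exact: esol_cvg].
  by apply: cvgM; [exact: cvg_cst|exact: esol_cvg].
rewrite -(cvg_lim _ c)//; apply/cvg_lim => //.
apply: (@cvg_near_cst).
exists (pickle x).+1 => // n /= xn.
have xK : x \in Kseq X n by rewrite mem_Kseq.
have := @gsolE _ _ G n 1 ltr01 (fun x => mu x + kappa x) x xK.
by rewrite mul1r.
Qed.

(** A bounded nonnegative solution of Delta z = - z, by [opH_defect]; completeness has to rule it
    out. *)
Definition defect x : R := 1 - esol_lim x.

Lemma defect_itv x : 0 <= defect x <= 1.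
Proof. by have /andP[h1 h2] := esol_lim_itv x; rewrite /defect; apply/andP; split; lra. Qed.

Lemma ldom_defect : ldom G defect.
Proof.
apply: (@ldom_bounded _ _ _ _ 1) => x; have /andP[h1 h2] := defect_itv x.
by rewrite ger0_norm.
Qed.

Lemma opH_defect x : opH G defect x = - (mu x * defect x).
Proof.
rewrite opHB; last 2 first.
- by apply: (@ldom_bounded _ _ _ _ 1) => y; rewrite normr1.
- apply: (@ldom_bounded _ _ _ _ 1) => y; have /andP[h1 h2] := esol_lim_itv y.
  by rewrite ger0_norm.
by have := esol_lim_eq x; rewrite opH_cst /defect; lra.
Qed.

(** Bernoulli's inequality bounds (1 + r)^n below by 1 + t, and (1 - r)^n (1 + r)^n is at most 1.
    Any decay factor below 1 that does not depend on [n] would do, so exponentials are avoided. *)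
Lemma bernoulli_inv (t : R) n : 0 < t -> (t < n%:R) ->
  (1 - t / n%:R) ^+ n <= (1 + t)^-1.
Proof.
move=> t0 tn; have n0 : 0 < n%:R :> R by exact: lt_trans tn.
set r := t / n%:R; have r0 : 0 < r by rewrite divr_gt0.
have r1 : r < 1 by rewrite ltr_pdivrMr// mul1r.
have E : n%:R * r = t by rewrite /r mulrCA mulfV ?mulr1// gt_eqF.
have B (k : nat) : 1 + k%:R * r <= (1 + r) ^+ k.
  elim: k => [|k ih]; first by rewrite mul0r addr0 expr0.
  rewrite exprS -natr1.
  have : (1 + r) * (1 + k%:R * r) <= (1 + r) * (1 + r) ^+ k.
    by rewrite ler_pM2l//; lra.
  have : 0 <= k%:R * r * r by rewrite !mulr_ge0// ltW.
  lra.
have h := B n; rewrite E in h.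
have t1 : 0 < 1 + t by lra.
rewrite -(ler_pM2r t1) mulVf ?gt_eqF//.
apply: (@le_trans _ _ ((1 - r) ^+ n * (1 + r) ^+ n)).
  by rewrite ler_wpM2l// exprn_ge0//; lra.
rewrite -exprMn exprn_ile1//.
  by rewrite mulr_ge0//; lra.
have : 0 <= r * r by rewrite mulr_ge0// ltW.
lra.
Qed.

(** * The implicit Euler scheme with source and its barrier *)

Section Discrete.
Variables (n : nat) (r m : R) (phi k : X -> R).
Hypotheses (r0 : 0 < r) (r1 : r < 1).
Hypotheses (sphi : L2 phi) (sk : L2 k).
Hypothesis hk : forall x, mu x * k x <= kappa x.
Hypothesis hphi : forall x, phi x <= 1 - (1 - r) ^+ n * defect x.

Let b0 : 0 < r^-1. Proof. by rewrite invr_gt0. Qed.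

(** Since [res r^-1] is the inverse of 1 + r L, each step solves (u_j - u_(j-1)) / r + L u_j = k. *)
Fixpoint implicit_euler j : X -> R :=
  if j is i.+1 then res r^-1 (fun x => r * k x + implicit_euler i x) else phi.

Lemma implicit_euler_L2 j : L2 (implicit_euler j).
Proof.
by elim: j => //= j ih; apply: res_L2 => //; apply: ell2D => //; exact: ell2Z.
Qed.

(** The discrete Duhamel formula: the second term will be compared with the time integral of [S s k]
    as a Riemann sum. *)
Lemma implicit_eulerE j x : implicit_euler j x =
  iter j (res r^-1) phi x + r * \sum_(i < j) iter i.+1 (res r^-1) k x.
Proof.
elim: j x => [|j ih] x; first by rewrite big_ord0 mulr0 addr0.
rewrite [LHS]/= res_lin//; last exact: implicit_euler_L2.
rewrite big_ord_recl /= mulrDr addrCA; congr (_ + _).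
have Lit i g : L2 g -> L2 (iter i (res r^-1) g).
  by move=> sg; elim: i => //= i; exact: res_L2.
have Lsum i : L2 (fun x => \sum_(l < i) iter l.+1 (res r^-1) k x).
  elim: i => [|i ihi]; first by under eq_fun do rewrite big_ord0; exact: ell2_0.
  under eq_fun do rewrite big_ord_recr /=.
  by apply: ell2D => //; exact: (Lit i.+1).
have rsum_i i : forall y, res r^-1 (fun x => \sum_(l < i) iter l.+1 (res r^-1) k x) y =
    \sum_(l < i) iter l.+2 (res r^-1) k y.
  elim: i => [|i ihi] y.
    have -> : (fun x : X => \sum_(l < 0) iter l.+1 (res r^-1) k x) = fun x => 0 * k x + 0 * k x.
      by apply/funext => z; rewrite big_ord0; ring.
    rewrite res_lin//; last exact: ell2Z.
    have -> : (fun x => 0 * k x) = fun x => 0 * k x + 0 * k x by apply/funext => z; ring.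
    rewrite res_lin//; last exact: ell2Z.
    rewrite big_ord0.
    have h0 : forall z, res r^-1 (fun x => 0 * k x) z = 0.
      move=> z; apply/eqP; rewrite eq_le; apply/andP; split.
        apply: (@res_le _ _ G _ b0 _ (fun=> 0)) => //.
        + exact: ell2Z.
        + by apply: (@ldom_bounded _ _ _ _ 0) => u; rewrite normr0.
        + by move=> u; rewrite opH_cst mul0r !mulr0 addr0.
      by apply: res_ge0 => //; [exact: ell2Z|move=> u; rewrite mul0r].
    by rewrite h0; ring.
  rewrite big_ord_recr/= -ihi.
  have -> : (fun x : X => \sum_(l < i.+1) iter l.+1 (res r^-1) k x) =
    fun x => 1 * iter i.+1 (res r^-1) k x + \sum_(l < i) iter l.+1 (res r^-1) k x.
    by apply/funext => z; rewrite big_ord_recr/= mul1r addrC.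
  rewrite res_lin//; last exact: (Lit i.+1).
  by rewrite mul1r addrC.
have -> : implicit_euler j = fun x => r * (\sum_(i < j) iter i.+1 (res r^-1) k x) +
     iter j (res r^-1) phi x.
  by apply/funext => y; rewrite ih addrC.
by rewrite res_lin//; [rewrite rsum_i addrC|exact: Lit].
Qed.

(* 1 - (1 - r)^(n - j) defect solves the implicit Euler scheme exactly. *)
Lemma implicit_euler_le j x : (j <= n)%N ->
  implicit_euler j x <= 1 - (1 - r) ^+ (n - j) * defect x.
Proof.
elim: j x => [|j ih] x jn; first by rewrite subn0; exact: hphi.
have q0 i : 0 <= (1 - r) ^+ i by rewrite exprn_ge0// subr_ge0 ltW.
have q1 i : (1 - r) ^+ i <= 1.
  by rewrite exprn_ile1// ?subr_ge0 ?(ltW r1)// gerBl ltW.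
set p := (1 - r) ^+ (n - j.+1).
have ld1 : ldom G (fun=> 1) by apply: (@ldom_bounded _ _ _ _ 1) => y; rewrite normr1.
apply: (@res_le _ _ G _ b0 _ (fun y => 1 - p * defect y)) => //.
- by apply: ell2D; [exact: ell2Z|exact: implicit_euler_L2].
- by apply: ldomB => //; apply: ldomZ; exact: ldom_defect.
- move=> y; have /andP[h1 h2] := defect_itv y.
  by rewrite subr_ge0 mulr_ile1// /p.
- move=> y; rewrite opHB//; last by apply: ldomZ; exact: ldom_defect.
  rewrite opHZ; last exact: ldom_defect.
  rewrite opH_cst opH_defect.
  have := ih y (ltnW jn).
  have -> : (n - j = (n - j.+1).+1)%N by rewrite subnSK.
  rewrite exprS -/p => h.
  have m0 := gmu_gt0 G y.
  have : r^-1 * mu y * (r * k y + implicit_euler j y) <=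
      mu y * k y + r^-1 * mu y * (1 - (1 - r) * p * defect y).
    have -> : mu y * k y = r^-1 * mu y * (r * k y) by field; rewrite gt_eqF.
    by rewrite -mulrDr ler_pM2l ?mulr_gt0// lerD2l.
  have -> : mu y * k y + r^-1 * mu y * (1 - (1 - r) * p * defect y) =
     mu y * k y + (mu y * p * defect y + r^-1 * mu y * (1 - p * defect y)).
    by field; rewrite gt_eqF.
  move=> /le_trans; apply.
  have -> : kappa y * 1 - p * - (mu y * defect y) + r^-1 * mu y * (1 - p * defect y) =
    kappa y + (mu y * p * defect y + r^-1 * mu y * (1 - p * defect y)) by ring.
  by rewrite lerD2r; exact: hk.
Qed.

End Discrete.

End Completeness.

(** * Stochastic completeness at infinity forces e = 1 *)

Section StepIntegral.
Variable R : realType.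
Local Notation leb := (@lebesgue_measure R).

Lemma integral_step_le (f : R -> R) (r : R) (n : nat) (c : nat -> R) : 0 < r ->
  measurable_fun `[0, n%:R * r] f -> (forall s, s \in `[0, n%:R * r] -> 0 <= f s) ->
  (forall i s, (i < n)%N -> i%:R * r <= s -> s <= i.+1%:R * r -> f s <= c i) ->
  (\int[leb]_(s in `[0%R, (n%:R * r)%R]) (f s)%:E <= (r * \sum_(i < n) c i)%:E)%E.
Proof.
move=> r0; elim: n => [|n ih] mf f0 hc.
  by rewrite mul0r set_itv1 integral_set1 big_ord0 mulr0.
have nr0 : 0 <= n%:R * r by rewrite mulr_ge0// ltW.
have nn : n%:R * r <= n.+1%:R * r by rewrite ler_pM2r// ler_nat.
have mE : measurable_fun `[0, n.+1%:R * r] (EFin \o f).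
  exact/measurable_EFinP.
have sU : `[0, n.+1%:R * r]%classic = `[0, n%:R * r]%classic `|` `]n%:R * r, n.+1%:R * r]%classic.
  by rewrite -itv_bndbnd_setU// bnd_simp.
rewrite sU ge0_integral_setU//; last 3 first.
- by rewrite -sU.
- by move=> s; rewrite -sU => /f0; rewrite lee_fin.
- apply/disj_setPRL => s /=; rewrite !in_itv/= => /andP[h1 h2] /andP[h3 h4].
  by move: h1; rewrite ltNge h4.
rewrite big_ord_recr/= mulrDr EFinD; apply: leeD.
  apply: ih => //.
  - apply: measurable_funS mf => //; apply: subset_itvl; rewrite bnd_simp//.
  - by move=> s; rewrite in_itv/= => /andP[s0 sn]; apply: f0; rewrite in_itv/= s0 (le_trans sn).
  - by move=> i s iN; apply: hc; rewrite ltnW.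
apply: (@le_trans _ _ (\int[leb]_(s in `](n%:R * r)%R, (n.+1%:R * r)%R]) (cst (c n)%:E) s)%E).
  have c0 : 0 <= c n.
    apply: le_trans (hc n (n%:R * r) (ltnSn n) (lexx _) nn).
    by apply: f0; rewrite in_itv/= nr0.
  apply: ge0_le_integral => //=.
  - move=> s; rewrite in_itv/= => /andP[s0 sn]; rewrite lee_fin; apply: f0.
    by rewrite in_itv/= sn andbT (le_trans nr0)// ltW.
  - apply: measurable_funS mE => //.
    by move=> s /=; rewrite !in_itv/= => /andP[s0 ->]; rewrite (le_trans nr0)// ltW.
  - by move=> s; rewrite in_itv/= => /andP[s0 sn]; rewrite lee_fin hc// ltW.
rewrite integral_cst//= lebesgue_measure_itv/= lte_fin ltr_pM2r// ltr_nat ltnSn.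
by rewrite -EFinD -EFinM lee_fin -natr1; have := r0; nra.
Qed.

End StepIntegral.

Section Vanishing.
Variables (R : realType) (X : countType) (G : graph R X).
Local Notation kappa := (gkappa G).
Local Notation mu := (gmu G).
Local Notation L2 := (ell2 G).
Local Notation res := (res G).
Local Notation leb := (@lebesgue_measure R).
Variable S : R -> (X -> R) -> X -> R.
Hypothesis hS : heat_semigroup G S.

Lemma S_continuous (t : R) n k x : 0 <= t -> fsupp (Kseq X n) k ->
  {within `[0, t], continuous (fun s => S s k x)}.
Proof.
move=> t0 fk; have sk : L2 k by exact: ell2_fin fk.
apply/subspace_continuousP => s; rewrite /= in_itv/= => /andP[s0 st].
apply/cvgrPdist_le => e e0.
have [d d0 hd] := S_modulus_pointwise hS x t0 sk e0.
exists d => //= r; rewrite /ball_/= => sr; rewrite in_itv/= => /andP[r0 rt].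
have [le|/ltW le] := leP s r.
  rewrite distrC; apply: hd => //; apply: le_lt_trans sr.
  by rewrite distrC ler_norm.
by apply: hd => //; apply: le_lt_trans sr; exact: ler_norm.
Qed.

Lemma S_measurable (t : R) n k x : 0 <= t -> fsupp (Kseq X n) k ->
  measurable_fun `[0, t] (fun s => S s k x).
Proof.
by move=> t0 fk; apply: subspace_continuous_measurable_fun => //; exact: S_continuous fk.
Qed.

Lemma trunc_fsupp (f : X -> R) n : fsupp (Kseq X n) (trunc_enum f n).
Proof. by move=> x; rewrite mem_Kseq /trunc_enum => /negPf ->. Qed.

Lemma kappa_div_ge0 x : 0 <= kappa x / mu x.
Proof. by rewrite divr_ge0 ?gkappa_ge0// ltW// gmu_gt0. Qed.

Lemma trunc_ge0 (f : X -> R) n x : (forall x, 0 <= f x) -> 0 <= trunc_enum f n x.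
Proof. by move=> f0; rewrite /trunc_enum; case: ifP. Qed.

(** The scheme stays below its barrier, which at the final time is [1 - defect]. Chernoff's formula
    replaces its first term by the semigroup and its Riemann sum by the integral, up to an arbitrary
    [e]. *)
Lemma defect_step (t m : R) N x : 0 < t -> 0 <= m -> m <= 1 ->
  (forall x, defect G x <= m) ->
  ((S t (trunc_enum (fun=> 1%R) N) x)%:E +
   \int[leb]_(s in `[0%R, t]) (S s (trunc_enum (fun y => (kappa y / mu y)%R) N) x)%:E
   <= (1 - defect G x + (1 + t)^-1 * m)%:E)%E.
Proof.
move=> t0 m0 m1 hm; set q := (1 + t)^-1.
set f := trunc_enum (fun=> 1) N; set k := trunc_enum _ N.
have ff : fsupp (Kseq X N) f by exact: trunc_fsupp.
have fk : fsupp (Kseq X N) k by exact: trunc_fsupp.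
have k0 y : 0 <= k y by apply: trunc_ge0; exact: kappa_div_ge0.
have f01 y : 0 <= f y <= 1 by rewrite /f /trunc_enum; case: ifP; rewrite ?ler01 lexx.
have q0 : 0 < q by rewrite invr_gt0; lra.
have q1 : q <= 1 by rewrite invf_le1 ?lerDl//; lra.
have qm1 : q * m <= 1 by rewrite mulr_ile1// ltW.
(* The factor pushes the initial datum below the barrier, as (1 - r)^n times the defect is at most
   [q * m]. It costs [q * m] at the end, since [S t f] is at most 1. *)
pose phi y := (1 - q * m) * f y.
have fphi : fsupp (Kseq X N) phi by exact: fsuppZ.
have sf : L2 f by exact: ell2_fin ff.
have sk : L2 k by exact: ell2_fin fk.
have sphi : L2 phi by exact: ell2_fin fphi.
have tge := ltW t0.
apply/lee_addgt0Pr => e e0.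
(* One [e'] for the initial datum and, per unit of time, two for the source: one from Chernoff's
   formula, one from moving [s] to the right end of its step. *)
pose e' := e / (1 + 2 * t).
have e'0 : 0 < e' by rewrite divr_gt0//; lra.
have [d1 d10 h1] := chernoff_pointwise hS x tge fphi e'0.
have [d2 d20 h2] := chernoff_pointwise hS x tge fk e'0.
have [d3 d30 h3] := S_modulus_pointwise hS x tge sk e'0.
pose D := Num.min (Num.min d1 d2) (Num.min d3 1).
have D0 : 0 < D by rewrite !lt_min d10 d20 d30 ltr01.
pose n := (Num.trunc (t / D)).+1.
have n0 : 0 < n%:R :> R by rewrite ltr0n.
pose r := t / n%:R.
have r0 : 0 < r by rewrite divr_gt0.
have rD : r < D by rewrite ltr_pdivrMr// mulrC -ltr_pdivrMr// /n truncnS_gt.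
have E : n%:R * r = t by rewrite /r mulrCA mulfV ?mulr1// gt_eqF.
move: (rD); rewrite !lt_min => /andP[/andP[rd1 rd2] /andP[rd3 r1]].
have tn : t < n%:R by rewrite -[ltRHS]mul1r -ltr_pdivrMr.
have bern : (1 - r) ^+ n <= q by exact: bernoulli_inv.
have hphi y : phi y <= 1 - (1 - r) ^+ n * defect G y.
  have /andP[f0 f1] := f01 y; have /andP[z0 z1] := defect_itv G y.
  have : (1 - r) ^+ n * defect G y <= q * m.
    by apply: ler_pM => //; rewrite exprn_ge0// subr_ge0 ltW.
  have : phi y <= 1 - q * m by rewrite /phi ler_piMr// subr_ge0.
  lra.
have hk y : mu y * k y <= kappa y.
  rewrite /k /trunc_enum; case: ifP => _; last by rewrite mulr0 gkappa_ge0.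
  by rewrite mulrCA mulfV ?mulr1// gt_eqF// gmu_gt0.
have := @implicit_euler_le R X G n r phi k r0 r1 sphi sk hk hphi n x (leqnn n).
rewrite subnn expr0 mul1r (implicit_eulerE r0)// => main.
pose c i := iter i.+1 (res r^-1) k x + 2 * e'.
have I : (\int[leb]_(s in `[0%R, t]) (S s k x)%:E <= (r * \sum_(i < n) c i)%:E)%E.
  rewrite -E; apply: integral_step_le => //.
  - by rewrite E; exact: S_measurable fk.
  - move=> s; rewrite E in_itv/= => /andP[s0 _]; exact: (S_ge0 hS x s0 fk).
  - move=> i s iN s1 s2.
    have ir : i.+1%:R * r <= t by rewrite -E ler_pM2r// ler_nat.
    have s0 : 0 <= s by apply: le_trans s1; rewrite mulr_ge0// ltW.
    have sd : i.+1%:R * r - s < d3.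
      apply: le_lt_trans rd3; rewrite -natr1; lra.
    have := h3 s _ s0 s2 ir sd; have := h2 r i.+1 r0 rd2 ir.
    rewrite !ler_distl => /andP[a1 a2] /andP[a3 a4]; rewrite /c; lra.
apply: (@le_trans _ _ ((S t f x)%:E + (r * \sum_(i < n) c i)%:E)%E).
  by rewrite leeD2l.
rewrite -!EFinD lee_fin.
have := h1 r n r0 rd1; rewrite E => /(_ (lexx _)).
rewrite ler_distl => /andP[a1 a2].
have Sphi : S t phi x = (1 - q * m) * S t f x by rewrite (lbZ (S_lb hS tge)).
have Sf1 : S t f x <= 1.
  by apply: (S_le1 hS x tge ff) => y; have /andP[] := f01 y.
have Sf0 : 0 <= S t f x.
  by apply: (S_ge0 hS x tge ff) => y; have /andP[] := f01 y.
have cs : r * \sum_(i < n) c i = r * \sum_(i < n) iter i.+1 (res r^-1) k x + t * (2 * e').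
  rewrite /c big_split/= mulrDr sumr_const card_ord; congr (_ + _).
  by rewrite -E -[X in r * X = _]mulr_natl; ring.
have e'E : e' + t * (2 * e') = e by rewrite /e'; field; rewrite gt_eqF//; lra.
have qmS : q * m * S t f x <= q * m by rewrite ler_piMr// mulr_ge0// ltW.
lra.
Qed.

Lemma trunc_mono (f : X -> R) (n m : nat) x : (forall x, 0 <= f x) -> (n <= m)%N ->
  trunc_enum f n x <= trunc_enum f m x.
Proof.
move=> f0 nm; rewrite /trunc_enum; case: ifP => [h|_].
  by rewrite (leq_trans h).
by case: ifP.
Qed.

Lemma trunc_fsupp_le (f : X -> R) n m : (n <= m)%N -> fsupp (Kseq X m) (trunc_enum f n).
Proof. by move=> nm; apply: fsupp_Kseq_le nm _; exact: trunc_fsupp. Qed.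

Lemma S_trunc_mono (f : X -> R) (t : R) x : (forall x, 0 <= f x) -> 0 <= t ->
  {homo (fun n => (S t (trunc_enum f n) x)%:E) : n m / (n <= m)%N >-> (n <= m)%E}.
Proof.
move=> f0 t0 n m nm; rewrite lee_fin.
have f1 := @trunc_fsupp_le f n m nm; have f2 := @trunc_fsupp f m.
apply: (S_mono hS x t0 f1 f2).
by move=> y; exact: trunc_mono.
Qed.

(** Monotone convergence in the truncation makes the left side of [defect_step] tend to 1 by
    completeness, while the right side does not depend on the truncation. *)
Lemma defect_contract (t m : R) : 0 < t -> 0 <= m -> m <= 1 ->
  (forall x : X, (semigroup_ext S t (fun=> 1%R) x
     + \int[leb]_(s in `[0%R, t])
         semigroup_ext S s (fun y => (kappa y / mu y)%R) x = 1)%E) ->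
  (forall x, defect G x <= m) -> forall x, defect G x <= (1 + t)^-1 * m.
Proof.
move=> t0 m0 m1 hN hm x; have tge := ltW t0.
pose a n := (S t (trunc_enum (fun=> 1%R) n) x)%:E.
pose g n s := (S s (trunc_enum (fun y => (kappa y / mu y)%R) n) x)%:E.
pose b n := (\int[leb]_(s in `[0%R, t]) g n s)%E.
have ca : a @ \oo --> limn a.
  by apply: ereal_nondecreasing_is_cvgn; apply: S_trunc_mono.
have g0 n s : s \in `[0, t] -> (0 <= g n s)%E.
  rewrite in_itv/= => /andP[s0 _]; rewrite lee_fin.
  apply: (S_ge0 hS x s0 (@trunc_fsupp _ n)) => y; apply: trunc_ge0; exact: kappa_div_ge0.
have mg n : measurable_fun `[0, t] (g n).
  by apply/measurable_EFinP; apply: S_measurable tge (@trunc_fsupp _ n).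
have ng s : s \in `[0, t] -> nondecreasing_seq (g^~ s).
  rewrite in_itv/= => /andP[s0 _]; apply: S_trunc_mono => //; exact: kappa_div_ge0.
have cb : b @ \oo --> limn b.
  apply: ereal_nondecreasing_is_cvgn => n n' nn; apply: ge0_le_integral => //.
  - by move=> s; exact: g0.
  - exact: mg.
  - exact: mg.
  - by move=> s st; exact: ng.
have bE : limn b = (\int[leb]_(s in `[0%R, t])
         semigroup_ext S s (fun y => (kappa y / mu y)%R) x)%E.
  rewrite -[LHS]/(limn (fun n => \int[leb]_(s in `[0%R, t]) g n s)%E).
  by rewrite -monotone_convergence.
have a0 n : (0 <= a n)%E.
  rewrite lee_fin; apply: (S_ge0 hS x tge (@trunc_fsupp _ n)) => y.
  by apply: trunc_ge0.
have b0 n : (0 <= b n)%E by apply: integral_ge0 => s; exact: g0.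
have la0 : (0 <= limn a)%E.
  by apply: lime_ge; [apply/cvg_ex; exists (limn a)|exact: nearW].
have lb0 : (0 <= limn b)%E.
  by apply: lime_ge; [apply/cvg_ex; exists (limn b)|exact: nearW].
have cab : (fun n => a n + b n)%E @ \oo --> (limn a + limn b)%E.
  by apply: cvgeD => //; exact: ge0_adde_def.
have := hN x; rewrite -bE -[X in (X + _)%E]/(limn a) => E1.
have : (1 <= (1 - defect G x + (1 + t)^-1 * m)%:E)%E.
  rewrite -E1 -(cvg_lim _ cab)//; apply: lime_le.
    by apply/cvg_ex; eexists; exact: cab.
  by apply: nearW => n; exact: defect_step.
rewrite lee_fin; lra.
Qed.

End Vanishing.

Lemma stochastically_complete_defect (R : realType) (X : countType) (G : graph R X) :
  stochastically_complete_at_infinity G -> forall x, defect G x = 0.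
Proof.
move=> [S [hS [t [t0 hN]]]] x.
have q0 : 0 < (1 + t)^-1 by rewrite invr_gt0; lra.
have q1 : (1 + t)^-1 < 1 by rewrite invf_lt1; lra.
have h k y : defect G y <= (1 + t)^-1 ^+ k.
  elim: k y => [|k ih] y; first by have /andP[] := defect_itv G y.
  rewrite exprS; apply: (defect_contract hS t0 _ _ hN ih).
    by rewrite exprn_ge0// ltW.
  by rewrite exprn_ile1// ltW.
apply/eqP; rewrite eq_le; have /andP[-> _] := defect_itv G x; rewrite andbT.
have c : (1 + t)^-1 ^+ k @[k --> \oo] --> (0 : R).
  by apply: cvg_expr; rewrite ger0_norm// ltW.
rewrite -(cvg_lim _ c)//; apply: limr_ge; last exact: nearW.
by apply/cvg_ex; exists 0.
Qed.

(** * The stationary balance *)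

Section Stationary.
Variables (R : realType) (X : countType) (G : graph R X).
Local Notation kappa := (gkappa G).
Local Notation mu := (gmu G).
Implicit Types (f g h v : X -> R).

Let rhs_ge0 x : 0 <= mu x + kappa x.
Proof. by rewrite addr_ge0 ?gkappa_ge0// ltW// gmu_gt0. Qed.

Lemma gsol_green n g : \sum_(x <- Kseq X n) gsol G n 1 g x * (mu x + kappa x) =
  \sum_(x <- Kseq X n) esol G n x * g x.
Proof.
have uK := Kseq_uniq X n.
have sp := @gsol_fsupp R X G n 1 ltr01 g; have se := @esol_fsupp R X G n.
have e1 := form_fsupp G uK sp se; have e2 := form_fsupp G uK se sp.
have -> : \sum_(x <- Kseq X n) gsol G n 1 g x * (mu x + kappa x) =
    \sum_(x <- Kseq X n) (gsol G n 1 g x * opH G (esol G n) x +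
      mu x * gsol G n 1 g x * esol G n x).
  rewrite big_seq [RHS]big_seq; apply: eq_bigr => x xK.
  rewrite -[mu x + kappa x](@gsolE _ _ G n 1 ltr01 (fun x => mu x + kappa x) x xK).
  by rewrite -/(esol G n); ring.
have -> : \sum_(x <- Kseq X n) esol G n x * g x =
    \sum_(x <- Kseq X n) (esol G n x * opH G (gsol G n 1 g) x +
      mu x * gsol G n 1 g x * esol G n x).
  rewrite big_seq [RHS]big_seq; apply: eq_bigr => x xK.
  rewrite -{1}(@gsolE _ _ G n 1 ltr01 g x xK); ring.
rewrite !big_split/=; congr (_ + _).
by rewrite -/(esol G n) in e1 e2; rewrite -e1 -e2 formC.
Qed.

Hypothesis defect0 : forall x, defect G x = 0.

Lemma esol_cvg1 x : esol G n x @[n --> \oo] --> (1 : R).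
Proof.
have := @esol_cvg R X G x.
by have := defect0 x; rewrite /defect => /eqP; rewrite subr_eq0 => /eqP <-.
Qed.

(** The sign of [g] makes the finite solutions increase with [n], and by [gsol_green] their weighted
    sums are those of [esol n] times [g], at most [rsum g]. The limit is then summable and
    dominates, so both sides converge; e = 1 identifies the right one. *)
Lemma gsol_limit g : (forall x, 0 <= g x) -> summ g ->
  exists p : X -> R, [/\ forall x, gsol G n 1 g x @[n --> \oo] --> p x,
    summ (fun x => p x * (mu x + kappa x)) &
    rsum (fun x => p x * (mu x + kappa x)) = rsum g].
Proof.
move=> g0 sg; pose p n := gsol G n 1 g.
have p0 n x : 0 <= p n x by exact: gsol_ge0.
have pm n m x : (n <= m)%N -> p n x <= p m x by move=> nm; exact: gsol_mono.
have pK n x : x \notin Kseq X n -> p n x * (mu x + kappa x) = 0.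
  by move=> /(@gsol_fsupp R X G n 1 ltr01 g); rewrite -/(p n) => ->; rewrite mul0r.
have sp n : summ (fun x => p n x * (mu x + kappa x)).
  by apply: (@summ_fin _ _ _ (Kseq X n)); exact: pK.
have se n : summ (fun x => esol G n x * g x).
  apply: (@summ_fin _ _ _ (Kseq X n)) => x /(@esol_fsupp R X G n) ->.
  by rewrite mul0r.
have pE n : rsum (fun x => p n x * (mu x + kappa x)) = rsum (fun x => esol G n x * g x).
  rewrite (@rsum_fin _ _ _ _ (Kseq_uniq X n))//; last exact: pK.
  rewrite gsol_green (@rsum_fin _ _ _ _ (Kseq_uniq X n))// => x /(@esol_fsupp R X G n) ->.
  by rewrite mul0r.
have ple n : rsum (fun x => p n x * (mu x + kappa x)) <= rsum g.
  rewrite pE; apply: ler_rsum => // x.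
  by rewrite ler_piMl// esol_le1.
have pb n x : p n x <= rsum g / mu x.
  rewrite ler_pdivlMr ?gmu_gt0//; apply: le_trans (ple n).
  have := @rsum_seq_le R X (fun x => p n x * (mu x + kappa x)) [:: x].
  rewrite big_seq1 => h.
  apply: le_trans (h _ (sp n) erefl); last by move=> y; rewrite mulr_ge0.
  by rewrite ler_wpM2l// lerDl gkappa_ge0.
have pc x : cvgn (p^~ x).
  apply: nondecreasing_is_cvgn; first by move=> n m; exact: pm.
  by exists (rsum g / mu x) => _ [n _ <-].
pose q x := limn (p^~ x).
have pq x : p n x @[n --> \oo] --> q x by exact: pc.
have pleq n x : p n x <= q x.
  apply: (@nondecreasing_cvgn_le R (p^~ x)) => //; by move=> a b; exact: pm.
have cq x : p n x * (mu x + kappa x) @[n --> \oo] --> q x * (mu x + kappa x).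
  by apply: cvgM => //; exact: cvg_cst.
have [||||sq _] := @rsum_fatou R X (fun n x => p n x * (mu x + kappa x))
  (fun x => q x * (mu x + kappa x)) (rsum g) => //.
- by move=> n x; rewrite mulr_ge0.
- by apply: nearW.
exists q; split => //.
have c1 : rsum (fun x => p n x * (mu x + kappa x)) @[n --> \oo] -->
    rsum (fun x => q x * (mu x + kappa x)).
  apply: (rsum_dominated sq) => // n x.
  by rewrite ger0_norm ?mulr_ge0// ler_wpM2r.
have c2 : rsum (fun x => p n x * (mu x + kappa x)) @[n --> \oo] --> rsum g.
  under eq_fun do rewrite pE.
  apply: (rsum_dominated sg) => [n x|x].
    by rewrite ger0_norm ?mulr_ge0 ?esol_ge0// ler_piMl// esol_le1.
  by rewrite -[X in _ --> X]mul1r; apply: cvgM; [exact: esol_cvg1|exact: cvg_cst].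
by rewrite -(cvg_lim _ c1)// (cvg_lim _ c2).
Qed.

Lemma stationary_balance v (M : R) : (forall x, 0 <= v x <= M) ->
  summ (fun x => mu x * v x) -> summ (opH G v) ->
  summ (fun x => kappa x * v x) /\ rsum (opH G v) = rsum (fun x => kappa x * v x).
Proof.
move=> vM sv sH.
pose g x := opH G v x + mu x * v x.
have sg : summ g by exact: summD.
(* [gsol_limit] relies on monotonicity in [n], so it is applied to both parts of [g]; linearity
   reassembles them. *)
pose gp x := Num.max (g x) 0; pose gm x := Num.max (- g x) 0.
have gp0 x : 0 <= gp x by rewrite le_max lexx orbT.
have gm0 x : 0 <= gm x by rewrite le_max lexx orbT.
have gE : g = fun x => gp x - gm x.
  by apply/funext => x; rewrite /gp /gm; case: ltrP => h; case: ltrP => h'; lra.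
have sgp : summ gp.
  by apply: summ_dom sg => x; rewrite ger0_norm// ge_max normr_ge0 ler_norm.
have sgm : summ gm.
  by apply: summ_dom sg => x; rewrite ger0_norm// ge_max normr_ge0 -normrN ler_norm.
have [p [cp sp Ep]] := gsol_limit gp0 sgp.
have [q [cq sq Eq]] := gsol_limit gm0 sgm.
have dv : ldom G v.
  apply: (@ldom_bounded _ _ _ _ M) => x; have /andP[h1 h2] := vM x.
  by rewrite ger0_norm.
have gl n x : gsol G n 1 gp x - gsol G n 1 gm x = gsol G n 1 g x.
  by rewrite gE gsolB.
have up n x : gsol G n 1 g x <= v x.
  apply: gsol_le => // y _; first by have /andP[] := vM y.
  by rewrite mul1r.
(* M (e_n - 1) solves the homogeneous equation on the n-th set, so this has the same right side [g]
   as [v] there; outside it equals v - M, which is nonpositive. *)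
have lo n x : v x + M * esol G n x - M <= gsol G n 1 g x.
  have de := @gsol_ldom R X G n 1 ltr01 (fun x => mu x + kappa x).
  have dM : ldom G (fun=> M) by apply: (@ldom_bounded _ _ _ _ `|M|).
  apply: (@gsol_ge _ _ G n 1 ltr01 g (fun x => v x + M * esol G n x - M)).
  - by apply: ldomB => //; apply: ldomD => //; exact: ldomZ.
  - move=> y /(@esol_fsupp R X G n) ->; rewrite mulr0 addr0 subr_le0.
    by have /andP[] := vM y.
  - move=> y yK; rewrite opHB//; last by apply: ldomD => //; exact: ldomZ.
    rewrite opHD//; last exact: ldomZ.
    rewrite opHZ// opH_cst.
    have := @gsolE _ _ G n 1 ltr01 (fun x => mu x + kappa x) y yK.
    rewrite -/(esol G n) mul1r => e.
    suff -> : opH G v y + M * opH G (esol G n) y - kappa y * M +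
      mu y * (v y + M * esol G n y - M) = g y by [].
    transitivity (opH G v y + mu y * v y + M * (opH G (esol G n) y + mu y * esol G n y)
       - M * (mu y + kappa y)); first by ring.
    by rewrite e /g; ring.
have vE x : v x = p x - q x.
  have c1 : gsol G n 1 g x @[n --> \oo] --> p x - q x.
    under eq_fun do rewrite -gl.
    by apply: cvgB; [exact: cp|exact: cq].
  have c2 : gsol G n 1 g x @[n --> \oo] --> v x.
    apply: (@squeeze_cvgr _ _ _ _ (fun n => v x + M * esol G n x - M) (fun=> v x)).
    - by apply: nearW => n; rewrite lo up.
    - rewrite -[X in _ --> X](addrK (M * 1)) mulr1.
      apply: cvgB; last exact: cvg_cst.
      apply: cvgD; first exact: cvg_cst.
      rewrite -[X in _ --> X]mulr1; apply: cvgM; first exact: cvg_cst.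
      exact: esol_cvg1.
    - exact: cvg_cst.
  by rewrite -(cvg_lim _ c2)// (cvg_lim _ c1).
have svk : summ (fun x => v x * (mu x + kappa x)).
  have := summB sp sq; congr summ; apply/funext => x; rewrite vE; ring.
have sk : summ (fun x => kappa x * v x).
  have := summB svk sv; congr summ; apply/funext => x; ring.
split => //.
have : rsum (fun x => v x * (mu x + kappa x)) = rsum g.
  rewrite gE rsumB// -Ep -Eq -rsumB//.
  by apply: eq_rsum => x; rewrite vE; ring.
rewrite [X in X = _](_ : _ = rsum (fun x => mu x * v x) + rsum (fun x => kappa x * v x)).
  rewrite /g rsumD//; lra.
by rewrite -rsumD//; apply: eq_rsum => x; ring.
Qed.

End Stationary.

(** * Integration in time *)

Section Tonelli.
Variables (R : realType) (X : countType).
Local Notation leb := (@lebesgue_measure R).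

(** Codes that belong to no point contribute 0. The sum becomes a series over the naturals, to which
    Tonelli's theorem for series applies. *)
Lemma esum_pickle (a : X -> \bar R) : (forall x, 0 <= a x)%E ->
  (\esum_(x in [set: X]) a x =
   \sum_(n <oo) (if @pickle_inv X n is Some x then a x else 0))%E.
Proof.
move=> a0; rewrite nneseries_esumT; last by move=> n; case: pickle_inv.
rewrite (@esum_inj R nat X (@pickle X)).
- by apply: eq_esum => x _; rewrite pickleK_inv.
- exact: (pcan_inj (@pickleK_inv X)).
- move=> n hn; have := @pickle_invK X n.
  by case: pickle_inv => //= x xn; exfalso; apply: hn; exists x.
Qed.

Variables (D : set R) (f : X -> R -> \bar R).
Hypothesis mD : measurable D.
Hypothesis mf : forall x, measurable_fun D (f x).
Hypothesis f0 : forall x s, D s -> (0 <= f x s)%E.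

Let h n s := (if @pickle_inv X n is Some x then f x s else 0)%E.

Let mh n : measurable_fun D (h n).
Proof. by rewrite /h; case: pickle_inv => //; exact: measurable_cst. Qed.

Let h0 n s : D s -> (0 <= h n s)%E.
Proof. by move=> Ds; rewrite /h; case: pickle_inv => // x; exact: f0. Qed.

Let hE s : D s -> (\esum_(x in [set: X]) f x s = \sum_(n <oo) h n s)%E.
Proof. by move=> Ds; apply: esum_pickle => x; exact: f0. Qed.

Lemma measurable_fun_esum : measurable_fun D (fun s => \esum_(x in [set: X]) f x s)%E.
Proof.
apply: (eq_measurable_fun (fun s => \sum_(n <oo) h n s)%E).
  by move=> s; rewrite inE => /hE.
have := @ge0_emeasurable_sum _ _ R D h xpredT; apply.
- by move=> k x Dx _; exact: h0.
- by move=> k _; exact: mh.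
Qed.

Lemma integral_esum :
  (\int[leb]_(s in D) (\esum_(x in [set: X]) f x s) =
   \esum_(x in [set: X]) \int[leb]_(s in D) f x s)%E.
Proof.
transitivity (\int[leb]_(s in D) (\sum_(n <oo) h n s))%E.
  by apply: eq_integral => s; rewrite inE => /hE.
rewrite integral_nneseries// esum_pickle; last first.
  by move=> x; apply: integral_ge0 => s; exact: f0.
apply: eq_eseriesr => n _; rewrite /h; case: pickle_inv => //.
by rewrite integral0.
Qed.

End Tonelli.

(** * The mass as a continuous function of time *)

Section Mass.
Variables (R : realType) (X : countType) (G : graph R X) (T : R) (u : R -> X -> R).
Local Notation mu := (gmu G).
Hypothesis T0 : 0 < T.
Hypothesis u_ge0 : forall (t : R) x, t \in `[0, T] -> 0 <= u t x.
Hypothesis u_cont : continuous_ell1 G T u.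

Definition rmass (t : R) : R := fine (mass G u t).

Lemma summ_mass t : t \in `[0, T] -> summ (fun x => u t x * mu x).
Proof.
move=> tT; have [+ _] := u_cont tT; rewrite /ell1 /norm1 /summ.
by congr (_ < _)%E; apply: eq_esum => x _; rewrite normrM (gtr0_norm (gmu_gt0 G x)).
Qed.

Lemma rmassE t : t \in `[0, T] -> rmass t = rsum (fun x => u t x * mu x).
Proof.
move=> tT; rewrite rsumE_ge0// => x.
by rewrite mulr_ge0 ?u_ge0// ltW// gmu_gt0.
Qed.

Lemma mass_fin t : t \in `[0, T] -> mass G u t = (rmass t)%:E.
Proof.
move=> tT; rewrite rmassE// rsum_esum//; last exact: summ_mass.
by move=> x; rewrite mulr_ge0 ?u_ge0// ltW// gmu_gt0.
Qed.

Lemma rmass_continuous : {within `[0, T], continuous rmass}.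
Proof.
apply/subspace_continuousP => t /= tT.
have [_ /fine_cvg/cvgrPdist_le c] := u_cont tT.
apply/cvgrPdist_le => e /c; rewrite !near_withinE; apply: filterS => s h sT.
have := h sT; rewrite sub0r normrN; apply: le_trans.
apply: le_trans (ler_norm _).
have := summB (summ_mass sT) (summ_mass tT) => sB.
suff : `|rmass t - rmass s| <= fine (norm1 G (u s \- u t)) by [].
rewrite !rmassE// -rsumB//; [|exact: summ_mass..].
have -> : fine (norm1 G (u s \- u t)) = rsum (fun x => `|u s x * mu x - u t x * mu x|).
  rewrite rsumE_ge0// /norm1; congr fine; apply: eq_esum => x _.
  by rewrite -mulrBl normrM (gtr0_norm (gmu_gt0 G x)).
apply: ler_norm_rsum => [|x]; last by rewrite distrC.
by apply: summ_dom sB => x; rewrite normr_id.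
Qed.

Lemma rmass_bounded : exists C : R, forall t, t \in `[0, T] -> rmass t <= C.
Proof.
have [c _ hc] := EVT_max (ltW T0) rmass_continuous.
by exists (rmass c) => t /hc.
Qed.

End Mass.

(** * The equation integrated over a time interval inside (0, T) *)

Section Interval.
Variables (R : realType) (X : countType) (G : graph R X).
Local Notation w := (gw G).
Local Notation kappa := (gkappa G).
Local Notation mu := (gmu G).
Local Notation leb := (@lebesgue_measure R).
Variables (phi : R -> R) (hphi : nonlinearity phi).
Variables (T : R) (T0 : 0 < T) (u0 : X -> R) (u : R -> X -> R).
Hypothesis u_ge0 : forall (t : R) x, t \in `[0, T] -> 0 <= u t x.
Hypothesis hu : pointwise_solution G phi T u0 u.
Variables (a b : R).
Hypotheses (a0 : 0 < a) (ab : a < b) (bT : b < T).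

Let D : set R := `[a, b]%classic.

Let Din s : D s -> s \in `]0, T[.
Proof.
rewrite /D/= !in_itv/= => /andP[h1 h2].
by rewrite (lt_le_trans a0)//= (le_lt_trans h2).
Qed.

Let Din' s : D s -> s \in `[0, T].
Proof. by move=> /Din; exact: subset_itv_oo_cc. Qed.

Let mD : measurable D. Proof. exact: measurable_itv. Qed.

Let phi_ge0 r : 0 <= r -> 0 <= phi r.
Proof. by case: hphi => _ mono _ p0 r0; rewrite -p0; exact: mono. Qed.

Let f x s := phi (u s x).

Let f_ge0 x s : D s -> 0 <= f x s.
Proof. by move=> Ds; apply: phi_ge0; apply: u_ge0; exact: Din'. Qed.

Let u_continuous x s : D s -> {for s, continuous (u^~ x)}.
Proof.
move=> /Din sT; have [_ /(_ x)[_ du _] _ _] := hu.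
by apply: differentiable_continuous; apply/derivable1_diffP; exact: du.
Qed.

Let f_continuous x : {within D, continuous (f x)}.
Proof.
apply: continuous_in_subspaceT => s; rewrite inE => Ds.
apply: continuous_comp; first exact: u_continuous.
by case: hphi => c _ _ _; exact: c.
Qed.

Let f_int x : leb.-integrable D (EFin \o f x).
Proof. by apply: continuous_compact_integrable => //; exact: segment_compact. Qed.

Let f_meas x : measurable_fun D (f x).
Proof.
exact: (@subspace_continuous_measurable_fun R D (f x) mD (@f_continuous x)).
Qed.

Let f_emeas x : measurable_fun D (EFin \o f x).
Proof. by apply/measurable_EFinP; exact: f_meas. Qed.

Definition time_integral x : R := (\int[leb]_(s in D) f x s)%R.
Local Notation v := time_integral.

Lemma time_integralE x : (v x)%:E = (\int[leb]_(s in D) (f x s)%:E)%E.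
Proof.
rewrite /v /Rintegral fineK//; apply: integrable_fin_num => //; exact: f_int.
Qed.

Lemma time_integral_ge0 x : 0 <= v x.
Proof. by apply: Rintegral_ge0 => s; exact: f_ge0. Qed.

Lemma integral_cst_itv (c : R) : (\int[leb]_(s in D) c%:E = (c * (b - a))%:E)%E.
Proof.
rewrite (integral_cst leb mD c%:E)/= /D lebesgue_measure_itv/= lte_fin ab.
by rewrite -EFinD -EFinM.
Qed.

Lemma time_integral_le x M : (forall s, D s -> f x s <= M) -> v x <= M * (b - a).
Proof.
move=> hM; rewrite -lee_fin time_integralE -integral_cst_itv.
apply: ge0_le_integral => //.
- by move=> s Ds; rewrite lee_fin f_ge0.
- exact: f_emeas.
Qed.

Lemma time_integral_esum (c : X -> R) : (forall x, 0 <= c x) ->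
  (\esum_(x in [set: X]) (c x * v x)%:E =
   \int[leb]_(s in D) \esum_(x in [set: X]) (c x * f x s)%:E)%E.
Proof.
move=> c0; rewrite integral_esum//.
- apply: eq_esum => x _; rewrite EFinM time_integralE.
  have h := @ge0_integralZl_EFin _ _ R leb D mD (EFin \o f x)
    (fun s Ds => f_ge0 x Ds) (f_emeas x) (c x) (c0 x).
  by rewrite -h; apply: eq_integral => s _; rewrite EFinM.
- by move=> x; apply/measurable_EFinP; exact: measurable_funM.
- by move=> x s Ds; rewrite lee_fin mulr_ge0// f_ge0.
Qed.

Lemma time_integral_balance x (M : R) : (forall y s, D s -> f y s <= M) ->
  opH G v x = mu x * (u a x - u b x).
Proof.
move=> hM; have [dom /(_ x)[ux_cont ux_der ux_c1] eqn _] := hu.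
have aD : D a by rewrite /D/= in_itv/= lexx ltW.
have bD : D b by rewrite /D/= in_itv/= lexx andbT ltW.
pose du s := derive1 (u^~ x) s.
have du_cont : {within D, continuous du}.
  by apply: continuous_in_subspaceT => s; rewrite inE => /Din sT; exact: ux_c1.
have du_int : leb.-integrable D (EFin \o du).
  by apply: continuous_compact_integrable => //; exact: segment_compact.
have FTC : (\int[leb]_(s in D) (du s)%:E = (u b x)%:E - (u a x)%:E)%E.
  apply: (@continuous_FTC2 R du (u^~ x) a b ab) => //; split.
  - move=> s sab; apply: ux_der; apply: Din; exact: subset_itv_oo_cc.
  - by apply: cvg_at_right_filter; exact: u_continuous.
  - by apply: cvg_at_left_filter; exact: u_continuous.
have fl s : D s -> ldom G (f^~ s) by move=> /Din /dom /lap_domE.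
(* The equation is solved for the adjacency sum, whose terms are nonnegative: Tonelli then exchanges
   it with the time integral, and only finitely many signed terms remain on the other side. *)
have adjE s : D s -> adj G (f^~ s) x = wdeg G x * f x s + mu x * du s.
  move=> Ds; have := lapE x (fl s Ds).
  have := eqn s x (Din Ds); rewrite -/(du s).
  have -> : lap G (phi \o u s) x = lap G (f^~ s) x by [].
  move=> /(canRL (addrK _)); rewrite sub0r => -> .
  by rewrite /opH => e; lra.
have M0 : 0 <= M by apply: le_trans (hM x a aD); exact: f_ge0.
have sv : ldom G v.
  apply: (@ldom_bounded _ _ _ _ (M * (b - a))) => y.
  by rewrite ger0_norm ?time_integral_ge0// time_integral_le// => s; exact: hM.
have A : (adj G v x)%:E = (\int[leb]_(s in D) (wdeg G x * f x s + mu x * du s)%:E)%E.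
  rewrite /adj rsum_esum//; last first.
    by move=> y; rewrite mulr_ge0 ?gw_ge0// time_integral_ge0.
  rewrite time_integral_esum; last by move=> y; exact: gw_ge0.
  apply: eq_integral => s; rewrite inE => Ds; rewrite -adjE// /adj rsum_esum//.
    by move=> y; rewrite mulr_ge0 ?gw_ge0// f_ge0.
  exact: fl.
have B : (\int[leb]_(s in D) (wdeg G x * f x s + mu x * du s)%:E =
   (wdeg G x * v x + mu x * (u b x - u a x))%:E)%E.
  transitivity (\int[leb]_(s in D) ((wdeg G x)%:E * (f x s)%:E + (mu x)%:E * (du s)%:E))%E.
    by apply: eq_integral => s _; rewrite EFinD !EFinM.
  have i1 : leb.-integrable D (fun s => (wdeg G x)%:E * (EFin \o f x) s)%E.
    by apply: integrableZl => //; exact: f_int.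
  have i2 : leb.-integrable D (fun s => (mu x)%:E * (EFin \o du) s)%E.
    by apply: integrableZl.
  rewrite (@integralD _ _ R leb D mD _ _ i1 i2).
  rewrite (@integralZl _ _ R leb D mD _ (f_int x)) (@integralZl _ _ R leb D mD _ du_int).
  rewrite FTC -time_integralE.
  by rewrite -EFinB -!EFinM -EFinD.
have := congr1 fine (etrans A B); rewrite /= /opH => ->; ring.
Qed.

End Interval.

(** * The mass balance *)

(** Below some [d] the quotient is bounded by the upper limit; from [d] to [B] monotonicity gives
    phi(r) <= phi(B) <= (phi(B) / d) r. *)
Lemma limf_esup_linear_bound (R : realType) (phi : R -> R) (B : R) :
  nonlinearity phi ->
  (limf_esup (fun r : R => (phi r / r)%:E) 0^'+ < +oo)%E ->
  exists2 C : R, 0 <= C & forall r, 0 <= r -> r <= B -> phi r <= C * r.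
Proof.
move=> [_ mono _ p0] /ereal_inf_lt[_ [V [d /= d0 hV] <-] hlt].
have [c hc] : exists c : R, forall r, V r -> phi r / r <= c.
  case E : (ereal_sup _) hlt => [c| |] // _.
    exists c => r Vr; rewrite -lee_fin -E; apply: ereal_sup_ubound.
    by exists r.
  exists 0 => r Vr; have : ((phi r / r)%:E <= -oo)%E.
    by rewrite -E; apply: ereal_sup_ubound; exists r.
  by rewrite leNgt ltNyr.
have [C [C0 Cc CB]] : exists C : R, [/\ 0 <= C, c <= C & phi B / d <= C].
  exists (Num.max 0 (Num.max c (phi B / d))).
  by split; rewrite !le_max lexx ?orbT.
exists C => // r; rewrite le_eqVlt => /orP[/eqP <- _|r0 rB]; first by rewrite p0 mulr0.
have [rd|dr] := ltP r d.
  rewrite -ler_pdivrMr//; apply: le_trans Cc; apply: hc; apply: hV => //.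
  by rewrite /ball_/= sub0r normrN gtr0_norm.
have pB0 : 0 <= phi B by rewrite -p0; apply: mono; exact: le_trans (ltW r0) rB.
apply: (@le_trans _ _ (phi B)); first exact: mono.
apply: (@le_trans _ _ (C * d)); first by rewrite -ler_pdivrMr.
by rewrite ler_wpM2l.
Qed.

Section Balance.
Variables (R : realType) (X : countType) (G : graph R X).
Local Notation kappa := (gkappa G).
Local Notation mu := (gmu G).
Local Notation leb := (@lebesgue_measure R).
Hypothesis defect0 : forall x, defect G x = 0.
Variables (phi : R -> R) (hphi : nonlinearity phi).
Hypothesis hmuphi : (total_measure G < +oo)%E \/
  (limf_esup (fun r : R => (phi r / r)%:E) 0^'+ < +oo)%E.
Variables (T : R) (T0 : 0 < T) (u0 : X -> R) (u : R -> X -> R).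
Hypothesis u_ge0 : forall (t : R) x, t \in `[0, T] -> 0 <= u t x.
Hypothesis hu : pointwise_solution G phi T u0 u.
Hypothesis u_cont : continuous_ell1 G T u.
Hypothesis hu_bdd : forall tau : R, tau \in `]0, T[ ->
  (ereal_sup [set (u s x)%:E | s in `[tau, T] & x in [set: X]] < +oo)%E.

Lemma solution_bounded (a : R) : a \in `]0, T[ -> exists2 B : R, 0 <= B &
  forall s x, s \in `[a, T] -> u s x <= B.
Proof.
move=> /hu_bdd h; case E : (ereal_sup _) h => [B| |] // _.
  exists (Num.max B 0); first by rewrite le_max lexx orbT.
  move=> s x sa; rewrite le_max; apply/orP; left; rewrite -lee_fin -E.
  by apply: ereal_sup_ubound; exists s => //; exists x.
exists 0 => // s x sa; have : ((u s x)%:E <= -oo)%E.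
  by rewrite -E; apply: ereal_sup_ubound; exists s => //; exists x.
by rewrite leNgt ltNyr.
Qed.

(** Here the alternative on the measure and the nonlinearity enters: either phi(u) <= phi(B) on a
    space of finite measure, or phi(u) <= C u with bounded mass. Integrated in time, the bound makes
    v summable against [mu]. *)
Lemma flux_mass_bounded (a : R) : a \in `]0, T[ -> exists C : R,
  forall s, s \in `[a, T] ->
  (\esum_(x in [set: X]) (mu x * phi (u s x))%:E <= C%:E)%E.
Proof.
move=> aT; have [B B0 hB] := solution_bounded aT.
have [_ mono _ p0] := hphi.
have saT s : s \in `[a, T] -> s \in `[0, T].
  move: aT; rewrite !in_itv/= => /andP[a0 _] /andP[as_ ->].
  by rewrite andbT (le_trans (ltW a0)).
have mu0 x : 0 <= mu x by rewrite ltW// gmu_gt0.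
case: hmuphi => [fin|/limf_esup_linear_bound -/(_ B hphi)[C C0 hC]].
  exists (phi B * fine (total_measure G)) => s sa.
  apply: esum_le_seq => r ur; rewrite sumEFin lee_fin.
  apply: (@le_trans _ _ (\sum_(x <- r) phi B * mu x)).
    by apply: ler_sum => x _; rewrite mulrC ler_wpM2r//; apply: mono; exact: hB.
  rewrite -mulr_sumr ler_wpM2l//; first by rewrite -p0; exact: mono.
  rewrite -lee_fin fine_esumK// -sumEFin; apply: seq_le_esum => //.
have [Cm hCm] := rmass_bounded T0 u_ge0 u_cont.
exists (C * Cm) => s sa; have sT := saT s sa.
apply: esum_le_seq => r ur; rewrite sumEFin lee_fin.
apply: (@le_trans _ _ (C * \sum_(x <- r) u s x * mu x)).
  rewrite mulr_sumr; apply: ler_sum => x _; rewrite mulrCA mulrC mulrCA.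
  rewrite [leRHS](_ : _ = mu x * (C * u s x)); last by ring.
  by rewrite mulrC ler_wpM2l//; apply: hC; [exact: u_ge0|exact: hB].
rewrite ler_wpM2l//; apply: le_trans (hCm s sT); rewrite (rmassE G u_ge0)//.
apply: rsum_seq_le => // [x|]; last exact: (summ_mass u_cont).
by rewrite mulr_ge0// u_ge0.
Qed.

Let phi_ge0 s x : s \in `[0, T] -> 0 <= phi (u s x).
Proof. by move=> sT; have [_ mono _ <-] := hphi; apply: mono; exact: u_ge0. Qed.

Lemma flux_measurable (c : X -> R) : (forall x, 0 <= c x) ->
  measurable_fun `[0, T] (fun s => \esum_(x in [set: X]) (c x * phi (u s x))%:E)%E.
Proof.
move=> c0; apply: (@measurable_fun_esum R X `[0, T] (fun x s => (c x * phi (u s x))%:E)).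
- move=> x; apply/measurable_EFinP; apply: measurable_funM; first exact: measurable_cst.
  apply: (@subspace_continuous_measurable_fun R `[0, T] (fun s => phi (u s x))).
    exact: measurable_itv.
  have [_ /(_ x)[uc _ _] _ _] := hu; have [pc _ _ _] := hphi.
  by move=> s; apply: continuous_comp; [exact: uc|exact: pc].
- by move=> x s sT; rewrite lee_fin mulr_ge0// phi_ge0.
Qed.

Lemma killing_measurable : measurable_fun `[0, T] (killing_rate G phi u).
Proof. by apply: flux_measurable => x; exact: gkappa_ge0. Qed.

Lemma killing_ge0 s : s \in `[0, T] -> (0 <= killing_rate G phi u s)%E.
Proof.
by move=> sT; apply: esum_ge0 => x _; rewrite lee_fin mulr_ge0 ?gkappa_ge0// phi_ge0.
Qed.

Lemma interior_balance (a b : R) : 0 < a -> a < b -> b < T ->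
  ((rmass G u b)%:E + \int[leb]_(s in `[a, b]) killing_rate G phi u s =
   (rmass G u a)%:E)%E.
Proof.
move=> a0 ab bT; have [_ mono _ p0] := hphi.
have aT : a \in `]0, T[ by rewrite in_itv/= a0 (lt_trans ab).
have abT s : s \in `[a, b] -> s \in `[a, T].
  by rewrite !in_itv/= => /andP[-> sb]; rewrite (le_trans sb)// ltW.
have ab0T s : s \in `[a, b] -> s \in `[0, T].
  by rewrite !in_itv/= => /andP[as_ sb]; rewrite (le_trans (ltW a0))//= (le_trans sb)// ltW.
have a_in : a \in `[0, T] by apply: ab0T; rewrite in_itv/= lexx ltW.
have b_in : b \in `[0, T] by apply: ab0T; rewrite in_itv/= lexx andbT ltW.
have [B B0 hB] := solution_bounded aT.
have [C hC] := flux_mass_bounded aT.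
have mu0 x : 0 <= mu x by rewrite ltW// gmu_gt0.
pose v := time_integral phi u a b.
have hM : forall y s, `[a, b]%classic s -> phi (u s y) <= phi B.
  by move=> y s sab; apply: mono; apply: hB; exact: abT.
have tE (c : X -> R) : (forall x, 0 <= c x) ->
    (\esum_(x in [set: X]) (c x * v x)%:E =
     \int[leb]_(s in `[a, b]) \esum_(x in [set: X]) (c x * phi (u s x))%:E)%E.
  by move=> c0; exact: (time_integral_esum hphi u_ge0 hu a0 bT c0).
have v0 x : 0 <= v x by exact: (time_integral_ge0 hphi u_ge0 a0 bT).
have vM x : 0 <= v x <= phi B * (b - a).
  by rewrite v0/=; apply: (time_integral_le hphi u_ge0 hu a0 ab bT) => s; exact: hM.
have HE x : opH G v x = mu x * (u a x - u b x).
  exact: (time_integral_balance hphi u_ge0 hu a0 ab bT x hM).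
have sa := summ_mass u_cont a_in; have sb := summ_mass u_cont b_in.
have HE' : opH G v = fun x => u a x * mu x - u b x * mu x.
  by apply/funext => x; rewrite HE; ring.
have sH : summ (opH G v) by rewrite HE'; exact: summB.
have sv : summ (fun x => mu x * v x).
  rewrite summ_ge0; last by move=> x; rewrite mulr_ge0.
  rewrite tE//; apply: (@le_lt_trans _ _ (\int[leb]_(s in `[a, b]) cst C%:E s)%E).
    have sub : `[a, b]%classic `<=` `[0, T]%classic by move=> s; exact: ab0T.
    apply: ge0_le_integral => //.
    - move=> s /ab0T sT; apply: esum_ge0 => x _; rewrite lee_fin mulr_ge0//.
      exact: phi_ge0.
    - by apply: measurable_funS (flux_measurable mu0).
    - by move=> s /abT; exact: hC.
  rewrite integral_cst//= lebesgue_measure_itv/= lte_fin ab -EFinD -EFinM.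
  exact: ltry.
have [sk rk] := stationary_balance defect0 vM sv sH.
have : (rsum (opH G v))%:E = (\int[leb]_(s in `[a, b]) killing_rate G phi u s)%E.
  rewrite rk rsum_esum//; last by move=> x; rewrite mulr_ge0// gkappa_ge0.
  by rewrite tE//; exact: gkappa_ge0.
rewrite HE' rsumB// -!(rmassE G u_ge0)// => <-.
by rewrite -EFinD; congr EFin; ring.
Qed.

Lemma within_continuous_cvg (f : R -> R) (s : nat -> R) (l : R) :
  {within `[0, T], continuous f} -> (forall n, s n \in `[0, T]) -> l \in `[0, T] ->
  s n @[n --> \oo] --> l -> f (s n) @[n --> \oo] --> f l.
Proof.
move=> /subspace_continuousP fc sT lT sl; have /cvgrPdist_le fl := fc l lT.
apply/cvgrPdist_le => e /fl[d /= d0 hd].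
have [N _ hN] := (cvgrPdist_lt _ _).1 sl d d0.
by exists N => // n Nn; apply: hd => //; exact: hN.
Qed.

Lemma global_balance (t : R) : t \in `[0, T] ->
  ((rmass G u t)%:E + \int[leb]_(s in `[0%R, t]) killing_rate G phi u s =
   (rmass G u 0)%:E)%E.
Proof.
move=> tT; move: (tT); rewrite in_itv/= => /andP[].
rewrite le_eqVlt => /orP[/eqP <- _|t0 tleT].
  by rewrite set_itv1 integral_set1 adde0.
(* The offset 3 gives [d n <= t / 3], so that [d n < t - d n]. The right end retreats as well, since
   [interior_balance] requires it to be below [T] and [t] may equal [T]. *)
pose d n : R := t / n.+3%:R.
have d0 n : 0 < d n by rewrite divr_gt0.
have d3 n : d n <= t / 3 by rewrite ler_pM2l// lef_pV2 ?posrE// ler_nat.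
have dm n m : (n <= m)%N -> d m <= d n.
  by move=> nm; rewrite ler_pM2l// lef_pV2 ?posrE// ler_nat.
have dc : d n @[n --> \oo] --> (0 : R).
  apply/cvgrPdist_le => e e0; exists (Num.trunc (t / e)).+1 => // n /= hn.
  rewrite sub0r normrN gtr0_norm// ler_pdivrMr// mulrC -ler_pdivrMr//.
  apply: (@le_trans _ _ (Num.trunc (t / e)).+1%:R); first by rewrite ltW// truncnS_gt.
  by rewrite ler_nat; do 3 apply: leqW.
pose F n : set R := `[d n, t - d n]%classic.
have FT n s : F n s -> s \in `[0, T].
  rewrite /F/= !in_itv/= => /andP[h1 h2]; have := d0 n => h3.
  by apply/andP; split; lra.
have Fnd : nondecreasing_seq F.
  move=> n m nm; rewrite subsetEset /F => s /=; rewrite !in_itv/= => /andP[h1 h2].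
  by have := dm _ _ nm => h3; apply/andP; split; lra.
have FU : \bigcup_n F n = `]0, t[%classic.
  apply/seteqP; split => s.
    move=> [n _]; rewrite /F/= !in_itv/= => /andP[h1 h2]; have := d0 n => h3.
    by apply/andP; split; lra.
  rewrite /= in_itv/= => /andP[s0 st].
  have m0 : 0 < Num.min s (t - s) by rewrite lt_min s0 subr_gt0.
  have [n _ /(_ n (leqnn n))] := (cvgrPdist_le _ _).1 dc _ m0.
  rewrite /= sub0r normrN (gtr0_norm (d0 n)) le_min => /andP[h1 h2].
  by exists n => //; rewrite /F/= in_itv/=; apply/andP; split; lra.
have mFn n : measurable (F n) by exact: measurable_itv.
(* Monotone convergence over the growing intervals: integrability of the killing rate up to time 0
   is an outcome, not a hypothesis. *)
have c1 : (\int[leb]_(s in F n) killing_rate G phi u s)%E @[n --> \oo] -->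
    (\int[leb]_(s in \bigcup_n F n) killing_rate G phi u s)%E.
  apply: ge0_nondecreasing_set_cvg_integral => //.
  - by move=> n; apply: measurable_funS killing_measurable => // s; exact: FT.
  - by move=> n s Fs; apply: killing_ge0; exact: FT Fs.
rewrite FU in c1.
have dT n : d n \in `[0, T] by rewrite in_itv/=; have := d0 n; have := d3 n; lra.
have tdT n : t - d n \in `[0, T] by rewrite in_itv/=; have := d0 n; have := d3 n; lra.
have z0T : (0 : R) \in `[0, T] by rewrite in_itv/= lexx ltW.
have mc := rmass_continuous u_ge0 u_cont.
have c2 : rmass G u (d n) - rmass G u (t - d n) @[n --> \oo] --> rmass G u 0 - rmass G u t.
  apply: cvgB; first exact: within_continuous_cvg.
  apply: within_continuous_cvg => //.
  by rewrite -[X in _ --> X]subr0; apply: cvgB => //; exact: cvg_cst.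
have IE n : (\int[leb]_(s in F n) killing_rate G phi u s =
    (rmass G u (d n) - rmass G u (t - d n))%:E)%E.
  have h3 := d3 n; have h0 := d0 n.
  have := @interior_balance (d n) (t - d n) h0 ltac:(lra) ltac:(lra).
  rewrite EFinB => <-; rewrite addeAC -EFinN -EFinD subrr add0e//.
have c3 : (\int[leb]_(s in F n) killing_rate G phi u s)%E @[n --> \oo] -->
   (rmass G u 0 - rmass G u t)%:E.
  under eq_fun do rewrite IE.
  by apply: cvg_EFin => //; exact: nearW.
have -> : (\int[leb]_(s in `[0%R, t]) killing_rate G phi u s =
   \int[leb]_(s in `]0%R, t[) killing_rate G phi u s)%E.
  apply: integral_itv_bndoo.
  apply: measurable_funS (killing_measurable) => // s /=; rewrite !in_itv/= => /andP[h1 h2].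
  by apply/andP; split; lra.
rewrite -(cvg_lim _ c1)// (cvg_lim _ c3)//.
by rewrite -EFinD; congr EFin; ring.
Qed.

End Balance.

(** * Absolute continuity and the derivative of the mass *)

Section AbsoluteContinuity.
Variable R : realType.
Local Notation leb := (@lebesgue_measure R).
Variables (T : R) (T0 : 0 < T) (m : R -> R) (k : R -> \bar R).
Hypothesis mk : measurable_fun `[0, T] k.
Hypothesis k0 : forall s, s \in `[0, T] -> (0 <= k s)%E.
Hypothesis balance : forall t, t \in `[0, T] ->
  ((m t)%:E + \int[leb]_(s in `[0%R, t]) k s = (m 0)%:E)%E.

Let D : set R := `[0, T]%classic.
Let mD : measurable D. Proof. exact: measurable_itv. Qed.

(** The killing rate may be infinite on a null set; this real-valued version, extended by 0, is what
    differentiation of integrals applies to. *)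
Let rate : R -> R := (fine \o k) \_ D.

Lemma integral_balance t : t \in `[0, T] ->
  (\int[leb]_(s in `[0%R, t]) k s = (m 0 - m t)%:E)%E.
Proof.
by move=> /balance; rewrite EFinB => <-; rewrite addeAC -EFinN -EFinD subrr add0e.
Qed.

Lemma k_integrable : leb.-integrable D k.
Proof.
apply/integrableP; split => //.
have -> : (\int[leb]_(s in D) `|k s| = \int[leb]_(s in D) k s)%E.
  by apply: eq_integral => s; rewrite inE => Ds; rewrite gee0_abs// k0.
by rewrite (integral_balance (t := T)) ?ltry// in_itv/= lexx ltW.
Qed.

Let fine_k_meas : measurable_fun D (fine \o k).
Proof. exact: measurableT_comp. Qed.

Let fine_k_integrable : leb.-integrable D (EFin \o (fine \o k)).
Proof.
apply: (@le_integrable _ _ _ leb D mD _ k); last exact: k_integrable.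
  exact/measurable_EFinP.
move=> s Ds; rewrite gee0_abs ?lee_fin ?fine_ge0 ?k0//= gee0_abs ?k0//.
by case: (k s) (k0 Ds).
Qed.

Lemma rate_integrable : leb.-integrable setT (EFin \o rate).
Proof.
rewrite /rate -restrict_EFin; 
exact: (proj1 (@integrable_mkcond _ _ R leb D _ mD) fine_k_integrable).
Qed.

Let rate_meas : measurable_fun setT (EFin \o rate).
Proof. exact: measurable_int rate_integrable. Qed.

Lemma k_fin_ae : {ae leb, forall s, D s -> k s \is a fin_num}.
Proof. exact: integrable_ae k_integrable. Qed.

Lemma integral_rate (A : set R) : measurable A -> A `<=` D ->
  (\int[leb]_(s in A) k s = \int[leb]_(s in A) (rate s)%:E)%E.
Proof.
move=> mA AD; apply: ae_eq_integral => //.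
- exact: measurable_funS mk.
- exact: measurable_funS rate_meas.
- have FF := ae_filter_ringOfSetsType leb.
  apply: filterS k_fin_ae => s ks As; have Ds := AD s As.
  by rewrite /rate patchE mem_set//= fineK// ks.
Qed.

Lemma rate_ge0 s : 0 <= rate s.
Proof.
rewrite /rate patchE; case: ifPn => //; rewrite inE => Ds.
by rewrite fine_ge0// k0.
Qed.

Lemma increment x y : 0 <= x -> x <= y -> y <= T ->
  (\int[leb]_(s in `]x, y[) (rate s)%:E = (m x - m y)%:E)%E.
Proof.
move=> x0 xy yT.
have xT : x \in `[0, T] by rewrite in_itv/= x0 (le_trans xy).
have yT' : y \in `[0, T] by rewrite in_itv/= yT (le_trans x0).
have mr := rate_meas.
have sub1 : `[0, y]%classic `<=` D.
  by move=> s; rewrite /D/= !in_itv/= => /andP[-> sy]; rewrite (le_trans sy).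
have sub2 : `[0, x]%classic `<=` D.
  by move=> s; rewrite /D/= !in_itv/= => /andP[-> sy]; rewrite (le_trans sy)// (le_trans xy).
have := integral_balance yT'; have := integral_balance xT.
rewrite !integral_rate// => Ix.
have -> : `[0, y]%classic = `[0, x]%classic `|` `]x, y]%classic.
  by rewrite -itv_bndbnd_setU// bnd_simp.
rewrite ge0_integral_setU//; last 3 first.
- exact: measurable_funS mr.
- by move=> s _; rewrite lee_fin rate_ge0.
- apply/disj_setPRL => s /=; rewrite !in_itv/= => /andP[h1 h2] /andP[h3 h4].
  by move: h1; rewrite ltNge h4.
rewrite Ix => Iy.
have -> : (\int[leb]_(s in `]x, y[) (rate s)%:E = \int[leb]_(s in `]x, y]) (rate s)%:E)%E.
  by apply/esym/integral_itv_bndoo; exact: measurable_funS mr.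
move: Iy; case: (\int[leb]_(_ in _) _)%E => [r| |] //.
by rewrite -EFinD => -[h]; congr EFin; lra.
Qed.

(** Since [m] decreases, the sum of its absolute increments is the integral of [rate] over the union
    of the disjoint intervals; this is small with the measure of the union by absolute continuity of
    the integral. *)
Lemma balance_absolutely_continuous : absolutely_continuous 0 T m.
Proof.
move=> e e0; have [d [d0 hd]] := integral_normr_continuous rate_integrable e0.
exists d => // n x y xy tI sd.
pose F (i : 'I_n) : set R := [set` `]x i, y i[].
have mF i : measurable (F i) by exact: measurable_itv.
pose A := \big[setU/set0]_(i <- index_enum 'I_n) F i.
have mA : measurable A by exact: bigsetU_measurable.
have ui : uniq (index_enum 'I_n) by exact: index_enum_uniq.
have tI' : trivIset [set` index_enum 'I_n] F.
  by move=> i j _ _; apply: tI.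
have lebF i : leb (F i) = (y i - x i)%:E.
  rewrite /F lebesgue_measure_itv/= lte_fin; case: ltP => //.
  have [_ h _] := xy i; move=> h'; rewrite (_ : y i = x i) ?subrr//.
  by apply/eqP; rewrite eq_le h h'.
have lebA : leb A = (\sum_(i < n) (y i - x i))%:E.
  have := @ge0_integral_bigsetU _ _ R leb 'I_n F (cst 1%E) (index_enum 'I_n) mF ui tI'.
  rewrite -/A => /(_ (measurable_cst _) (fun _ _ => lee01)).
  rewrite integral_cst// mul1e => ->; rewrite -sumEFin; apply: eq_bigr => i _.
  by rewrite integral_cst; [rewrite mul1e; exact: lebF|exact: mF].
have lebAd : (leb A < d%:E)%E by rewrite lebA lte_fin.
have := hd A mA lebAd.
apply: le_lt_trans; rewrite le_eqVlt; apply/orP; left; apply/eqP.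
have mr := rate_meas.
rewrite /Rintegral.
have -> : (\int[leb]_(s in A) `|rate s|%:E = \int[leb]_(s in A) (rate s)%:E)%E.
  by apply: eq_integral => s _; rewrite ger0_norm// rate_ge0.
rewrite (@ge0_integral_bigsetU _ _ R leb 'I_n F _ (index_enum 'I_n) mF ui tI'); last 2 first.
- by apply: measurable_funS mr.
- by move=> s _; rewrite lee_fin rate_ge0.
have mono i : 0 <= m (x i) - m (y i).
  rewrite -lee_fin; have [h1 h2 h3] := xy i; rewrite -increment//.
  by apply: integral_ge0 => s _; rewrite lee_fin rate_ge0.
rewrite (eq_bigr (fun i => (m (x i) - m (y i))%:E)).
  rewrite sumEFin/=; apply: eq_bigr => i _.
  by rewrite distrC ger0_norm.
by move=> i _; have [h1 h2 h3] := xy i; rewrite -increment.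
Qed.

Lemma balance_derivative : {ae leb, forall t : R, t \in `]0, T[ ->
  derivable m t 1 /\ (derive1 m t)%:E = (- k t)%E}.
Proof.
have li : locally_integrable [set: R] rate.
  by apply: integrable_locally => //.
have ri y : leb.-integrable [set` Interval (BLeft 0) (BRight y)] (EFin \o rate).
  exact: integrableS rate_integrable.
have := FTC1 ri li; move=> /=; 
set F := fun x => (\int[leb]_(t in [set` Interval (BLeft 0) (BRight x)]) rate t)%R => h.
have FF := ae_filter_ringOfSetsType leb.
apply: filterS2 h k_fin_ae => t ht kt tT.
have tD : D t by exact: subset_itv_oo_cc tT.
have t0 : 0 < t by move: tT; rewrite in_itv/= => /andP[].
have [dF F't] : derivable F t 1 /\ derive1 F t = rate t by apply: ht; rewrite lte_fin.
have FE s : s \in `[0, T] -> F s = m 0 - m s.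
  move=> sT; rewrite /F /Rintegral -integral_rate//.
    by rewrite integral_balance.
  move=> r; move: sT; rewrite /D/= !in_itv/= => /andP[_ sT] /andP[-> rs].
  by rewrite (le_trans rs).
(* The identity between [m] and the primitive is known on [[0, T]] alone, so the derivative is
   transferred by equality near an interior time. *)
have near_eq : \forall s \near t, m 0 - F s = m s.
  have : \forall s \near t, s \in `]0, T[ by exact: near_in_itvoo.
  apply: filterS => s /(subset_itv_oo_cc) sT; rewrite FE//; lra.
have dG : derivable (cst (m 0) - F) t 1.
  by apply: (@derivableB _ _ _ (cst (m 0)) F); [exact: derivable_cst|exact: dF].
have nE : {near t, cst (m 0) - F =1 m} by exact: near_eq.
split; first exact: near_eq_derivable nE dG.
rewrite derive1E -(near_eq_derive _ nE) (@deriveB _ _ _ (cst (m 0)) F)//.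
rewrite derive_cst sub0r -derive1E F't EFinN; congr (- _)%E.
by rewrite /rate patchE mem_set//= fineK// kt.
Qed.

End AbsoluteContinuity.

Theorem proposition7p6 (R : realType) (X : countType) (G : graph R X)
    (hG : stochastically_complete_at_infinity G)
    (phi : R -> R) (hphi : nonlinearity phi)
    (hmuphi : (total_measure G < +oo)%E \/
              (limf_esup (fun r : R => (phi r / r)%:E) 0^'+ < +oo)%E)
    (T : R) (hT : 0 < T)
    (u0 : X -> R) (hu0 : ell1 G u0) (hu0_ge0 : forall x, 0 <= u0 x)
    (u : R -> X -> R)
    (hu_ge0 : forall (t : R) x, t \in `[0, T] -> 0 <= u t x)
    (hu : pointwise_solution G phi T u0 u)
    (hu_cont : continuous_ell1 G T u)
    (hu_bdd : forall tau : R, tau \in `]0, T[ ->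
      (ereal_sup [set (u s x)%:E | s in `[tau, T] & x in [set: X]] < +oo)%E) :
  (forall t : R, t \in `[0, T] ->
     (mass G u t
      + \int[lebesgue_measure]_(s in `[0%R, t]) killing_rate G phi u s
      = \esum_(x in [set: X]) (u0 x * gmu G x)%:E)%E) /\
  absolutely_continuous 0 T (fun t => fine (mass G u t)) /\
  {ae lebesgue_measure, forall t : R, t \in `]0, T[ ->
     derivable (fun s => fine (mass G u s)) t 1 /\
     (derive1 (fun s => fine (mass G u s)) t)%:E = (- killing_rate G phi u t)%E}.
Proof.
have d0 := stochastically_complete_defect hG.
have bal := global_balance d0 hphi hmuphi hT hu_ge0 hu hu_cont hu_bdd.
have mk := killing_measurable hphi hu_ge0 hu.
have k0 := killing_ge0 G hphi hu_ge0.
have z0 : (0 : R) \in `[0, T] by rewrite in_itv/= lexx ltW.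
split; last split.
- move=> t tT; rewrite (mass_fin hu_ge0 hu_cont tT) bal//.
  rewrite -(mass_fin hu_ge0 hu_cont z0) /mass; apply: eq_esum => x _.
  by have [_ _ _ ->] := hu.
- exact: (balance_absolutely_continuous hT mk k0 bal).
- exact: (balance_derivative hT mk k0 bal).
Qed.
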